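(* Let $X$ be a compact Hausdorff space. Then $HX$ is homeomorphic to a Tychonov cube $[0,1]^\tau$ for some uncountable cardinal $\tau$ if and only if $X$ is an openly generated $\chi$-homogeneous compactum of weight $\omega_1$.
   Context: For a compact Hausdorff space $X$, let $HM(X)$ be the set of all maps $\alpha:[0,1)\to X$ for which there exist $0=t_0<t_1<\dots<t_n=1$ such that $\alpha$ is constant on each $[t_i,t_{i+1})$. Let $C(X)$ be the set of continuous real-valued functions on $X$. For $\varphi\in C(X)$ and $0\le a<b\le 1$ define $\varphi_{(a,b)}:HM(X)\to\mathbb{R}$ by $\varphi_{(a,b)}(\alpha)=\frac{1}{b-a}\int_a^b\varphi(\alpha(t))\,dt$, and let $S_{HM}(X)$ be the set of all such functions. The map $\alpha\mapsto(\varphi_{(a,b)}(\alpha))_{\varphi_{(a,b)}\in S_{HM}(X)}$ embeds $HM(X)$ into the product $\prod_{\varphi_{(a,b)}\in S_{HM}(X)}[\min\varphi,\max\varphi]$ (product topology); $HX$ is the closure of the image of $HM(X)$ in this product. A partially ordered set is $\omega$-complete if every countable subset has a least upper bound. An $\omega$-system is a continuous inverse system of compacta of weight $\le\omega$ with surjective bonding maps, indexed by an $\omega$-complete directed set. A compactum $X$ is openly generated if $X$ is the limit of an $\omega$-system whose bonding maps are open. A space $X$ is $\chi$-homogeneous if the character $\chi(x,X)$ is the same for all points $x\in X$. *)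

(* Defs.v *)
From HB Require Import structures.
From mathcomp Require Import all_boot all_order all_algebra.
From mathcomp Require Import all_classical all_reals all_analysis.
From mathcomp Require Import Rstruct Rstruct_topology.


Unset Printing Implicit Defensive.

Import Order.TTheory GRing.Theory Num.Theory.
Import numFieldNormedType.Exports.
Local Open Scope classical_set_scope.
Local Open Scope ring_scope.

Notation R := Rdefinitions.R.

Definition homeo_via {T U : topologicalType} (A : set T) (B : set U)
    (f : T -> U) : Prop :=
  exists g : U -> T,
    (forall x, A x -> B (f x)) /\ (forall y, B y -> A (g y)) /\
    (forall x, A x -> g (f x) = x) /\ (forall y, B y -> f (g y) = y) /\
    {within A, continuous f} /\ {within B, continuous g}.

Definition homeomorphic {T U : topologicalType} (A : set T) (B : set U) : Prop :=
  exists f : T -> U, homeo_via A B f.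

(* alpha : [0,1) -> X is represented by a map R -> X; only its values on
   [0,1) matter.  It is in HM(X) iff there are 0 = t_0 < ... < t_n = 1
   with alpha constant on every [t_i, t_{i+1}). *)
Definition HM (X : Type) : set (R -> X) :=
  [set alpha | exists (n : nat) (t : nat -> R),
     t 0%N = 0 /\ t n = 1 /\
     (forall i : nat, (i < n)%N -> t i < t i.+1) /\
     (forall i : nat, (i < n)%N -> exists x : X,
        forall s, t i <= s -> s < t i.+1 -> alpha s = x)].

Definition S_HM (X : topologicalType) :=
  {p : (X -> R) * R * R |
     continuous p.1.1 /\ 0 <= p.1.2 /\ p.1.2 < p.2 /\ p.2 <= 1}.

Definition S_eval (X : topologicalType) (s : S_HM X) (alpha : R -> X) : R :=
  let phi := (proj1_sig s).1.1 in
  let a := (proj1_sig s).1.2 in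
  let b := (proj1_sig s).2 in
  (b - a)^-1 * Rintegral (@lebesgue_measure R) `[a, b] (fun t => phi (alpha t)).

Definition HM_embed (X : topologicalType) (alpha : R -> X)
    : prod_topology (fun _ : S_HM X => R) :=
  fun s => S_eval X s alpha.

Definition HX (X : topologicalType) : set (prod_topology (fun _ : S_HM X => R)) :=
  closure (HM_embed X @` HM X).

Definition tychonov_cube (J : Type) : set (prod_topology (fun _ : J => R)) :=
  [set x | forall j, 0 <= x j <= 1].

(* |S| <= omega_1: S carries a well-order all of whose proper initial
   segments are countable. *)
Definition card_le_omega1 {T : Type} (S : set T) : Prop :=
  exists r : T -> T -> Prop,
    (forall x, S x -> ~ r x x) /\
    (forall x y z, S x -> S y -> S z -> r x y -> r y z -> r x z) /\
    (forall x y, S x -> S y -> x = y \/ r x y \/ r y x) /\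
    (forall P : set T, P `<=` S -> P !=set0 ->
        exists2 m, P m & forall y, P y -> ~ r y m) /\
    (forall x, S x -> countable [set y | S y /\ r y x]).

Definition weight_omega1 (X : topologicalType) : Prop :=
  (exists B : set (set X), basis B /\ card_le_omega1 B) /\ ~ @second_countable X.

Definition local_base {X : topologicalType} (x : X) (B : set (set X)) : Prop :=
  (forall U, B U -> open U /\ U x) /\
  (forall V, nbhs x V -> exists2 U, B U & U `<=` V).

Definition chi_le {X : topologicalType} (x y : X) : Prop :=
  forall By, local_base y By ->
    exists Bx, local_base x Bx /\ card_le Bx By.

Definition chi_homogeneous (X : topologicalType) : Prop :=
  forall x y : X, chi_le x y.

Section InverseSystems.
Variables (A : Type) (le : A -> A -> Prop).

Definition partial_order : Prop :=
  (forall a, le a a) /\ (forall a b c, le a b -> le b c -> le a c) /\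
  (forall a b, le a b -> le b a -> a = b).

Definition directed_subset (B : set A) : Prop :=
  B !=set0 /\ forall a b, B a -> B b -> exists2 c, B c & le a c /\ le b c.

Definition is_lub (B : set A) (c : A) : Prop :=
  (forall b, B b -> le b c) /\ (forall u, (forall b, B b -> le b u) -> le c u).

Definition omega_complete : Prop :=
  forall B : set A, countable B -> exists c, is_lub B c.

Variables (Xs : A -> topologicalType) (p : forall a b : A, Xs b -> Xs a).

Definition inverse_system : Prop :=
  (forall a (x : Xs a), p a a x = x) /\
  (forall a b c (x : Xs c), le a b -> le b c -> p a b (p b c x) = p a c x) /\
  (forall a b, le a b -> continuous (p a b)).

Definition lim_set (B : set A)
    : set (prod_topology (fun i : {a : A | B a} => Xs (proj1_sig i))) :=
  [set x | forall i j : {a : A | B a}, le (proj1_sig i) (proj1_sig j) ->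
            p (proj1_sig i) (proj1_sig j) (x j) = x i].

Definition continuous_system : Prop :=
  forall (B : set A) (c : A), countable B -> directed_subset B -> is_lub B c ->
    homeo_via [set: Xs c] (lim_set B)
      (fun (y : Xs c) (i : {a : A | B a}) => p (proj1_sig i) c y).

Definition open_map {T U : topologicalType} (f : T -> U) : Prop :=
  forall V : set T, open V -> open (f @` V).

Definition omega_system : Prop :=
  partial_order /\ directed_subset setT /\ omega_complete /\
  inverse_system /\ continuous_system /\
  (forall a, hausdorff_space (Xs a) /\ compact [set: Xs a] /\
             @second_countable (Xs a)) /\
  (forall a b, le a b -> forall y : Xs a, exists x : Xs b, p a b x = y).

End InverseSystems.

Definition openly_generated (X : topologicalType) : Prop :=
  exists (A : Type) (le : A -> A -> Prop) (Xs : A -> topologicalType)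
         (p : forall a b : A, Xs b -> Xs a),
    omega_system A le Xs p /\
    (forall a b, le a b -> open_map (p a b)) /\
    homeomorphic [set: X] (lim_set A le Xs p setT).

(* Main.v *)
(* Suppose that [HX] is a cube.  A cube coordinate depends on countably many of the functionals
   defining [HX], and conversely; so [HX] and [X] have compatible quotients indexed by the countable
   sets [E] of coordinates and functionals closed under these dependences.  The projections of the
   cube are open, hence so are the maps [X -> X_E], as one sees near the constant functions.  As there
   are coordinates outside [E], all fibres of [X -> X_E] are nondegenerate, whence all points have
   uncountable character.  Two coordinates neither of which is generated by the other would allow one
   to glue two step functions along cube coordinates, in phase or in opposite phase, with the same
   limit under fast oscillation; this is absurd, and the weight of [X] is omega_1.

   Conversely, the projections [X -> X_a] of an open omega-system induce open maps of [HX] with convex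
   fibres.  Homogeneity of character forces the fibres in [X] to be nondegenerate, and a
   pressing-down argument then yields one function oscillating on all fibres.  Integrating it gives
   an affine function mapping every fibre in [HX] onto [0, 1].  Infinitely many such steps, trivialized
   by a parametrized Keller theorem, make the projection in [HX] from a later stage a trivial bundle
   with fibre the Hilbert cube; a recursion over omega_1 assembles these to a cube. *)

Require Import Defs.
From HB Require Import structures.
From mathcomp Require Import all_boot all_order all_algebra all_classical all_reals all_analysis.
From mathcomp Require Import Rstruct Rstruct_topology.
From mathcomp Require Import ring lra zify.
From mathcomp Require wochoice.
From Stdlib Require List.

Set Implicit Arguments.
Unset Strict Implicit.
Unset Printing Implicit Defensive.

Import Order.TTheory GRing.Theory Num.Theory.
Import numFieldNormedType.Exports.
Local Open Scope classical_set_scope.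
Local Open Scope ring_scope.

(** * Compact spaces and cubes *)

(** The parametrized Keller theorem only makes [T / r' * Q] homeomorphic to [T / r * Q] over
    [T / r], and the factor [Q] has to be removed again. This is why infinitely many steps are
    needed, and why the functions are normalized to have range [0, 1] on every fibre: the integral
    [l] of such a function makes the map (x, q) |-> (x, (l x, q)) from [T / r' * Q] to [T / r * Q] a
    uniform limit of homeomorphisms. In the inverse limit of these maps [q] is determined by [x],
    while, as in Brown's theorem on near-homeomorphisms, the limit is still [T / r * Q].

    While the cube is built, relations on [X] and on [HX] stand for their quotients. Openness then
    means that classes vary lower semicontinuously, which makes extrema over classes continuous.

    In the other direction, integrals must yield information about points. Sets of functionals are
    therefore closed under squares: an element of [HX] at which [phi] and [phi ^ 2] have the same
    integrals as at the constant function [y] gives [phi] variance zero, so it is concentrated where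
    [phi] equals [phi y]. *)

HB.instance Definition _ := NormedModule.copy R R^o.

Lemma near_lt (T : topologicalType) (f : T -> R) x (c : R) :
  {for x, continuous f} -> f x < c -> \forall y \near x, f y < c.
Proof. by move=> cf fx; exact: (cvgr_lt (f x) cf c fx). Qed.

Lemma near_gt (T : topologicalType) (f : T -> R) x (c : R) :
  {for x, continuous f} -> c < f x -> \forall y \near x, c < f y.
Proof. by move=> cf fx; exact: (cvgr_gt (f x) cf c fx). Qed.

Lemma near_dist (T : topologicalType) (f : T -> R) x (e : R) :
  {for x, continuous f} -> 0 < e -> \forall y \near x, `|f x - f y| < e.
Proof. by move=> cf e0; move/cvgrPdist_lt: (cf); exact. Qed.

Lemma continuous_pair (M A B : topologicalType) (f : M -> A) (g : M -> B) :
  continuous f -> continuous g -> continuous (fun m => (f m, g m)).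
Proof. by move=> cf cg m; apply: cvg_pair; [exact: cf | exact: cg]. Qed.

Lemma continuous_o (A B C : topologicalType) (g : B -> C) (f : A -> B) :
  continuous g -> continuous f -> continuous (fun x => g (f x)).
Proof.
by move=> cg cf x; apply: (@continuous_comp _ _ _ f g); [exact: cf | exact: cg].
Qed.

Lemma continuous_fst (A B : topologicalType) : continuous (fun p : A * B => p.1).
Proof. by move=> p; exact: cvg_fst. Qed.

Lemma continuous_snd (A B : topologicalType) : continuous (fun p : A * B => p.2).
Proof. by move=> p; exact: cvg_snd. Qed.

Lemma continuous_pairl (A B : topologicalType) (a : A) : continuous (fun b : B => (a, b)).
Proof. by move=> b; apply: cvg_pair; [exact: cvg_cst | exact: cvg_id]. Qed.

Lemma continuous_pairr (A B : topologicalType) (b : B) : continuous (fun a : A => (a, b)).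
Proof. by move=> a; apply: cvg_pair; [exact: cvg_id | exact: cvg_cst]. Qed.

Lemma sum_continuous (A : topologicalType) (n : nat) (f : nat -> A -> R) :
  (forall j, continuous (f j)) -> continuous (fun y => \sum_(j < n) f j y).
Proof.
move=> cf; elim: n => [|m IH].
  have -> : (fun y => \sum_(j < 0) f j y) = (fun=> 0 : R) by apply/funext => y; rewrite big_ord0.
  by move=> y; exact: cvg_cst.
have -> : (fun y => \sum_(j < m.+1) f j y) = (fun y => \sum_(j < m) f j y + f m y).
  by apply/funext => y; rewrite big_ord_recr.
by move=> y; apply: cvgD; [exact: IH | exact: cf].
Qed.

Section ContinuousAlgebra.
Variables (A : topologicalType) (f g : A -> R).
Hypotheses (cf : continuous f) (cg : continuous g).

Lemma cont_add : continuous (fun x => f x + g x).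
Proof. by move=> x; apply: cvgD; [exact: cf | exact: cg]. Qed.

Lemma cont_sub : continuous (fun x => f x - g x).
Proof. by move=> x; apply: cvgB; [exact: cf | exact: cg]. Qed.

Lemma cont_mul : continuous (fun x => f x * g x).
Proof. by move=> x; apply: cvgM; [exact: cf | exact: cg]. Qed.

Lemma cont_norm : continuous (fun x => `|f x|).
Proof. by move=> x; apply: cvg_norm; exact: cf. Qed.

Lemma cont_cst (B : topologicalType) (b : B) : continuous (fun _ : A => b).
Proof. by move=> x; exact: cvg_cst. Qed.

End ContinuousAlgebra.

Lemma continuous_affine (A : topologicalType) (f : A -> R) (a b : R) :
  continuous f -> continuous (fun x => a * f x + b).
Proof.
move=> cf x; apply: cvgD; last exact: cvg_cst.
by apply: cvgM; [exact: cvg_cst | exact: cf].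
Qed.

Lemma closed_pre (A B : topologicalType) (g : A -> B) (D : set B) :
  continuous g -> closed D -> closed (g @^-1` D).
Proof. by move=> cg; apply: closed_comp => x _; exact: cg. Qed.

Lemma chain_le (A : Type) (le : A -> A -> Prop) (u : nat -> A) :
  (forall a, le a a) -> (forall a b c, le a b -> le b c -> le a c) ->
  (forall n, le (u n) (u n.+1)) -> forall m n, (m <= n)%N -> le (u m) (u n).
Proof.
move=> refl trans uS m n /subnK <-; elim: (n - m)%N => [//|k IH].
by rewrite addSn; exact: trans IH (uS _).
Qed.

Lemma closed_coincidence (M Y : topologicalType) (f g : M -> Y) : hausdorff_space Y ->
  continuous f -> continuous g -> closed [set m | f m = g m].
Proof.
move=> hY cf cg; rewrite -[X in closed X]setCK closedC openE => m /= /eqP fg.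
have := hY; rewrite open_hausdorff => /(_ _ _ fg)[[U V] /= [Um Vm] [oU oV UV]].
have n1 : nbhs m (f @^-1` U) by apply: cf; apply: open_nbhs_nbhs; split => //; exact: set_mem.
have n2 : nbhs m (g @^-1` V) by apply: cg; apply: open_nbhs_nbhs; split => //; exact: set_mem.
apply: filterS2 n1 n2 => m' /= h1 h2 E; rewrite E in h1.
by have : (U `&` V) (g m') by []; rewrite (eqP UV).
Qed.

Lemma max_continuous (T : topologicalType) (f g : T -> R) : continuous f ->
  continuous g -> continuous (fun x => Num.max (f x) (g x)).
Proof.
move=> cf cg; under eq_fun do rewrite maxr_absE.
move=> x; apply: cvgMl; apply: cvgD; first by apply: cvgD; [exact: cf | exact: cg].
by apply: cvg_norm; apply: cvgB; [exact: cf | exact: cg].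
Qed.

Lemma min_continuous (T : topologicalType) (f g : T -> R) : continuous f ->
  continuous g -> continuous (fun x => Num.min (f x) (g x)).
Proof.
move=> cf cg; under eq_fun do rewrite minr_absE.
move=> x; apply: cvgMl; apply: cvgB; first by apply: cvgD; [exact: cf | exact: cg].
by apply: cvg_norm; apply: cvgB; [exact: cf | exact: cg].
Qed.

Section CompactTools.
Variables (M T : topologicalType).
Hypothesis cT : compact [set: T].

Lemma tube (G : set (M * T)) (m : M) : open G -> (forall x, G (m, x)) ->
  \forall m' \near m, forall x, G (m', x).
Proof.
move=> oG Gm; have /compact_near_coveringP cN := cT.
have sub : \forall m' \near m, [set: T] `<=` (fun x => G (m', x)).
  apply: (cN M (nbhs m) (fun m' x => G (m', x))) => x _.
  have : nbhs (m, x) G by apply: open_nbhs_nbhs; split => //; exact: Gm.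
  case=> -[U V] [Um Vx] UV; exists (V, U) => // -[x' m'] [/= Vx' Um'].
  exact: (UV (m', x')).
by apply: filterS sub => m' Gm' x; apply: Gm'.
Qed.

Lemma closed_exists (G : set (M * T)) : closed G ->
  closed [set m | exists x, G (m, x)].
Proof.
move=> cG; rewrite -[X in closed X]setCK closedC openE => m /= nG.
have : \forall m' \near m, forall x, (~` G) (m', x).
  by apply: tube; [rewrite openC | move=> x Gmx; apply: nG; exists x].
by apply: filterS => m' Gm' [x]; apply: Gm'.
Qed.

Lemma closed_graph_continuous (g : M -> T) :
  closed [set p : M * T | g p.1 = p.2] -> continuous g.
Proof.
move=> cg m U /= /nbhs_interior nU.
have : \forall m' \near m, forall x,
    (~` ([set p : M * T | g p.1 = p.2] `\` snd @^-1` (U^°))) (m', x).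
  apply: tube.
    rewrite openC; apply: closedI => //; rewrite closedC.
    by apply: open_comp => [p _|]; [exact: cvg_snd | exact: open_interior].
  by move=> x [/= <-]; apply; exact: nbhs_singleton.
apply: filterS => m' H; suff : U° (g m') by exact: interior_subset.
by apply: contrapT => nUg; apply: (H (g m')); split.
Qed.

(** The form of compactness used throughout; [I] is a set of stages, of finite lists or of natural
    numbers. *)
Lemma compact_directed (I : Type) (F : I -> set T) (i0 : I) :
  (forall i, closed (F i)) -> (forall i, F i !=set0) ->
  (forall i j, exists k, F k `<=` F i `&` F j) ->
  exists x, forall i, F i x.
Proof.
move=> Fc Fn Fd.
have FF : ProperFilter (filter_from [set: I] F).
  apply: filter_from_proper => //.
  apply: filter_from_filter; first by exists i0.
  by move=> i j _ _; have [k] := Fd i j; exists k.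
have [x [_ clx]] := cT FF filterT.
exists x => i; apply: Fc => U nU.
by apply: clx => //; exists i.
Qed.

Section Slice.
Variables (S : M -> set T) (f : T -> R).
Hypothesis cf : continuous f.
Hypothesis clS : closed [set p : M * T | S p.1 p.2].
Hypothesis S0 : forall m, S m !=set0.

Definition slice_inf (m : M) : R := inf (f @` S m).

Lemma closed_slice m : closed (S m).
Proof.
have -> : S m = (fun x => (m, x)) @^-1` [set p : M * T | S p.1 p.2] by [].
apply: closed_comp => // x _; apply: cvg_pair; [exact: cvg_cst | exact: cvg_id].
Qed.

Lemma slice_infP m : (exists2 x, S m x & f x = slice_inf m) /\
  (forall x, S m x -> slice_inf m <= f x).
Proof.
have cS : compact (S m) by apply: subclosed_compact (@closed_slice m) cT _.
have cw : {within S m, continuous f} by exact: continuous_subspaceT.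
have [x /set_mem Sx fx] := compact_EVT_min (S0 m) cS cw.
have lb : lbound (f @` S m) (f x) by move=> _ [y Sy <-]; apply: fx; exact/mem_set.
have fxE : f x = slice_inf m.
  apply/eqP; rewrite eq_le; apply/andP; split.
    by apply: lb_le_inf => //; exists (f x), x.
  by apply: ge_inf; [exists (f x) | exists x].
split; first by exists x.
by move=> y Sy; rewrite -fxE; apply: lb; exists y.
Qed.

Hypothesis lscS : forall m x U, S m x -> nbhs x U ->
  \forall m' \near m, exists2 x', S m' x' & U x'.

(** Berge's maximum theorem. Lower semicontinuity of [S] keeps the infimum from jumping up nearby;
    the closed graph and the compactness of [T] keep it from jumping down. *)
Lemma slice_inf_continuous : continuous slice_inf.
Proof.
move=> m; apply/cvgrPdist_lt => e e0.
have [[x Sx fx] lb] := slice_infP m.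
have up : \forall m' \near m, slice_inf m' < slice_inf m + e.
  have nU : nbhs x [set x' | f x' < slice_inf m + e].
    by apply: near_lt; [exact: cf | rewrite fx ltrDl].
  have := lscS Sx nU; apply: filterS => m' [x' Sx' Ux'].
  exact: le_lt_trans ((slice_infP m').2 _ Sx') Ux'.
have lo : \forall m' \near m, forall x', ~ (S m' x' /\ f x' <= slice_inf m - e).
  apply: (@tube (~` ([set p | S p.1 p.2] `&` snd @^-1` [set x' | f x' <= slice_inf m - e]))).
    rewrite openC; apply: closedI => //.
    apply: closed_comp => [p _|]; first exact: cvg_snd.
    have -> : [set x' | f x' <= slice_inf m - e] = f @^-1` [set y | y <= slice_inf m - e] by [].
    by apply: closed_comp => [? _|]; [exact: cf | exact: closed_le].
  move=> x' [/= Sx' /=]; apply/negP; rewrite -ltNge.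
  by apply: lt_le_trans (lb _ Sx'); rewrite ltrBlDr ltrDl.
near=> m'; have h1 : slice_inf m' < slice_inf m + e by near: m'.
have h2 : forall x', ~ (S m' x' /\ f x' <= slice_inf m - e) by near: m'.
have [[x' Sx' fx'] _] := slice_infP m'.
have h3 : slice_inf m - e < slice_inf m'.
  by rewrite -fx' ltNge; apply/negP => h; apply: (h2 x').
by rewrite ltr_norml; apply/andP; split; lra.
Unshelve. all: by end_near. Qed.

End Slice.
End CompactTools.

Section Tower.
Variables (T Z : topologicalType) (W : Type) (lt : W -> W -> Prop).
Hypothesis cT : compact [set: T].
Hypothesis hZ : hausdorff_space Z.
Hypothesis lt_wf : well_founded lt.
Hypothesis lt_trans : forall u v w, lt u v -> lt v w -> lt u w.
Hypothesis lt_total : forall v w, v = w \/ lt v w \/ lt w v.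
Variables (K : set T) (Psi : W -> T -> Z) (q : W -> Z).
Hypothesis clK : closed K.
Hypothesis K0 : K !=set0.
Hypothesis cPsi : forall w, continuous (Psi w).
Hypothesis step : forall w x, K x ->
  exists x', [/\ K x', forall v, lt v w -> Psi v x' = Psi v x & Psi w x' = q w].

Let closed_eq w : closed [set x | Psi w x = q w].
Proof.
have -> : [set x | Psi w x = q w] = Psi w @^-1` [set q w] by [].
apply: closed_comp => [? _|]; first exact: cPsi.
by apply: accessible_closed_set1; apply: hausdorff_accessible.
Qed.

Let upto (P : set W) := K `&` \bigcap_(v in P) [set x | Psi v x = q v].

Let closed_upto P : closed (upto P).
Proof. by apply: closedI => //; apply: closed_bigI => v _; exact: closed_eq. Qed.

Let upto_bigcup (I : Type) (P : I -> set W) :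
  (forall i j, P i `<=` P j \/ P j `<=` P i) -> (forall i, upto (P i) !=set0) ->
  upto (\bigcup_i P i) !=set0.
Proof.
move=> Pch Pn; have [[i0]|nI] := pselect (exists i : I, True).
  have [|||x Hx] := compact_directed cT (F := fun i => upto (P i)) i0.
  - by move=> i; exact: closed_upto.
  - exact: Pn.
  - move=> i j; have [s|s] := Pch i j; [exists j | exists i];
      move=> x [Kx Hx]; do 2?split => //; by move=> v /s; exact: Hx.
  - exists x; split; first by have [] := Hx i0.
    by move=> v [i _ Pv]; have [_] := Hx i; exact.
have [x Kx] := K0; exists x; split => // v [i _ _].
by case: nI; exists i.
Qed.

(** Values are prescribed along the well-order: [step] corrects the value at [w] without disturbing
    the earlier ones, and compactness supplies a point at limits. *)
Lemma tower_onto : exists2 x, K x & forall w, Psi w x = q w.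
Proof.
have le_chain w v : (fun u => u = w \/ lt u w) `<=` (fun u => u = v \/ lt u v) \/
    (fun u => u = v \/ lt u v) `<=` (fun u => u = w \/ lt u w).
  have [->|[h|h]] := lt_total v w; first by left.
  - by right => u [->|h']; right => //; apply: lt_trans h.
  - by left => u [->|h']; right => //; apply: lt_trans h.
have main w : upto (fun u => u = w \/ lt u w) !=set0.
  elim/(well_founded_ind lt_wf): w => w IH.
  have [||x [Kx Hx]] := @upto_bigcup {v | lt v w} (fun v u => u = sval v \/ lt u (sval v)).
  - by move=> i j; exact: le_chain.
  - by move=> [v vw]; exact: IH.
  - have [x' [Kx' e1 e2]] := step w Kx; exists x'; split => // u [->//|uw] /=.
    by rewrite e1 //; apply: Hx; exists (exist _ u uw) => //; left.
have [||x [Kx Hx]] := @upto_bigcup W (fun v u => u = v \/ lt u v).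
- exact: le_chain.
- exact: main.
- by exists x => // w; apply: Hx; exists w => //; left.
Qed.

End Tower.

Section ProductTopology.

Lemma prod_coord_continuous (S : Type) (K : S -> topologicalType) (s : S) :
  continuous (fun v : prod_topology K => v s).
Proof. exact: (@proj_continuous {classic S} K s). Qed.

Lemma prod_continuous (M : topologicalType) (S : Type) (K : S -> topologicalType)
    (f : M -> prod_topology K) :
  (forall s, continuous (fun m => f m s)) -> continuous f.
Proof.
move=> cf m; apply/cvg_sup => s U [V [[W oW <-] Wf] VU].
apply: (filterS VU); apply: (cf s m).
by apply: open_nbhs_nbhs; split.
Qed.

Lemma prod_hausdorff (S : Type) (K : S -> topologicalType) :
  (forall s, hausdorff_space (K s)) -> hausdorff_space (prod_topology K).
Proof. exact: (@hausdorff_product {classic S} K). Qed.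

Lemma set_val_continuous (V : topologicalType) (A : set V) :
  continuous (set_val : A -> V).
Proof. exact: initial_continuous. Qed.

Lemma set_type_continuous (V M : topologicalType) (A : set V) (f : M -> A) :
  continuous (fun m => set_val (f m)) -> continuous f.
Proof. exact: continuous_comp_initial. Qed.

Lemma set_type_nbhs (V : topologicalType) (A : set V) (a : A) (U : set A) :
  nbhs a U -> exists2 W, nbhs (set_val a) W & forall b : A, W (set_val b) -> U b.
Proof.
by case=> _ [[W oW <-] Wa] WU; exists W => //; apply: open_nbhs_nbhs.
Qed.

Lemma set_type_compact (V : topologicalType) (A : set V) :
  compact A -> compact [set: A].
Proof.
move=> cA F FF _; have FA : (set_val @ F) A.
  by apply: (@filterS _ F _ setT) => [a _|]; [exact: set_valP | exact: filterT].
have [x [Ax clx]] := cA (set_val @ F) (fmap_proper_filter _ FF) FA.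
exists (SigSub (mem_set Ax)); split => // U B FU nB.
have [W nW WB] := set_type_nbhs nB.
have FU' : (set_val @ F) (set_val @` U).
  by apply: (@filterS _ F _ U) => // u Uu; exists u.
have [_ [[u Uu <-] Wu]] := clx _ _ FU' nW.
by exists u; split => //; exact: WB.
Qed.

Lemma set_type_hausdorff (V : topologicalType) (A : set V) :
  hausdorff_space V -> hausdorff_space A.
Proof.
move=> hV a b clab; apply: val_inj; apply: hV => U B nU nB.
have [||c [Uc Bc]] := clab (set_val @^-1` U) (set_val @^-1` B).
- exact: (set_val_continuous nU).
- exact: (set_val_continuous nB).
- by exists (set_val c).
Qed.

End ProductTopology.

Section Cube.
Variable J : Type.
Definition cube := set_type (tychonov_cube J).
HB.instance Definition _ := Topological.on cube.

Definition cu (s : cube) (j : J) : R := (set_val s : prod_topology (fun=> R)) j.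

Lemma cuP s j : 0 <= cu s j <= 1.
Proof. exact: (set_valP s j). Qed.

Definition mk_cube (f : J -> R) (H : forall j, 0 <= f j <= 1) : cube :=
  SigSub (mem_set (H : tychonov_cube J f)).

Lemma cu_mk f H j : cu (@mk_cube f H) j = f j.
Proof. by []. Qed.

Lemma cu_inj s s' : (forall j, cu s j = cu s' j) -> s = s'.
Proof. by move=> e; apply: val_inj; apply/funext. Qed.

Lemma cu_continuous j : continuous (fun s => cu s j).
Proof.
move=> s; apply: (@continuous_comp _ _ _ (set_val : cube -> _)
  (fun v : prod_topology (fun _ : J => R) => v j)).
  exact: set_val_continuous.
exact: prod_coord_continuous.
Qed.

Lemma continuous_cu (M : topologicalType) (h : M -> cube) j :
  continuous h -> continuous (fun m => cu (h m) j).
Proof. exact: (continuous_o (@cu_continuous j)). Qed.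

Lemma cube_continuous (M : topologicalType) (f : M -> cube) :
  (forall j, continuous (fun m => cu (f m) j)) -> continuous f.
Proof.
by move=> cf; apply: set_type_continuous; apply: prod_continuous.
Qed.

Lemma tychonov_cube_compact : compact (tychonov_cube J).
Proof.
have -> : tychonov_cube J = [set f | forall j, `[0, 1]%classic (f j)].
  by apply/seteqP; split => f /= H j; have := H j; rewrite in_itv.
apply: (@tychonoff {classic J} (fun=> R) (fun=> `[0, 1]%classic)) => _.
exact: segment_compact.
Qed.

Lemma cube_compact : compact [set: cube].
Proof. exact: set_type_compact tychonov_cube_compact. Qed.

Lemma R_hausdorff : hausdorff_space R.
Proof. exact: norm_hausdorff. Qed.

Lemma cube_hausdorff : hausdorff_space cube.
Proof.
by apply: set_type_hausdorff; apply: prod_hausdorff => _; exact: R_hausdorff.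
Qed.

End Cube.

Notation Q := (cube nat).

(** * Fibrewise absorption of Hilbert cubes *)

(** Kernels of open maps with convex fibres: [mix l x y] is the combination with weight [l] at [y],
    and [good_open] is openness of the quotient map, written as lower semicontinuity of the
    classes. *)
Record good_rel (T : topologicalType) (mix : R -> T -> T -> T) (r : T -> T -> Prop)
    : Prop := GoodRel {
  good_refl : forall x, r x x;
  good_sym : forall x y, r x y -> r y x;
  good_trans : forall x y z, r x y -> r y z -> r x z;
  good_closed : closed [set p : T * T | r p.1 p.2];
  good_open : forall x x' U, r x x' -> nbhs x' U ->
    \forall y \near x, exists2 y', r y y' & U y';
  good_mix : forall l x y z, 0 <= l <= 1 -> r x y -> r x z -> r x (mix l y z) }.

(* A parametrized form of Keller's theorem that infinite-dimensional convex compacta are Hilbert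
   cubes, once multiplied by [Q].  A pair [(x, s)] is coded by a sequence [control] of numbers, where
   the [n]-th one is placed by [s n] between the bounds [lA] and [uB], which keep it both close to
   [f n x] and in the range of [f n] on the points of the class compatible with the previous ones.
   The latter range is fattened by [eps n / 2] on each side: the resulting slack makes the set of
   compatible points vary lower semicontinuously.  [tau] rescales this range to [0, 1]. *)
Section Trivialization.
Variables (T : topologicalType) (mix : R -> T -> T -> T).
Hypothesis cT : compact [set: T].
Hypothesis mix_near : forall x y U, nbhs x U -> exists2 l, 0 < l <= 1 & U (mix l x y).
Variables (r : T -> T -> Prop) (c : nat -> T -> R) (e0 : R).
Hypothesis gr : good_rel mix r.
Hypothesis cc : forall j, continuous (c j).
Hypothesis c_mix : forall j l x y, 0 <= l <= 1 ->
  c j (mix l x y) = (1 - l) * c j x + l * c j y.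
Hypothesis e0_gt0 : 0 < e0.

Let eps (n : nat) : R := e0 / n.+1%:R.
(* Every index occurs infinitely often, at smaller and smaller scales. *)
Let f (n : nat) := c (logn 2 n.+1).

Let eps_gt0 n : 0 < eps n. Proof. by rewrite divr_gt0 ?ltr0n. Qed.

Let cf n : continuous (f n). Proof. exact: cc. Qed.

Let f_mix n l x y : 0 <= l <= 1 -> f n (mix l x y) = (1 - l) * f n x + l * f n y.
Proof. exact: c_mix. Qed.

Definition band n (x : T) (t : nat -> R) : set T :=
  [set x' | r x x' /\ forall i, (i < n)%N -> `|t i - f i x'| <= eps i].

Let lo n x t : R := inf (f n @` band n x t).
(** A supremum, written so that continuity of [slice_inf] covers both ends of the range. *)
Let up n x t : R := - inf ((fun y => - f n y) @` band n x t).
Let lA n x t : R := Num.max (f n x - eps n) (lo n x t - eps n / 2).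
Let uB n x t : R := Num.min (f n x + eps n) (up n x t + eps n / 2).

(** A prefix is a whole sequence, zero from [n] on, because [band n] reads only the entries below
    [n]. *)
Fixpoint control_prefix n (m : T * Q) : nat -> R :=
  if n is n'.+1 then let t := control_prefix n' m in
    fun i => if i == n' then lA n' m.1 t + cu m.2 n' * (uB n' m.1 t - lA n' m.1 t)
             else t i
  else fun=> 0.

Definition control (m : T * Q) (n : nat) : R := control_prefix n.+1 m n.

Let control_prefixE n m i : (i < n)%N -> control_prefix n m i = control m i.
Proof.
elim: n => // n IH; rewrite ltnS leq_eqVlt => /orP[/eqP->//|lt_in] /=.
by rewrite (ltn_eqF lt_in) IH.
Qed.

Let band_ext n x x' (t t' : nat -> R) : r x x' ->
  (forall i, (i < n)%N -> t i = t' i) -> band n x t = band n x' t'.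
Proof.
move=> rx e; apply/seteqP; split => y [ry H]; split.
- exact: (good_trans gr (good_sym gr rx) ry).
- by move=> i lt_in; rewrite -e //; exact: H.
- exact: (good_trans gr rx ry).
- by move=> i lt_in; rewrite e //; exact: H.
Qed.

Let lm n m := lo n m.1 (control m).
Let um n m := up n m.1 (control m).

Let controlE n m : control m n = lA n m.1 (control m) + cu m.2 n * (uB n m.1 (control m) - lA n m.1 (control m)).
Proof.
rewrite {1}/control /= eqxx.
have e : band n m.1 (control_prefix n m) = band n m.1 (control m).
  by apply: band_ext; [exact: (good_refl gr) | exact: control_prefixE].
by rewrite /lA /uB /lo /up e.
Qed.

(** The invariant of the recursion. Its last clause, lower semicontinuity of the compatible points,
    is what makes the bounds for the next control continuous. *)
Let P n := [/\ forall i, (i < n)%N -> continuous (fun m => control m i),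
  forall m, band n m.1 (control m) m.1
  & forall m x U, band n m.1 (control m) x -> nbhs x U ->
      \forall m' \near m, exists2 x', band n m'.1 (control m') x' & U x'].

Section Level.
Variable n : nat.
Hypothesis Pn : P n.

Let S (m : T * Q) := band n m.1 (control m).

Local Lemma clS : closed [set p : T * Q * T | S p.1 p.2].
Proof.
have -> : [set p : T * Q * T | S p.1 p.2] =
    [set p | r p.1.1 p.2] `&`
    \bigcap_(i in [set i | (i < n)%N]) [set p | `|control p.1 i - f i p.2| <= eps i].
  apply/seteqP; split => -[m x] /= [rx H]; split => // i /=; exact: H.
have c1 : continuous (fun p : T * Q * T => p.1) by move=> p; exact: cvg_fst.
have c2 : continuous (fun p : T * Q * T => p.2) by move=> p; exact: cvg_snd.
apply: closedI.
  apply: (@closed_pre _ _ (fun p : T * Q * T => (p.1.1, p.2)) _ _ (good_closed gr)).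
  move=> p; apply: cvg_pair; last exact: c2.
  by apply: (@continuous_comp _ _ _ fst fst); [exact: c1 | exact: cvg_fst].
apply: closed_bigI => i lt_in.
apply: (@closed_pre _ _ (fun p : T * Q * T => `|control p.1 i - f i p.2|) [set y | y <= eps i]).
  move=> p; apply: cvg_norm; apply: cvgB.
    have [H _ _] := Pn.
    by apply: (@continuous_comp _ _ _ fst (fun m => control m i)); [exact: c1 | exact: H].
  by apply: (@continuous_comp _ _ _ snd (f i)); [exact: c2 | exact: cf].
exact: closed_le.
Qed.

Local Lemma S0 m : S m !=set0. Proof. by exists m.1; have [_ H _] := Pn; exact: H. Qed.

Local Lemma lm_cont : continuous (lm n).
Proof.
have [_ _ H] := Pn.
exact: (slice_inf_continuous cT (@cf n) clS S0 H).
Qed.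

Local Lemma cNf : continuous (fun y => - f n y).
Proof. by move=> x; apply: cvgN; exact: cf. Qed.

Local Lemma um_cont : continuous (um n).
Proof.
have [_ _ H] := Pn; move=> m; apply: cvgN.
exact: (slice_inf_continuous cT cNf clS S0 H).
Qed.

Local Lemma lmP m : (exists2 x, S m x & f n x = lm n m) /\ forall x, S m x -> lm n m <= f n x.
Proof. exact: (slice_infP cT (@cf n) clS S0). Qed.

Local Lemma umP m : (exists2 x, S m x & f n x = um n m) /\ forall x, S m x -> f n x <= um n m.
Proof.
have [[x Sx ex] H] := slice_infP cT cNf clS S0 m; split.
  by exists x => //; rewrite -[LHS]opprK ex.
by move=> y Sy; rewrite -[leLHS]opprK lerN2; exact: H.
Qed.

Local Lemma S_self m : S m m.1. Proof. by have [_ H _] := Pn; exact: H. Qed.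

Local Lemma lu m : lm n m <= f n m.1 <= um n m.
Proof. by rewrite (lmP m).2 ?(umP m).2 //; exact: S_self. Qed.

Local Lemma S_mix m l x y : 0 <= l <= 1 -> S m x -> S m y -> S m (mix l x y).
Proof.
move=> l01 [rx Hx] [ry Hy]; split; first exact: (good_mix gr).
move=> i lt_in; rewrite f_mix //.
have := Hx i lt_in; have := Hy i lt_in; rewrite !ler_norml.
by move=> /andP[? ?] /andP[? ?]; apply/andP; split; nra.
Qed.

(** Slater's condition: the next constraint, with tolerance [eps n], is met with half of it to spare
    by a minimizer of [f n], a maximizer, or a mixture of both. *)
Lemma band_slater m (s : R) : lm n m - eps n / 2 <= s <= um n m + eps n / 2 ->
  exists2 y, S m y & `|s - f n y| <= eps n / 2.
Proof.
move=> /andP[s1 s2]; have e := eps_gt0 n.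
have [[a Sa ea] _] := lmP m; have [[b Sb eb] _] := umP m.
have [h1|h1] := leP s (lm n m).
  by exists a => //; rewrite ea ler_norml; apply/andP; split; lra.
have [h2|h2] := leP (um n m) s.
  by exists b => //; rewrite eb ler_norml; apply/andP; split; lra.
have d : 0 < um n m - lm n m by lra.
pose l := (s - lm n m) / (um n m - lm n m).
have l01 : 0 <= l <= 1.
  by rewrite /l divr_ge0 ?ler_pdivrMr ?mul1r //; lra.
exists (mix l a b); first exact: S_mix.
rewrite f_mix // ea eb.
have -> : (1 - l) * lm n m + l * um n m = lm n m + l * (um n m - lm n m) by ring.
have -> : s - (lm n m + l * (um n m - lm n m)) = 0.
  by rewrite /l divfK ?gt_eqF //; ring.
by rewrite normr0; lra.
Qed.

(** The admissible interval has length at least [eps n], so [s n] can be recovered from the control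
    in [triv_inj]. *)
Local Lemma control_bounds m : [/\ lA n m.1 (control m) + eps n <= uB n m.1 (control m),
  f n m.1 - eps n <= lA n m.1 (control m), lm n m - eps n / 2 <= lA n m.1 (control m),
  uB n m.1 (control m) <= f n m.1 + eps n & uB n m.1 (control m) <= um n m + eps n / 2].
Proof.
have e := eps_gt0 n; have /andP[] := lu m; rewrite /lm /um => h1 h2.
rewrite /lA /uB; split; rewrite ?le_max ?ge_min ?lexx ?orbT //.
by rewrite maxEle minEle; do 2 case: ifP => _; lra.
Qed.

Lemma control_range m : [/\ lm n m - eps n / 2 <= control m n, control m n <= um n m + eps n / 2
  & `|control m n - f n m.1| <= eps n].
Proof.
have [h1 h2 h3 h4 h5] := control_bounds m; have /andP[s0 s1] := cuP m.2 n; have e := eps_gt0 n.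
have a1 : lA n m.1 (control m) <= control m n by rewrite [leRHS]controlE; nra.
have a2 : control m n <= uB n m.1 (control m) by rewrite [leLHS]controlE; nra.
by split; [lra | lra | rewrite ler_norml; apply/andP; split; lra].
Qed.

Local Lemma control_cont : continuous (fun m => control m n).
Proof.
have c1 : continuous (fun m : T * Q => f n m.1).
  by move=> m; apply: (@continuous_comp _ _ _ fst (f n)); [exact: cvg_fst | exact: cf].
have cA : continuous (fun m : T * Q => lA n m.1 (control m)).
  apply: max_continuous => m.
    by apply: cvgB; [exact: c1 | exact: cvg_cst].
  by apply: cvgB; [exact: lm_cont | exact: cvg_cst].
have cB : continuous (fun m : T * Q => uB n m.1 (control m)).
  apply: min_continuous => m.
    by apply: cvgD; [exact: c1 | exact: cvg_cst].
  by apply: cvgD; [exact: um_cont | exact: cvg_cst].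
have cs : continuous (fun m : T * Q => cu m.2 n).
  by move=> m; apply: (@continuous_comp _ _ _ snd (fun s : Q => cu s n));
    [exact: cvg_snd | exact: cu_continuous].
have -> : (fun m => control m n) =
  (fun m => lA n m.1 (control m) + cu m.2 n * (uB n m.1 (control m) - lA n m.1 (control m))).
  by apply/funext => m; exact: controlE.
move=> m; apply: cvgD; first exact: cA.
by apply: cvgM; [exact: cs | apply: cvgB; [exact: cB | exact: cA]].
Qed.

Local Lemma P_step : P n.+1.
Proof.
have [H1 H2 H3] := Pn; split.
- by move=> i; rewrite ltnS leq_eqVlt => /orP[/eqP->|]; [exact: control_cont | exact: H1].
- move=> m; split; first exact: (good_refl gr).
  move=> i; rewrite ltnS leq_eqVlt => /orP[/eqP->|lt_in].
    by have [] := control_range m.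
  by have [_] := H2 m; exact.
move=> m x U [rx Hx] nU.
have Sx : S m x by split => // i lt_in; apply: Hx; exact: ltnW.
have hx := Hx n (ltnSn n); have e := eps_gt0 n.
have [t1 t2 _] := control_range m.
have [y Sy hy] : exists2 y, S m y & `|control m n - f n y| <= eps n / 2.
  by apply: band_slater; rewrite t1 t2.
(* A small admixture of the point [y] with slack makes the new constraint strict without leaving
   [U]; strict constraints survive small changes of [m]. *)
have [l /andP[l0 l1] Uz] := mix_near y (nbhs_interior nU).
set z := mix l x y in Uz.
have Sz : S m z by apply: S_mix => //; rewrite (ltW l0).
have hz : `|control m n - f n z| < eps n.
  rewrite f_mix ?(ltW l0) //; move: hx hy; rewrite !ler_norml ltr_norml.
  by move=> /andP[? ?] /andP[? ?]; apply/andP; split; nra.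
pose d := (eps n - `|control m n - f n z|) / 2.
have d0 : 0 < d by rewrite divr_gt0 // subr_gt0.
have nV : nbhs z (U `&` [set w | `|f n z - f n w| < d]).
  apply: filterI => //; exact: (near_dist (@cf n z) d0).
have near1 := H3 m z _ Sz nV.
have near2 : \forall m' \near m, `|control m n - control m' n| < d.
  exact: (near_dist (@control_cont m) d0).
near=> m'.
have [w [rw Hw] [Uw dw]] : exists2 w, S m' w & (U `&` [set w | `|f n z - f n w| < d]) w.
  by near: m'.
have dm : `|control m n - control m' n| < d by near: m'.
exists w => //; split => // i; rewrite ltnS leq_eqVlt => /orP[/eqP->|]; last exact: Hw.
have -> : control m' n - f n w =
   - (control m n - control m' n) + ((control m n - f n z) + (f n z - f n w)) by ring.
apply: le_trans (ler_normD _ _) _; rewrite normrN.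
have := ler_normD (control m n - f n z) (f n z - f n w).
by move: dm dw; rewrite /d /=; lra.
Unshelve. all: by end_near. Qed.

End Level.

Let allP n : P n.
Proof.
elim: n => [|n]; last exact: P_step.
split => //; first by move=> m; split => //; exact: (good_refl gr).
move=> m x U [rx _] nU.
have := good_open gr rx nU => H.
have : \forall m' \near m, exists2 y', r m'.1 y' & U y'.
  exact: (@cvg_fst T Q (nbhs m.1) (nbhs m.2) _ _ H).
by apply: filterS => m' [x' rx' Ux']; exists x'.
Qed.

Definition tau (m : T * Q) (n : nat) : R :=
  (control m n - (lm n m - eps n / 2)) / (um n m - lm n m + eps n).

Let wid n m : 0 < um n m - lm n m + eps n.
Proof.
by have := lu (allP n) m; have := eps_gt0 n; move=> ? /andP[? ?]; lra.
Qed.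

Lemma tau01 m n : 0 <= tau m n <= 1.
Proof.
have [h1 h2 _] := control_range (allP n) m; have w := wid n m.
by rewrite /tau divr_ge0 ?ler_pdivrMr ?mul1r //; lra.
Qed.

Definition triv (m : T * Q) : Q := mk_cube (tau01 m).

Lemma triv_continuous : continuous triv.
Proof.
apply: cube_continuous => n m; have Pn := allP n.
rewrite /triv /=.
have -> : (fun m => cu (mk_cube (tau01 m)) n) = (fun m => tau m n) by [].
apply: cvgM.
  apply: cvgB; first exact: control_cont.
  by apply: cvgB; [exact: lm_cont | exact: cvg_cst].
apply: cvgV; first by rewrite gt_eqF.
apply: cvgD; last exact: cvg_cst.
by apply: cvgB; [exact: um_cont | exact: lm_cont].
Qed.

Let rel_lu n m m' : r m.1 m'.1 -> (forall i, (i < n)%N -> control m i = control m' i) ->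
  lm n m = lm n m' /\ um n m = um n m'.
Proof. by move=> rm e; rewrite /lm /um /lo /up (band_ext rm e). Qed.

Lemma triv_resp x x' s : r x x' -> (forall j, c j x = c j x') ->
  triv (x, s) = triv (x', s).
Proof.
move=> rx ec; apply: cu_inj => n.
have e k : forall i, (i < k)%N -> control (x, s) i = control (x', s) i.
  elim: k => // k IH i; rewrite ltnS leq_eqVlt => /orP[/eqP->|]; last exact: IH.
  rewrite 2!controlE /=; have [e1 e2] := @rel_lu k (x, s) (x', s) rx IH.
  by rewrite /lA /uB -/(lm k (x, s)) -/(um k (x, s)) -/(lm k (x', s)) -/(um k (x', s))
    e1 e2 /f ec.
have [e1 e2] := @rel_lu n (x, s) (x', s) rx (e n).
by rewrite /triv !cu_mk /tau e1 e2 (e n.+1).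
Qed.

(** The controls are decoded in order, since each range depends only on the previous ones. They
    approximate every [c j] arbitrarily well, so they determine all [c j x]; these in turn fix the
    bounds, and hence [s]. *)
Lemma triv_inj x x' s s' : r x x' -> triv (x, s) = triv (x', s') ->
  (forall j, c j x = c j x') /\ s = s'.
Proof.
move=> rx et.
have etau n : tau (x, s) n = tau (x', s') n by have := congr1 (fun q => cu q n) et.
have e k : forall i, (i < k)%N -> control (x, s) i = control (x', s') i.
  elim: k => // k IH i; rewrite ltnS leq_eqVlt => /orP[/eqP->|]; last exact: IH.
  have := etau k; have [e1 e2] := @rel_lu k (x, s) (x', s') rx IH.
  rewrite /tau -e1 -e2 => /(mulIf _) H.
  have := H _; rewrite invr_eq0 gt_eqF // => /(_ isT).
  by move/addIr.
have ec j : c j x = c j x'.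
  apply/eqP; rewrite -subr_eq0 -normr_le0; apply/ler_addgt0Pr => d d0; rewrite add0r.
  (* The odd cofactor makes [f k.-1] equal to [c j], and is large enough for [eps k.-1 <= d / 2]. *)
  pose k := (2 ^ j * (Num.truncn (2 * e0 / d)).*2.+1)%N.
  have k0 : (0 < k)%N by rewrite muln_gt0 expn_gt0.
  have fk : f k.-1 = c j.
    rewrite /f prednK // lognM ?expn_gt0 // pfactorK //.
    by rewrite [logn 2 _.+1]lognE dvdn2 /= odd_double addn0.
  have [_ _ b1] := control_range (allP k.-1) (x, s).
  have [_ _ b2] := control_range (allP k.-1) (x', s').
  move: b1 b2; rewrite -(e k.-1.+1) // /= fk => b1 b2.
  have -> : c j x - c j x' = - (control (x, s) k.-1 - c j x) + (control (x, s) k.-1 - c j x') by ring.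
  apply: le_trans (ler_normD _ _) _; rewrite normrN.
  suff : eps k.-1 <= d / 2 by lra.
  rewrite /eps prednK // ler_pdivrMr ?ltr0n //.
  have t1 : 2 * e0 / d < k%:R.
    apply: lt_le_trans (truncnS_gt _) _; rewrite ler_nat.
    rewrite /k -{1}[_.+1]mul1n leq_mul ?expn_gt0 //.
    by rewrite ltnS -addnn leq_addr.
  by move: t1; rewrite ltr_pdivrMr //; lra.
split => //; apply: cu_inj => n.
have := e n.+1 n (ltnSn n); rewrite 2!controlE /=.
have [e1 e2] := @rel_lu n (x, s) (x', s') rx (e n).
have [w _ _ _ _] := control_bounds (allP n) (x, s).
move: w; rewrite /lA /uB -/(lm n (x, s)) -/(um n (x, s)) -/(lm n (x', s')) -/(um n (x', s'))
    e1 e2 /f /= !ec.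
set a := Num.max _ _; set b := Num.min _ _ => w /addrI /mulIf; apply.
by rewrite gt_eqF // subr_gt0; apply: lt_le_trans w; rewrite ltrDl.
Qed.

(** Coordinates are prescribed one at a time. To change the one at [n], the base point is replaced
    by a point [y] compatible with the old controls and the new one, and the cube parameters
    reproducing these controls at [y] are solved for. *)
Lemma triv_onto x (q : Q) : exists2 m, r x m.1 & triv m = q.
Proof.
suff [m rm H] : exists2 m, r x m.1 & forall n, tau m n = cu q n.
  by exists m => //; apply: cu_inj => n; rewrite -H.
have cTQ : compact [set: T * Q].
  by rewrite -setXTT; apply: compact_setX cT (@cube_compact _).
apply: (@tower_onto (T * Q)%type R nat (fun i j => (i < j)%N) cTQ (@R_hausdorff)
  _ _ _ [set m : T * Q | r x m.1] (fun n m => tau m n) (cu q)).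
- by elim/ltn_ind => k IH; constructor.
- by move=> a b d; exact: ltn_trans.
- by move=> a b; case: (ltngtP a b) => [?|?|->]; auto.
- apply: (@closed_pre _ _ (fun m : T * Q => (x, m.1)) _ _ (good_closed gr)).
  by move=> m; apply: cvg_pair; [exact: cvg_cst | exact: cvg_fst].
- by exists (x, q); exact: (good_refl gr).
- move=> n m; apply: (@continuous_comp _ _ _ triv (fun s : Q => cu s n)).
    exact: triv_continuous.
  exact: cu_continuous.
move=> n m rm.
have /andP[q0 q1] := cuP q n; have w := wid n m; have en := eps_gt0 n.
pose s := lm n m - eps n / 2 + cu q n * (um n m - lm n m + eps n).
have [y [ry Hy] hy] : exists2 y, band n m.1 (control m) y & `|s - f n y| <= eps n / 2.
  by apply: (band_slater (allP n)); rewrite /s; apply/andP; split; nra.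
(* The controls wanted at [y], the bounds [a] and [b] that [y] imposes on them, and below their
   relative positions [sg]. *)
pose g i := if (i < n)%N then control m i else s.
pose a i := Num.max (f i y - eps i) (lm i m - eps i / 2).
pose b i := Num.min (f i y + eps i) (um i m + eps i / 2).
have gab i : (i <= n)%N -> [/\ a i <= g i, g i <= b i & a i < b i].
  rewrite leq_eqVlt => le_in; have e := eps_gt0 i.
  have [h1 h2 h3] : [/\ lm i m - eps i / 2 <= g i, g i <= um i m + eps i / 2
    & `|g i - f i y| <= eps i].
    rewrite /g; case/orP: le_in => [/eqP->|lt_in].
      by rewrite ltnn; split; [rewrite /s; nra | rewrite /s; nra | apply: le_trans hy _; lra].
    have [? ? _] := control_range (allP i) m.
    by rewrite lt_in; split => //; exact: Hy.
  have : band i m.1 (control m) y.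
    split => // k lt_ki; apply: Hy; case/orP: le_in => [/eqP<-//|]; exact: ltn_trans.
  move=> By; have := (lmP (allP i) m).2 y By; have := (umP (allP i) m).2 y By => u1 l1.
  move: h3; rewrite ler_norml => /andP[h3 h4]; rewrite /a /b; split.
  - by rewrite ge_max; apply/andP; split; lra.
  - by rewrite le_min; apply/andP; split; lra.
  - by rewrite maxEle minEle; do 2 case: ifP => _; lra.
pose sg i := if (i <= n)%N then (g i - a i) / (b i - a i) else 0.
have sg01 i : 0 <= sg i <= 1.
  rewrite /sg; case: ifP => [/gab[h1 h2 h3]|_]; last by rewrite lexx ler01.
  by rewrite divr_ge0 ?ler_pdivrMr ?mul1r ?lerB ?subr_ge0 ?subr_gt0 // ltW.
pose m' := (y, mk_cube sg01).
have rmm : r m.1 m'.1 by [].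
have key k : (k <= n.+1)%N -> forall i, (i < k)%N -> control m' i = g i.
  elim: k => // k IH le_kn i; rewrite ltnS leq_eqVlt => /orP[/eqP->|]; last first.
    by apply: IH; exact: ltnW.
  have e1 j : (j < k)%N -> control m j = control m' j.
    move=> lt_jk; rewrite IH //; last exact: ltnW.
    by rewrite /g (leq_trans lt_jk).
  have [el eu] := rel_lu rmm e1.
  have [g1 g2 g3] := gab k le_kn.
  rewrite controlE /lA /uB -/(lm k m') -/(um k m') -el -eu /= -/(a k) -/(b k).
  by rewrite cu_mk /sg -ltnS le_kn divfK ?subr_eq0 ?gt_eqF // addrC subrK.
have key' i : (i <= n)%N -> control m' i = g i by move=> le_in; apply: (key n.+1).
exists m'; split.
- exact: (good_trans gr rm rmm).
- move=> i lt_in.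
  have e1 j : (j < i)%N -> control m j = control m' j.
    move=> lt_ji; rewrite key' /g ?(ltn_trans lt_ji) //.
    by apply: ltnW; exact: ltn_trans lt_in.
  have [el eu] := rel_lu rmm e1.
  by rewrite /tau -el -eu key' ?(ltnW lt_in) // /g lt_in.
have e1 j : (j < n)%N -> control m j = control m' j.
  by move=> lt_jn; rewrite key' /g ?lt_jn // ltnW.
have [el eu] := rel_lu rmm e1.
rewrite /tau -el -eu key' // /g ltnn /s addrC addKr.
by rewrite mulfK // gt_eqF.
Qed.

(** As [c 0] has minimum 0 and maximum 1 on the class, the first fattened range is
    [- e0 / 2, 1 + e0 / 2]; rescaling it to [0, 1] hardly moves a control that is already within
    [e0] of [c 0 x]. *)
Lemma triv_approx x s : (forall y, r x y -> 0 <= c 0 y <= 1) ->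
  (exists2 y, r x y & c 0 y = 0) -> (exists2 y, r x y & c 0 y = 1) ->
  `|cu (triv (x, s)) 0 - c 0 x| <= 2 * e0.
Proof.
move=> c01 [y0 ry0 cy0] [y1 ry1 cy1].
have E : eps 0 = e0 by rewrite /eps divr1.
have f0 : f 0 = c 0 by rewrite /f logn1.
have B0 y : r x y -> band 0 x (control (x, s)) y by [].
have [[a [ra _] ea] la] := lmP (allP 0) (x, s).
have [[b [rb _] eb] ub] := umP (allP 0) (x, s).
have l0 : lm 0 (x, s) = 0.
  apply/eqP; rewrite eq_le; apply/andP; split.
    by have := la y0 (B0 y0 ry0); rewrite f0 cy0.
  by rewrite -ea f0; have /andP[] := c01 a ra.
have u1 : um 0 (x, s) = 1.
  apply/eqP; rewrite eq_le; apply/andP; split.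
    by rewrite -eb f0; have /andP[] := c01 b rb.
  by have := ub y1 (B0 y1 ry1); rewrite f0 cy1.
have [h1 h2 h3] := control_range (allP 0) (x, s).
have /andP[t0 t1] := tau01 (x, s) 0.
have eT : control (x, s) 0 = tau (x, s) 0 * (1 + e0) - e0 / 2.
  rewrite /tau l0 u1 E subr0 sub0r divfK; first ring.
  by rewrite gt_eqF // addr_gt0.
move: h3; rewrite f0 E /= eT /triv cu_mk !ler_norml => /andP[h3 h4].
by apply/andP; split; nra.
Qed.

End Trivialization.

Section Controlled.
Variables (T : topologicalType) (mix : R -> T -> T -> T).
Hypothesis cT : compact [set: T].
Hypothesis mix_near : forall x y U, nbhs x U -> exists2 l, 0 < l <= 1 & U (mix l x y).
Variables (r : T -> T -> Prop) (c : nat -> T -> R).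
Hypothesis gr : good_rel mix r.
Hypothesis cc : forall j, continuous (c j).
Hypothesis c_mix : forall j l x y, 0 <= l <= 1 ->
  c j (mix l x y) = (1 - l) * c j x + l * c j y.
Hypothesis c01 : forall y, 0 <= c 0 y <= 1.
Hypothesis c0_ex : forall x, exists2 y, r x y & c 0 y = 0.
Hypothesis c1_ex : forall x, exists2 y, r x y & c 0 y = 1.

(** Makes the trivialization uniformly close to (x, s) |-> (c 0 x, s). The first [N] coordinates of
    [s] bypass [triv] and are inserted behind its first output, which is near [c 0 x]; only the tail
    of [s] is consumed. *)
Lemma controlled_trivialization (N : nat) : exists G : T * Q -> Q, [/\ continuous G,
  forall x x' s, r x x' -> (forall j, c j x = c j x') -> G (x, s) = G (x', s),
  forall x x' s s', r x x' -> G (x, s) = G (x', s') -> (forall j, c j x = c j x') /\ s = s',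
  forall x q, exists2 m, r x m.1 & G m = q
  & forall x s, `|cu (G (x, s)) 0 - c 0 x| <= N.+1%:R^-1 /\
      forall i, (i < N)%N -> cu (G (x, s)) i.+1 = cu s i].
Proof.
pose e0 : R := N.+1%:R^-1 / 2.
have e0_gt0 : 0 < e0 by rewrite divr_gt0 // invr_gt0 ltr0n.
pose tail (s : Q) : Q := mk_cube (fun j => cuP s (N + j)%N).
pose H := triv cT mix_near gr cc c_mix e0_gt0.
pose g (m : T * Q) (i : nat) : R :=
  if i == 0%N then cu (H (m.1, tail m.2)) 0
  else if (i <= N)%N then cu m.2 i.-1 else cu (H (m.1, tail m.2)) (i - N)%N.
have g01 m i : 0 <= g m i <= 1 by rewrite /g; do 2?case: ifP => _; exact: cuP.
pose G m : Q := mk_cube (g01 m).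
have cH : continuous (fun m : T * Q => H (m.1, tail m.2)).
  apply: (@continuous_o _ _ _ H (fun m : T * Q => (m.1, tail m.2))).
    exact: triv_continuous.
  apply: continuous_pair; first exact: continuous_fst.
  apply: cube_continuous => j.
  by apply: (@continuous_cu nat (T * Q)%type (fun m => m.2)); exact: continuous_snd.
have Gtail x x' s s' : G (x, s) = G (x', s') ->
    H (x, tail s) = H (x', tail s') /\ forall i, (i < N)%N -> cu s i = cu s' i.
  move=> e; have eg i : g (x, s) i = g (x', s') i by have := congr1 (fun q => cu q i) e.
  split; last by move=> i iN; have := eg i.+1; rewrite /g /= iN.
  apply: cu_inj => -[|i]; first exact: (eg 0%N).
  have := eg (N + i.+1)%N.
  by rewrite /g addnS /= ltnNge leq_addr /= subSn ?leq_addr // addKn.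
exists G; split.
- apply: cube_continuous => i.
  have -> : (fun m => cu (G m) i) = g^~ i by [].
  rewrite /g; case: (i == 0%N); last case: (i <= N)%N.
  + exact: continuous_cu cH.
  + by apply: continuous_cu; exact: continuous_snd.
  + exact: continuous_cu cH.
- move=> x x' s rx ec; apply: cu_inj => i; rewrite !cu_mk /g /=.
  by rewrite /H (triv_resp _ _ _ _ _ _ _ rx ec).
- move=> x x' s s' rx /Gtail[e1 e2].
  have [ec es] := triv_inj rx e1; split => //; apply: cu_inj => i.
  have [iN|Ni] := ltnP i N; first exact: e2.
  by have := congr1 (fun q => cu q (i - N)%N) es; rewrite !cu_mk subnKC.
- move=> x q.
  pose q1 : Q := mk_cube (fun i => cuP q (if i == 0%N then 0%N else (N + i)%N)).
  have [[y s] ry ey] := triv_onto cT mix_near gr cc c_mix e0_gt0 x q1.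
  pose s' : Q := mk_cube (fun i => (fun b => if b as b0 return
      0 <= (if b0 then cu q i.+1 else cu s (i - N)%N) <= 1 then cuP q i.+1 else cuP s (i - N)%N)
      (i < N)%N).
  have ts : tail s' = s.
    by apply: cu_inj => j; rewrite !cu_mk ltnNge leq_addr /= addKn.
  exists (y, s') => //; apply: cu_inj => i; rewrite cu_mk /g /= ts /H ey.
  case: i => [|i] /=; first by rewrite cu_mk.
  have [iN|Ni] := ltnP i N; first by rewrite cu_mk iN.
  by rewrite cu_mk subn_eq0 leqNgt ltnS Ni subnKC // ltnW.
- move=> x s; split.
    rewrite cu_mk /g /=.
    apply: le_trans (triv_approx cT mix_near gr cc c_mix e0_gt0 _ _ (c0_ex x) (c1_ex x)) _ => //.
    by rewrite /e0 mulrC divfK.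
  by move=> i iN; rewrite cu_mk /g /= iN.
Qed.

End Controlled.

(** Uniform continuity in the second variable. The tolerance [2 / N.+1] is the distance between two
    points that are both within [1 / N.+1] of a common one. *)
Lemma modulus (T : topologicalType) (C : T * Q -> Q) (k N0 : nat) :
  compact [set: T] -> continuous C -> exists2 N, (N0 <= N)%N &
  forall x q q', (forall i, (i < N)%N -> `|cu q i - cu q' i| <= 2 / N.+1%:R) ->
    forall i, (i < k)%N -> `|cu (C (x, q)) i - cu (C (x, q')) i| < k.+1%:R^-1.
Proof.
move=> cT cC.
pose d (p : T * Q * Q) (i : nat) := `|cu (C p.1) i - cu (C (p.1.1, p.2)) i|.
have cq (h : T * Q * Q -> Q) i : continuous h -> continuous (fun p => cu (h p) i).
  exact: continuous_cu.
have c1 : continuous (fun p : T * Q * Q => p.1) by exact: continuous_fst.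
have c2 : continuous (fun p : T * Q * Q => p.2) by exact: continuous_snd.
have c11 : continuous (fun p : T * Q * Q => p.1.1).
  exact: (continuous_o (@continuous_fst _ _) c1).
have c12 : continuous (fun p : T * Q * Q => p.1.2).
  exact: (continuous_o (@continuous_snd _ _) c1).
have cd i : continuous (d^~ i).
  move=> p; apply: cvg_norm; apply: cvgB; apply: cq.
    exact: (continuous_o cC c1).
  exact: (continuous_o cC (continuous_pair c11 c2)).
have one i : exists2 N, (N0 <= N)%N & forall x q q',
    (forall j, (j < N)%N -> `|cu q j - cu q' j| <= 2 / N.+1%:R) ->
    `|cu (C (x, q)) i - cu (C (x, q')) i| < k.+1%:R^-1.
  apply: contrapT => H.
  pose F N := [set p : T * Q * Q | k.+1%:R^-1 <= d p i] `&`
    \bigcap_(j in [set j | (j < N + N0)%N])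
       [set p | `|cu p.1.2 j - cu p.2 j| <= 2 / (N + N0).+1%:R].
  have cTQ : compact [set: T * Q * Q].
    by rewrite -!setXTT; do 2?apply: compact_setX => //; exact: cube_compact.
  have [|||[[x q] q'] Hp] := compact_directed cTQ (F := F) 0%N.
  - move=> N; apply: closedI.
      by apply: (@closed_pre _ _ (d^~ i) [set y | k.+1%:R^-1 <= y]); last exact: closed_ge.
    apply: closed_bigI => j _.
    apply: (@closed_pre _ _ (fun p : T * Q * Q => `|cu p.1.2 j - cu p.2 j|)
      [set y | y <= 2 / (N + N0).+1%:R]); last exact: closed_le.
    by move=> p; apply: cvg_norm; apply: cvgB; apply: cq.
  - move=> N; apply: contrapT => FN0; apply: H; exists (N + N0)%N; first exact: leq_addl.
    move=> x q q' Hq; rewrite ltNge; apply/negP => h; apply: FN0.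
    by exists ((x, q), q'); split => //= j; exact: Hq.
  - have mono N N' : (N <= N')%N -> F N' `<=` F N.
      move=> le_N p [h1 h2]; split => // j /= jN; apply: le_trans (h2 j _) _ => /=.
        by apply: leq_trans jN _; rewrite leq_add2r.
      rewrite ler_pM2l // lef_pV2 ?posrE ?ltr0n // ler_nat ltnS leq_add2r //.
    by move=> N N'; exists (maxn N N') => p Fp; split; apply: mono Fp;
      rewrite ?leq_maxl ?leq_maxr.
  have eqq : q = q'.
    apply: cu_inj => j; apply/eqP; rewrite -subr_eq0 -normr_le0.
    apply/ler_addgt0Pr => e e_gt0; rewrite add0r.
    pose N := (Num.truncn (2 / e) + j.+1)%N.
    have [_ h] := Hp N; apply: le_trans (h j _) _ => /=.
      by rewrite /N; lia.
    rewrite ler_pdivrMr ?ltr0n // mulrC -ler_pdivrMr //.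
    by apply/ltW; apply: lt_le_trans (truncnS_gt _) _; rewrite ler_nat /N ltnS -addnA leq_addr.
  have [+ _] := Hp 0%N; rewrite /d /= eqq subrr normr0.
  by rewrite leNgt invr_gt0 ltr0n.
suff main k' : exists2 N, (N0 <= N)%N &
    forall x q q', (forall i, (i < N)%N -> `|cu q i - cu q' i| <= 2 / N.+1%:R) ->
    forall i, (i < k')%N -> `|cu (C (x, q)) i - cu (C (x, q')) i| < k.+1%:R^-1 by exact: main.
elim: k' => [|k' [N leN IH]]; first by exists N0.
have [N' leN' H] := one k'.
have weak M M' (q q' : Q) : (M <= M')%N ->
    (forall i, (i < M')%N -> `|cu q i - cu q' i| <= 2 / M'.+1%:R) ->
    forall i, (i < M)%N -> `|cu q i - cu q' i| <= 2 / M.+1%:R.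
  move=> le_M Hq i iM; apply: le_trans (Hq i (leq_trans iM le_M)) _.
  by rewrite ler_pM2l // lef_pV2 ?posrE ?ltr0n // ler_nat ltnS.
exists (maxn N N'); first by rewrite leq_max leN.
move=> x q q' Hq i; rewrite ltnS leq_eqVlt => /orP[/eqP->|].
  by apply: H; apply: weak Hq; exact: leq_maxr.
by apply: IH; apply: weak Hq; exact: leq_maxl.
Qed.

Section Absorb.
Variables (T : topologicalType) (mix : R -> T -> T -> T).
Hypothesis cT : compact [set: T].
Hypothesis mix_near : forall x y U, nbhs x U -> exists2 l, 0 < l <= 1 & U (mix l x y).
Variables (r : nat -> T -> T -> Prop) (c : nat -> nat -> T -> R).
Hypothesis gr : forall n, good_rel mix (r n).
Hypothesis cc : forall n j, continuous (c n j).
Hypothesis c_mix : forall n j l x y, 0 <= l <= 1 ->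
  c n j (mix l x y) = (1 - l) * c n j x + l * c n j y.
Hypothesis rS : forall n x y, r n.+1 x y <-> r n x y /\ forall j, c n j x = c n j y.
Hypothesis c01 : forall n y, 0 <= c n 0 y <= 1.
Hypothesis c0_ex : forall n x, exists2 y, r n x y & c n 0 y = 0.
Hypothesis c1_ex : forall n x, exists2 y, r n x y & c n 0 y = 1.

Let r_le m n x y : (m <= n)%N -> r n x y -> r m x y.
Proof.
move=> /subnK <-; elim: (n - m)%N => [|k IH]; first by rewrite add0n.
by rewrite addSn => /rS[/IH].
Qed.

(* The sections [l_n = c n 0] make [T / (meet of the r_n)] an inverse limit of the
   spaces [T / r_n * cube], along the maps [(x, q) |-> (x, (l_n x, q))].  Each of these
   is approximated by the homeomorphism [gam n N]; if [N] grows quickly enough, the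
   iterates [C n] forget their second argument in the limit. *)
Lemma absorb : exists Psi : T -> Q, [/\ continuous Psi,
  forall x y, (forall n, r n x y) -> Psi x = Psi y,
  forall x y, r 0 x y -> Psi x = Psi y -> forall n, r n x y
  & forall x q, exists2 y, r 0 x y & Psi y = q].
Proof.
have /choice[gam0 gamP0] : forall p : nat * nat, exists G : T * Q -> Q, [/\ continuous G,
    forall x x' s, r p.1.+1 x x' -> G (x, s) = G (x', s),
    forall x x' s s', r p.1 x x' -> G (x, s) = G (x', s') -> r p.1.+1 x x' /\ s = s',
    forall x q, exists2 m, r p.1 x m.1 & G m = q
    & forall x s, `|cu (G (x, s)) 0 - c p.1 0 x| <= p.2.+1%:R^-1 /\
        forall i, (i < p.2)%N -> cu (G (x, s)) i.+1 = cu s i].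
  move=> [n N] /=; have [G [G1 G2 G3 G4 G5]] := controlled_trivialization cT mix_near
    (gr n) (@cc n) (@c_mix n) (c01 n) (c0_ex n) (c1_ex n) N.
  exists G; split => //; first by move=> x x' s /rS[]; exact: G2.
  by move=> x x' s s' rx /(G3 _ _ _ _ rx)[? ->]; split => //; apply/rS.
have /choice[md0 mdP0] : forall p : (T * Q -> Q) * nat * nat, exists N, (p.2 <= N)%N /\
    (continuous p.1.1 ->
     forall x q q', (forall i, (i < N)%N -> `|cu q i - cu q' i| <= 2 / N.+1%:R) ->
     forall i, (i < p.1.2)%N -> `|cu (p.1.1 (x, q)) i - cu (p.1.1 (x, q')) i| < p.1.2.+1%:R^-1).
  move=> [[C k] N0] /=; have [cC|] := pselect (continuous C); last by exists N0.
  by have [N leN H] := modulus k N0 cT cC; exists N.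
pose gam n N := gam0 (n, N); pose md C k N0 := md0 (C, k, N0).
(* [C n] composes the first [n] trivializations; [N n] is chosen only afterwards, from the modulus
   of continuity of [C n]. *)
pose st := fix st n : (T * Q -> Q) * nat := if n is n'.+1 then
  let N := md (st n').1 n' (st n').2 in (fun m => (st n').1 (m.1, gam n' N m), N)
  else (snd, 0%N).
pose C n := (st n).1; pose N n := (st n.+1).2; pose G n := gam n (N n).
have CS n x q : C n.+1 (x, q) = C n (x, G n (x, q)) by [].
have GP n := gamP0 (n, N n).
have cC n : continuous (C n).
  elim: n => [|n IH]; first exact: continuous_snd.
  apply: (continuous_o IH); apply: continuous_pair; first exact: continuous_fst.
  by have [] := GP n.
have Nmono n : (N n <= N n.+1)%N by have [] := mdP0 (C n.+1, n.+1, N n).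
have Nle m n : (m <= n)%N -> (N m <= N n)%N.
  move=> /subnK <-; elim: (n - m)%N => // k IH; rewrite addSn.
  exact: leq_trans IH (Nmono _).
have NP n : forall x q q', (forall i, (i < N n)%N -> `|cu q i - cu q' i| <= 2 / (N n).+1%:R) ->
    forall i, (i < n)%N -> `|cu (C n (x, q)) i - cu (C n (x, q')) i| < n.+1%:R^-1.
  by have [_] := mdP0 (C n, n, (st n).2); apply; exact: cC.
pose D := fix D n k (x : T) (s : Q) : Q := if k is k'.+1 then G n (x, D n.+1 k' x s) else s.
have CD n k x s : C (n + k)%N (x, s) = C n (x, D n k x s).
  by elim: k n => [|k IH] n; rewrite ?addn0 // -addSnnS IH CS.
(* Whatever [s] is, coordinate [i] of the remaining composite is near [c (n + i) 0 x]: the map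
   number [n + i] writes it as its first coordinate, and the maps applied afterwards only shift
   it. *)
have Dapp i n k x s : (i < k)%N -> (i <= N n)%N ->
    `|cu (D n k x s) i - c (n + i)%N 0%N x| <= (N n).+1%:R^-1.
  elim: i n k => [|i IH] n [|k] // ik iN /=.
    by have [_ _ _ _ /(_ x (D n.+1 k x s))[]] := GP n; rewrite addn0.
  have [_ _ _ _ /(_ x (D n.+1 k x s))[_ ->]] // := GP n.
  rewrite -addSnnS; apply: le_trans (IH n.+1 k ik _) _.
    by apply: leq_trans (Nmono n); exact: ltnW.
  by rewrite lef_pV2 ?posrE ?ltr0n // ler_nat ltnS.
have contr n x s s' i : (i < n)%N ->
    `|cu (C (n + N n)%N (x, s)) i - cu (C (n + N n)%N (x, s')) i| < n.+1%:R^-1.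
  rewrite !CD; apply: NP => j jN.
  have := Dapp j n (N n) x s jN (ltnW jN); have := Dapp j n (N n) x s' jN (ltnW jN).
  rewrite !ler_norml; move: (N n).+1%:R^-1 => v /andP[? ?] /andP[? ?].
  by apply/andP; split; lra.
have Cdec m n x s : (m <= n)%N -> exists s', C n (x, s) = C m (x, s').
  by move=> /subnKC <-; rewrite CD; exists (D m (n - m)%N x s).
have Cresp n x x' s : r n x x' -> C n (x, s) = C n (x', s).
  elim: n s => // n IH s /[dup] rx /rS[rx' _]; rewrite !CS.
  have -> : G n (x, s) = G n (x', s) by have [_ H _ _ _] := GP n; exact: H.
  exact: IH.
have Cinj n x x' s s' : r 0 x x' -> C n (x, s) = C n (x', s') -> r n x x' /\ s = s'.
  move=> rx; elim: n s s' => // n IH s s'; rewrite !CS => /IH[rn].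
  by have [_ _ H _ _] := GP n; exact: H.
have Conto n x q : exists2 m, r 0 x m.1 & C n m = q.
  elim: n q => [|n IH] q; first by exists (x, q) => //; exact: (good_refl (gr 0)).
  have [[y s] ry es] := IH q.
  have [_ _ _ /(_ y s)[[z t] rz et] _] := GP n.
  exists (z, t); first exact: (good_trans (gr 0) ry (r_le (leq0n n) rz)).
  have {}et : G n (z, t) = s by [].
  by rewrite CS et -es; apply/esym; exact: Cresp.
(* The images under [C n] of the fibre over [x] decrease with [n], and by [contr] they shrink to one
   point, which becomes [Psi x]. *)
pose lim x q := forall n, exists s, C n (x, s) = q.
have lim_uniq x q q' : lim x q -> lim x q' -> q = q'.
  move=> lq lq'; apply: cu_inj => i; apply/eqP; rewrite -subr_eq0 -normr_le0.
  apply/ler_addgt0Pr => e e_gt0; rewrite add0r.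
  pose n := (Num.truncn e^-1 + i.+1)%N.
  have [s es] := lq (n + N n)%N; have [s' es'] := lq' (n + N n)%N.
  have iN : (i < n)%N by rewrite /n addnS ltnS leq_addl.
  have := contr n x s s' i iN; rewrite es es' => /ltW/le_trans; apply.
  rewrite invf_ple ?posrE ?ltr0n //.
  by apply/ltW; apply: lt_le_trans (truncnS_gt _) _; rewrite ler_nat /n ltnS leq_addr.
have q0 : Q by apply: (@mk_cube nat (fun=> 0)) => _; rewrite lexx ler01.
have clim n : closed [set p : T * Q | exists s, C n (p.1, s) = p.2].
  apply: (closed_exists (@cube_compact nat)
    (G := [set p : T * Q * Q | C n (p.1.1, p.2) = p.1.2])).
  apply: (closed_coincidence (@cube_hausdorff nat)).
    apply: (continuous_o (@cC n)); apply: continuous_pair; last exact: continuous_snd.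
    exact: (continuous_o (@continuous_fst _ _) (@continuous_fst _ _)).
  exact: (continuous_o (@continuous_snd _ _) (@continuous_fst _ _)).
have lim_ex x : exists q, lim x q.
  apply: (compact_directed (@cube_compact nat) (F := fun n => [set q | exists s, C n (x, s) = q]) 0%N).
  - by move=> n; apply: (@closed_pre _ _ (fun q : Q => (x, q)) _ _ (clim n));
      exact: continuous_pairl.
  - by move=> n; exists (C n (x, q0)), q0.
  - move=> m n; exists (maxn m n) => q [s <-]; split.
      by have [s' ->] := Cdec m _ x s (leq_maxl m n); exists s'.
    by have [s' ->] := Cdec n _ x s (leq_maxr m n); exists s'.
have /choice[Psi PsiP] := lim_ex.
exists Psi; split.
- apply: (closed_graph_continuous (@cube_compact nat)).
  have -> : [set p : T * Q | Psi p.1 = p.2] =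
      \bigcap_(n in [set: nat]) [set p | exists s, C n (p.1, s) = p.2].
    apply/seteqP; split => -[x q] /=; first by move=> <- n _; exact: PsiP.
    by move=> H; apply: lim_uniq (PsiP x) _ => n; exact: (H n).
  by apply: closed_bigI => n _; exact: clim.
- move=> x y rxy; apply: (lim_uniq x) (PsiP x) _ => n.
  by have [s <-] := PsiP y n; exists s; exact: Cresp.
- move=> x y rxy e n; have [s es] := PsiP x n; have [s' es'] := PsiP y n.
  by have [] := Cinj n x y s s' rxy _; rewrite ?es ?es'.
move=> x q.
have [|||y Hy] := compact_directed cT
    (F := fun n => [set y | r 0 x y] `&` [set y | exists s, C n (y, s) = q]) 0%N.
- move=> n; apply: closedI.
    apply: (@closed_pre _ _ (fun y => (x, y)) _ _ (good_closed (gr 0))).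
    exact: continuous_pairl.
  apply: (@closed_pre _ _ (fun y => (y, q)) _ _ (clim n)).
  exact: continuous_pairr.
- by move=> n; have [[y s] ry es] := Conto n x q; exists y; split => //; exists s.
- move=> m n; exists (maxn m n) => y [ry [s es]]; split; split => //.
    by have [s' e] := Cdec m _ y s (leq_maxl m n); exists s'; rewrite -e.
  by have [s' e] := Cdec n _ y s (leq_maxr m n); exists s'; rewrite -e.
exists y; first by have [] := Hy 0%N.
by apply: lim_uniq (PsiP y) _ => n; have [] := Hy n.
Qed.

End Absorb.

(** * Step functions and the convex compactum HX *)

Definition partition01 (n : nat) (t : nat -> R) : Prop :=
  [/\ t 0 = 0, t n = 1 & forall i, (i < n)%N -> t i < t i.+1].

Section Partitions.
Variables (n : nat) (t : nat -> R).
Hypothesis pt : partition01 n t.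

Lemma part_le i j : (i <= j)%N -> (j <= n)%N -> t i <= t j.
Proof.
have [_ _ H] := pt; elim: j => [|j IH]; first by rewrite leqn0 => /eqP->.
rewrite leq_eqVlt => /orP[/eqP->//|]; rewrite ltnS => ij jn.
by apply: le_trans (IH ij (ltnW jn)) _; exact: ltW (H _ jn).
Qed.

Lemma part01 i : (i <= n)%N -> 0 <= t i <= 1.
Proof.
have [t0 t1 _] := pt => le_in.
by rewrite -{1}t0 -t1 !part_le.
Qed.

Lemma part_locate s : 0 <= s < 1 -> exists2 i, (i < n)%N & t i <= s < t i.+1.
Proof.
have [t0 t1 _] := pt; rewrite -{1}t0 -t1 => /andP[s0].
elim: n => [|m IH]; first by move=> h; have := le_lt_trans s0 h; rewrite ltxx.
have [/IH[i im ti] _|sm s1] := ltP s (t m); first by exists i => //; exact: ltnW.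
by exists m; rewrite // sm.
Qed.

Definition part_idx (s : R) : nat := \sum_(i < n) (t i.+1 <= s)%R.

Lemma part_idxE j s : (j < n)%N -> t j <= s < t j.+1 -> part_idx s = j.
Proof.
move=> jn /andP[h1 h2]; rewrite /part_idx -(big_mkord xpredT (fun i => (t i.+1 <= s)%R : nat)).
rewrite (big_cat_nat (n := j)) //=; last exact: ltnW.
rewrite (eq_big_nat _ _ (F2 := fun=> 1%N)); last first.
  by move=> i /andP[_ ij]; rewrite (le_trans _ h1) // part_le // ltnW.
rewrite sum_nat_const_nat subn0 muln1 big_nat_cond big1 ?addn0 // => i /andP[/andP[ji iN] _].
by rewrite leNgt (lt_le_trans h2) // part_le.
Qed.

End Partitions.

Lemma partition_through (D : seq R) : exists n t, partition01 n t /\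
  forall d, d \in D -> 0 <= d <= 1 -> exists2 k, (k <= n)%N & t k = d.
Proof.
pose u := undup (0 :: 1 :: [seq d <- D | 0 <= d <= 1]).
pose s := sort <=%R u.
have ms d : (d \in s) = (d \in 0 :: 1 :: [seq d <- D | 0 <= d <= 1]).
  by rewrite mem_sort mem_undup.
have s01 d : d \in s -> 0 <= d <= 1.
  rewrite ms !inE => /or3P[/eqP->|/eqP->|]; rewrite ?lexx ?ler01 //.
  by rewrite mem_filter => /andP[].
have srt : sorted <%R s by rewrite sort_lt_sorted undup_uniq.
have sz : (1 < size s)%N.
  have : {subset [:: 0; 1 : R] <= s} by move=> d; rewrite ms !inE => /orP[]->; rewrite ?orbT.
  by move/uniq_leq_size; apply; rewrite /= inE andbT eq_sym oner_eq0.
have lt_nth i j : (i < j)%N -> (j < size s)%N -> nth 0 s i < nth 0 s j.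
  move=> ij js; apply: (sorted_ltn_nth lt_trans 0 srt) => //; rewrite inE.
  exact: ltn_trans js.
have le_nth i j : (i <= j)%N -> (j < size s)%N -> nth 0 s i <= nth 0 s j.
  by rewrite leq_eqVlt => /orP[/eqP->//|ij js]; apply/ltW/lt_nth.
exists (size s).-1, (nth 0 s); split; first split.
- have m0 : 0 \in s by rewrite ms inE eqxx.
  have : index 0 s \in [pred i | (i < size s)%N] by rewrite inE index_mem.
  rewrite inE => h; have := le_nth 0%N _ (leq0n _) h; rewrite nth_index // => h0.
  apply/eqP; rewrite eq_le h0 /=.
  by have /andP[] := s01 _ (mem_nth 0 (ltnW sz)).
- have m1 : 1 \in s by rewrite ms !inE eqxx orbT.
  have h : (index (1%R : R) s <= (size s).-1)%N by rewrite -ltnS prednK ?index_mem // ltnW.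
  have := le_nth _ _ h; rewrite prednK ?(ltnW sz) // => /(_ (leqnn _)).
  rewrite nth_index // => h1; apply/eqP; rewrite eq_le h1 andbT.
  have hs : ((size s).-1 < size s)%N by rewrite prednK // ltnW.
  by have /andP[] := s01 _ (mem_nth 0 hs).
- by move=> i h; apply: lt_nth => //; rewrite -ltn_predRL.
- move=> d dD d01; have : d \in s by rewrite ms !inE mem_filter d01 dD !orbT.
  move=> ds; exists (index d s); last exact: nth_index.
  by rewrite -ltnS prednK ?index_mem // ltnW.
Qed.

Section HM_breaks.
Variable Y : Type.
Implicit Type al : R -> Y.

(** Step functions by finite lists of possible jumps, in any order and possibly outside [0, 1], so
    that lists for several functions are merged by concatenation. The interval is closed on the
    right because steps are closed on the left. *)
Definition breaks (D : seq R) al := forall s s', 0 <= s -> s <= s' -> s' < 1 ->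
  (forall d, d \in D -> ~ (s < d <= s')) -> al s = al s'.

Lemma breaks_part D al n t i s : breaks D al -> partition01 n t ->
  (forall d, d \in D -> 0 <= d <= 1 -> exists2 k, (k <= n)%N & t k = d) ->
  (i < n)%N -> t i <= s < t i.+1 -> al s = al (t i).
Proof.
move=> bD pt tD iN /andP[ti si]; apply/esym; apply: bD => //.
- by have /andP[] := part01 pt (ltnW iN).
- by apply: lt_le_trans si _; have /andP[] := part01 pt iN.
move=> d dD /andP[td ds].
have d01 : 0 <= d <= 1.
  apply/andP; split.
    by apply: le_trans (ltW td); have /andP[] := part01 pt (ltnW iN).
  by apply/ltW; apply: le_lt_trans ds _; apply: lt_le_trans si _; have /andP[] := part01 pt iN.
have [k kn tk] := tD d dD d01.
have [ki|ik] := leqP k i.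
  by have := part_le pt ki (ltnW iN); rewrite tk leNgt td.
by have := part_le pt ik kn; rewrite tk leNgt (le_lt_trans ds).
Qed.

Lemma HM_of_breaks D al : breaks D al -> HM Y al.
Proof.
move=> bD; have [n [t [pt tD]]] := partition_through D.
exists n, t; have [t0 t1 ts] := pt; do 3 split => //.
move=> i iN; exists (al (t i)) => s ti si.
by apply: breaks_part bD pt tD iN _; rewrite ti.
Qed.

Lemma breaks_of_HM al : HM Y al -> exists D, breaks D al.
Proof.
move=> [n [t [t0 [t1 [ts tx]]]]]; have pt : partition01 n t by [].
exists (mkseq t n.+1) => s s' s0 ss' s1 H.
have [|i iN /andP[h1 h2]] := part_locate pt (s := s); first by rewrite s0 (le_lt_trans ss').
have [x xP] := tx i iN; rewrite (xP s) // (xP s') //; first exact: le_trans ss'.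
rewrite ltNge; apply/negP => h; apply: (H (t i.+1)); last by rewrite h2.
by apply: map_f; rewrite mem_iota add0n ltnS.
Qed.

End HM_breaks.

Lemma HM_map2 (A B C : Type) (g : A -> B -> C) al be :
  HM A al -> HM B be -> HM C (fun s => g (al s) (be s)).
Proof.
move=> /breaks_of_HM[D bD] /breaks_of_HM[E bE].
apply: (@HM_of_breaks _ (D ++ E)) => s s' s0 ss' s1 H; congr g.
  by apply: bD => // d dD; apply: H; rewrite mem_cat dD.
by apply: bE => // d dE; apply: H; rewrite mem_cat dE orbT.
Qed.

Lemma HM_cst (A : Type) (a : A) : HM A (fun=> a).
Proof. exact: (@HM_of_breaks _ [::]). Qed.

Lemma HM_map (A B : Type) (g : A -> B) al : HM A al -> HM B (fun s => g (al s)).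
Proof. by move=> h; exact: (HM_map2 (fun a _ => g a) h (HM_cst tt)). Qed.

Lemma HM_idx n t : partition01 n t -> HM nat (part_idx n t).
Proof.
move=> pt; apply: (@HM_of_breaks _ (mkseq t n.+1)) => s s' s0 ss' s1 H.
have [|i iN /andP[h1 h2]] := part_locate pt (s := s); first by rewrite s0 (le_lt_trans ss').
rewrite !(@part_idxE n t pt i) ?h1 ?h2 //= (le_trans h1) //= ltNge; apply/negP => h.
apply: (H (t i.+1)); last by rewrite h2.
by apply: map_f; rewrite mem_iota add0n ltnS.
Qed.

(** * Integrals of step functions *)

Lemma measure_itvco (a b : R) : a <= b ->
  @lebesgue_measure R `[a, b[%classic = (b - a)%:E.
Proof.
rewrite le_eqVlt => /orP[/eqP->|ab]; rewrite lebesgue_measure_itv /= lte_fin.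
  by rewrite ltxx subrr.
by rewrite ab EFinB.
Qed.

Section Integral.
Variable Y : Type.
Notation mu := (@lebesgue_measure R).

Definition hm_int (al : R -> Y) (psi : Y -> R) (a b : R) : R :=
  Rintegral mu `[a, b[ (fun s => psi (al s)).

Variables (al : R -> Y) (hal : HM Y al).

Lemma HM_integrable psi : mu.-integrable `[0, 1[ (EFin \o (fun s => psi (al s))).
Proof.
case: hal => n [t [t0 [t1 [ts tx]]]]; have pt : partition01 n t by [].
have [mf [M bM]] :
    @measurable_fun _ _ (measurableTypeR R) (measurableTypeR R) `[0, t n[ (fun s => psi (al s)) /\
    exists M, forall s, 0 <= s < t n -> `|psi (al s)| <= M.
  elim: {-2}n (leqnn n) => [_|k IH kn].
    rewrite t0; split; first by rewrite set_itvco0; exact: measurable_fun_set0.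
    by exists 0 => s /andP[h1 h2]; have := le_lt_trans h1 h2; rewrite ltxx.
  have [mf [M bM]] := IH (ltnW kn); have [x xP] := tx k kn; split.
    rewrite (@itv_bndbnd_setU _ _ _ (BLeft (t k))); last 2 first.
      by rewrite bnd_simp; have /andP[] := part01 pt (ltnW kn).
      by rewrite bnd_simp; exact: ltW (ts k kn).
    apply/measurable_funU => //; split => //.
    apply: (@eq_measurable_fun _ _ _ _ _ (fun=> psi x)); last exact: measurable_cst.
    by move=> s; rewrite inE /= in_itv /= => /andP[h1 h2]; rewrite (xP s).
  exists (Num.max M `|psi x|) => s /andP[h1 h2].
  have [h|h] := ltP s (t k); first by rewrite le_max bM ?h1.
  by rewrite (xP s) // le_max lexx orbT.
rewrite t1 in mf bM; apply: measurable_bounded_integrable => //.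
  have h : (@lebesgue_measure R `[0%R, 1%R[%classic < +oo)%E.
    by rewrite measure_itvco ?ler01 // ltry.
  exact: h.
exists M; split; first exact: num_real.
move=> z Mz s /=; rewrite in_itv /= => h; apply: le_trans (ltW Mz); exact: bM.
Qed.

Lemma HM_integrable_sub psi a b : 0 <= a -> b <= 1 ->
  mu.-integrable `[a, b[ (EFin \o (fun s => psi (al s))).
Proof.
move=> a0 b1; apply: integrableS (HM_integrable psi) => //.
by apply: subset_itv; rewrite bnd_simp.
Qed.

Lemma hm_int_cc psi a b : 0 <= a -> b <= 1 ->
  Rintegral mu `[a, b] (fun s => psi (al s)) = hm_int al psi a b.
Proof.
move=> a0 b1; rewrite /hm_int -Rintegral_itv_bndo_bndc //.
exact: HM_integrable_sub.
Qed.

Lemma hm_int_add psi a b c : 0 <= a -> a <= b -> b <= c -> c <= 1 ->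
  hm_int al psi a c = hm_int al psi a b + hm_int al psi b c.
Proof.
move=> a0 ab bc c1; rewrite /hm_int (@itv_bndbnd_setU _ _ _ (BLeft b)) ?bnd_simp //.
rewrite Rintegral_setU //.
  rewrite -itv_bndbnd_setU ?bnd_simp //; exact: HM_integrable_sub.
apply/disj_setPS => s [/=]; rewrite !in_itv /= => /andP[_ sb] /andP[].
by rewrite leNgt sb.
Qed.

Lemma hm_int_lin psi psi' (k : R) a b : 0 <= a -> b <= 1 ->
  hm_int al (fun y => psi y + k * psi' y) a b =
  hm_int al psi a b + k * hm_int al psi' a b.
Proof.
move=> a0 b1; rewrite /hm_int RintegralD //; try exact: HM_integrable_sub.
  by rewrite RintegralZl //; exact: HM_integrable_sub.
exact: (HM_integrable_sub (fun y => k * psi' y)).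
Qed.

Lemma hm_int_le psi psi' a b : 0 <= a -> b <= 1 -> (forall y, psi y <= psi' y) ->
  hm_int al psi a b <= hm_int al psi' a b.
Proof. by move=> a0 b1 H; apply: le_Rintegral => //; exact: HM_integrable_sub. Qed.

End Integral.

Lemma hm_int_cst (Y : Type) (al : R -> Y) psi (v a b : R) : a <= b ->
  (forall s, a <= s < b -> psi (al s) = v) -> hm_int al psi a b = (b - a) * v.
Proof.
move=> ab H; rewrite /hm_int (@eq_Rintegral _ _ _ _ _ (fun=> v)); last first.
  by move=> s; rewrite inE /= in_itv /=; exact: H.
by rewrite Rintegral_cst // [X in fine X](measure_itvco ab) mulrC.
Qed.

Lemma hm_int_eq (Y Y' : Type) (al : R -> Y) (al' : R -> Y') psi psi' a b :
  (forall s, a <= s < b -> psi (al s) = psi' (al' s)) ->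
  hm_int al psi a b = hm_int al' psi' a b.
Proof.
by move=> H; apply: eq_Rintegral => s; rewrite inE /= in_itv /=; exact: H.
Qed.

(** On every interval of a common partition [be] follows [al] for the fraction [1 - l] of the time,
    then [al']. Integrals between partition points then combine exactly, and the partition is made
    to contain the endpoints in [D0]. *)
Lemma hm_mix (Y : Type) (al al' : R -> Y) (l : R) (D0 : seq R) : HM Y al -> HM Y al' ->
  0 <= l <= 1 -> exists2 be, HM Y be & forall psi a b, a \in D0 -> b \in D0 ->
    0 <= a -> a <= b -> b <= 1 ->
    hm_int be psi a b = (1 - l) * hm_int al psi a b + l * hm_int al' psi a b.
Proof.
move=> hal hal' /andP[l0 l1].
have [D bD] := breaks_of_HM hal; have [E bE] := breaks_of_HM hal'.
have [n [t [pt tD]]] := partition_through (D ++ E ++ D0).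
have [t0 tn ts] := pt.
pose m i := t i + (1 - l) * (t i.+1 - t i).
have mt i : (i < n)%N -> t i <= m i <= t i.+1.
  by move=> iN; have := ts i iN => h; rewrite /m; apply/andP; split; nra.
pose e s := s < m (part_idx n t s).
have he : HM bool e.
  apply: (@HM_of_breaks _ (mkseq t n.+1 ++ mkseq m n)) => s s' s0 ss' s1 H.
  have [|i iN /andP[h1 h2]] := part_locate pt (s := s); first by rewrite s0 (le_lt_trans ss').
  have h3 : s' < t i.+1.
    rewrite ltNge; apply/negP => h; apply: (H (t i.+1)); last by rewrite h2.
    by rewrite mem_cat; apply/orP; left; apply: map_f; rewrite mem_iota add0n ltnS.
  rewrite /e !(@part_idxE n t pt i) ?h1 ?h2 ?h3 ?(le_trans h1) //.
  apply/idP/idP => h; last exact: le_lt_trans h.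
  rewrite ltNge; apply/negP => h'; apply: (H (m i)); last by rewrite h.
  by rewrite mem_cat; apply/orP; right; apply: map_f; rewrite mem_iota add0n.
pose be s := if e s then al s else al' s.
have hbe : HM Y be.
  exact: (HM_map2 (fun b (p : Y * Y) => if b then p.1 else p.2) he
    (HM_map2 (fun a b => (a, b)) hal hal')).
exists be => // psi.
have cal i s : (i < n)%N -> t i <= s < t i.+1 -> al s = al (t i).
  by apply: (breaks_part bD pt) => d dD; apply: tD; rewrite mem_cat dD.
have cal' i s : (i < n)%N -> t i <= s < t i.+1 -> al' s = al' (t i).
  by apply: (breaks_part bE pt) => d dD; apply: tD; rewrite !mem_cat dD orbT.
have t01 i : (i <= n)%N -> 0 <= t i <= 1 by exact: part01.
have F k : (k <= n)%N -> hm_int be psi 0 (t k) =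
    (1 - l) * hm_int al psi 0 (t k) + l * hm_int al' psi 0 (t k).
  elim: k => [_|k IH kn].
    have z ga : hm_int ga psi 0 (t 0) = 0 by rewrite t0 /hm_int set_itvco0 Rintegral_set0.
    by rewrite !z !mulr0 addr0.
  have /andP[tk0 tk1] := t01 k (ltnW kn); have /andP[tk0' tk1'] := t01 k.+1 kn.
  have tt := ts k kn; have /andP[mt1 mt2] := mt k kn.
  rewrite (hm_int_add hbe psi (a := 0) (b := t k) (c := t k.+1)) ?(ltW tt) // IH ?(ltnW kn) //.
  rewrite (hm_int_add hal psi (a := 0) (b := t k) (c := t k.+1)) ?(ltW tt) //.
  rewrite (hm_int_add hal' psi (a := 0) (b := t k) (c := t k.+1)) ?(ltW tt) //.
  rewrite (hm_int_add hbe psi (a := t k) (b := m k)) //.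
  rewrite (@hm_int_cst _ be psi (psi (al (t k))) (t k) (m k)) //; last first.
    move=> s /andP[h1 h2]; have h : t k <= s < t k.+1 by rewrite h1 (lt_le_trans h2).
    by rewrite /be /e (part_idxE pt kn h) h2 (cal k).
  rewrite (@hm_int_cst _ be psi (psi (al' (t k))) (m k) (t k.+1)) //; last first.
    move=> s /andP[h1 h2]; have h : t k <= s < t k.+1 by rewrite h2 (le_trans mt1).
    by rewrite /be /e (part_idxE pt kn h) ltNge h1 (cal' k).
  rewrite (@hm_int_cst _ al psi (psi (al (t k))) (t k) (t k.+1)) ?(ltW tt) //; last first.
    by move=> s h; rewrite (cal k).
  rewrite (@hm_int_cst _ al' psi (psi (al' (t k))) (t k) (t k.+1)) ?(ltW tt) //; last first.
    by move=> s h; rewrite (cal' k).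
  by rewrite /m; ring.
move=> a b aD bD0 a0 ab b1.
have [i iN ti] := tD a (ltac:(by rewrite !mem_cat aD !orbT)) (ltac:(by rewrite a0 (le_trans ab))).
have [j jN tj] := tD b (ltac:(by rewrite !mem_cat bD0 !orbT)) (ltac:(by rewrite b1 (le_trans a0))).
have sub ga : HM Y ga -> hm_int ga psi a b = hm_int ga psi 0 (t j) - hm_int ga psi 0 (t i).
  by move=> hga; rewrite tj ti (hm_int_add hga psi (a := 0) (b := a) (c := b)) //; ring.
by rewrite !sub // !F //; ring.
Qed.

Lemma prod_nbhs_basis (S : Type) (v : prod_topology (fun _ : S => R)) U : nbhs v U ->
  exists (F : seq S) (e : R), 0 < e /\
    forall w, (forall s, List.In s F -> `|w s - v s| < e) -> U w.
Proof.
pose bas (p : seq S * R) : set (prod_topology (fun _ : S => R)) :=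
  [set w | forall s, List.In s p.1 -> `|w s - v s| < p.2].
pose G := filter_from [set p | 0 < p.2] bas.
have FG : Filter G.
  apply: filter_from_filter; first by exists ([::], 1) => /=.
  move=> [F e] [F' e'] /= e0 e'0; exists (F ++ F', Num.min e e') => /=.
    by rewrite lt_min e0.
  move=> w H; split => s sF.
    have := H s; rewrite /= List.in_app_iff lt_min => /(_ (or_introl sF)) /andP[? _] //.
  by have := H s; rewrite /= List.in_app_iff lt_min => /(_ (or_intror sF)) /andP[].
have Gv : G --> v.
  apply/cvg_sup => s W [V [[B oB <-] Bv] VW].
  have /nbhs_ballP[e /= e0 eB] : nbhs (v s) B by apply: open_nbhs_nbhs.
  exists ([:: s], e) => // w /= H; apply: VW; apply: eB.
  by rewrite /ball /= distrC; apply: H; left.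
move=> nU; have [[F e] e0 sub] := Gv U nU.
by exists F, e; split => // w Hw; apply: sub.
Qed.

Lemma map_In (A : Type) (B : eqType) (f : A -> B) (s : A) (F : seq A) :
  List.In s F -> f s \in map f F.
Proof.
elim: F => //= t F IH [->|/IH]; first by rewrite inE eqxx.
by rewrite inE => ->; rewrite orbT.
Qed.

(** * The integrals as functionals on HX *)

Section HXfacts.
Variable X : topologicalType.
Notation V := (prod_topology (fun _ : S_HM X => R)).

Definition okS (phi : X -> R) (a b : R) :=
  continuous (phi, a, b).1.1 /\ 0 <= (phi, a, b).1.2 /\ (phi, a, b).1.2 < (phi, a, b).2 /\
  (phi, a, b).2 <= 1.

Definition mkS phi a b (h : okS phi a b) : S_HM X := exist _ (phi, a, b) h.

(* The continuous extension to [HX] of [alpha |-> \int_a^b phi (alpha t) dt]; it is [0] unless [phi] is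
   continuous and [0 <= a < b <= 1]. *)
Definition lin (v : V) (phi : X -> R) (a b : R) : R :=
  if pselect (okS phi a b) is left h then (b - a) * v (mkS h) else 0.

Lemma lin_cont phi a b : continuous (fun v => lin v phi a b).
Proof.
rewrite /lin; case: pselect => h v; last exact: cvg_cst.
apply: cvgM; first exact: cvg_cst.
exact: (@prod_coord_continuous _ (fun=> R) (mkS h)).
Qed.

Lemma linE (s : S_HM X) v : let p := sval s in
  v s = (p.2 - p.1.2)^-1 * lin v p.1.1 p.1.2 p.2.
Proof.
case: s => -[[phi a] b] h /=; rewrite /lin; case: pselect => [h'|[]] //.
rewrite (Prop_irrelevance h' h) mulKf // subr_eq0 gt_eqF //.
by case: h => _ [_ []].
Qed.

Lemma lin_embed al phi a b : HM X al -> continuous phi -> 0 <= a -> a <= b -> b <= 1 ->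
  lin (HM_embed X al) phi a b = hm_int al phi a b.
Proof.
move=> hal cphi a0; rewrite le_eqVlt => /orP[/eqP<-|ab] b1.
  rewrite /hm_int set_itvco0 Rintegral_set0 /lin; case: pselect => // h.
  by rewrite subrr mul0r.
rewrite /lin; case: pselect => [h|[]] //; rewrite /HM_embed /S_eval /=.
by rewrite mulVKf ?subr_eq0 ?gt_eqF // hm_int_cc.
Qed.

Lemma HX_closed : closed (HX X).
Proof. exact: closed_closure. Qed.

Lemma HX_embed al : HM X al -> HX X (HM_embed X al).
Proof. by move=> hal; apply: subset_closure; exists al. Qed.

Lemma HX_ind (C : set V) : closed C -> (forall al, HM X al -> C (HM_embed X al)) ->
  HX X `<=` C.
Proof.
move=> cC H; have := closure_subset (A := HM_embed X @` HM X) (B := C) _.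
by move/closure_id: cC => <-; apply=> _ [al hal <-]; exact: H.
Qed.

Let closed_eqR (f g : V -> R) : continuous f -> continuous g -> closed [set v | f v = g v].
Proof.
move=> cf cg.
have -> : [set v | f v = g v] = (fun v => f v - g v) @^-1` [set 0].
  by apply/seteqP; split => v /= => [->|/eqP]; rewrite ?subrr // subr_eq0 => /eqP.
apply: closed_pre; first by move=> v; apply: cvgB; [exact: cf | exact: cg].
by apply: accessible_closed_set1; apply: hausdorff_accessible; exact: R_hausdorff.
Qed.

Let closed_leR (f g : V -> R) : continuous f -> continuous g -> closed [set v | f v <= g v].
Proof.
move=> cf cg.
have -> : [set v | f v <= g v] = (fun v => f v - g v) @^-1` [set x | x <= 0].
  by apply/seteqP; split => v /=; rewrite subr_le0.
by apply: closed_pre; [move=> v; apply: cvgB; [exact: cf | exact: cg] | exact: closed_le].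
Qed.

Variable v : V.
Hypothesis Hv : HX X v.

Lemma lin_add phi a b c : continuous phi -> 0 <= a -> a <= b -> b <= c -> c <= 1 ->
  lin v phi a c = lin v phi a b + lin v phi b c.
Proof.
move=> cphi a0 ab bc c1; move: v Hv.
apply: HX_ind; first by apply: closed_eqR => [|w]; [|apply: cvgD]; exact: lin_cont.
move=> al hal /=; have ac := le_trans ab bc; have b1 := le_trans bc c1.
have b0 := le_trans a0 ab; rewrite !lin_embed //.
exact: hm_int_add.
Qed.

Lemma lin_lin phi psi (k : R) a b : continuous phi -> continuous psi ->
  0 <= a -> a <= b -> b <= 1 ->
  lin v (fun x => phi x + k * psi x) a b = lin v phi a b + k * lin v psi a b.
Proof.
move=> c1 c2 a0 ab b1; move: v Hv.
apply: HX_ind.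
  apply: closed_eqR => [|w]; first exact: lin_cont.
  apply: cvgD; first exact: lin_cont.
  by apply: cvgM; [exact: cvg_cst | exact: lin_cont].
move=> al hal /=; rewrite !lin_embed //; first exact: hm_int_lin.
move=> x; apply: cvgD; first exact: c1.
by apply: cvgM; [exact: cvg_cst | exact: c2].
Qed.

Lemma lin_le phi psi a b : continuous phi -> continuous psi ->
  0 <= a -> a <= b -> b <= 1 -> (forall x, phi x <= psi x) ->
  lin v phi a b <= lin v psi a b.
Proof.
move=> c1 c2 a0 ab b1 H; move: v Hv.
apply: HX_ind; first by apply: closed_leR; exact: lin_cont.
by move=> al hal /=; rewrite !lin_embed //; exact: hm_int_le.
Qed.

Lemma lin_cst (k : R) a b : 0 <= a -> a <= b -> b <= 1 ->
  lin v (fun=> k) a b = (b - a) * k.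
Proof.
move=> a0 ab b1; move: v Hv.
apply: HX_ind; first by apply: closed_eqR => [|w]; [exact: lin_cont | exact: cvg_cst].
move=> al hal /=; rewrite lin_embed //; last by move=> x; exact: cvg_cst.
exact: hm_int_cst.
Qed.

Lemma lin_dist phi psi (e : R) a b : continuous phi -> continuous psi ->
  0 <= a -> a <= b -> b <= 1 -> (forall x, `|phi x - psi x| <= e) ->
  `|lin v phi a b - lin v psi a b| <= (b - a) * e.
Proof.
move=> c1 c2 a0 ab b1 H.
have cc (k : R) : continuous (fun _ : X => k) by move=> x; exact: cvg_cst.
have h1 : lin v phi a b - lin v psi a b <= (b - a) * e.
  rewrite lerBlDl -(lin_cst e a0 ab b1) -[X in _ + X]mul1r -lin_lin //.
  apply: lin_le => // [x|x].
    by apply: cvgD; [exact: c2 | apply: cvgM; [exact: cvg_cst | exact: cvg_cst]].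
  by rewrite mul1r -lerBlDl; have := H x; rewrite ler_norml => /andP[].
have h2 : lin v psi a b - lin v phi a b <= (b - a) * e.
  rewrite lerBlDl -(lin_cst e a0 ab b1) -[X in _ + X]mul1r -lin_lin //.
  apply: lin_le => // [x|x].
    by apply: cvgD; [exact: c1 | apply: cvgM; [exact: cvg_cst | exact: cvg_cst]].
  by rewrite mul1r -lerBlDl; have := H x; rewrite distrC ler_norml => /andP[].
by rewrite ler_norml; apply/andP; split; lra.
Qed.

End HXfacts.

(** * HX as a convex compactum *)

Section HXspace.
Variable X : topologicalType.
Hypothesis cX : compact [set: X].
Notation V := (prod_topology (fun _ : S_HM X => R)).

Lemma compact_bounded_fun (phi : X -> R) : continuous phi ->
  exists M : R, 0 <= M /\ forall x, `|phi x| <= M.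
Proof.
move=> cphi; have [[x0 _]|nX] := pselect ([set: X] !=set0); last first.
  by exists 0; split => // x; case: nX; exists x.
have cn : continuous (fun x => `|phi x|) by move=> x; apply: cvg_norm; exact: cphi.
have [|x _ H] := compact_EVT_max (ex_intro _ x0 I) cX (f := fun x => `|phi x|).
  exact: continuous_subspaceT.
by exists `|phi x|; split => // y; apply: H; rewrite inE.
Qed.

Lemma HX_compact : compact (HX X).
Proof.
have /choice[M HM'] : forall s : S_HM X, exists M : R, 0 <= M /\ forall x, `|(sval s).1.1 x| <= M.
  by move=> s; apply: compact_bounded_fun; have [] := svalP s.
apply: (subclosed_compact (B := [set v : V | forall s, `[- M s, M s]%classic (v s)])).
- exact: HX_closed.
- apply: (@tychonoff {classic S_HM X} (fun=> R) (fun s => `[- M s, M s]%classic)) => s.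
  exact: segment_compact.
- move=> v Hv s /=; rewrite in_itv /= -ler_norml [v s]linE.
  case: s => -[[phi a] b] /= h; have [cphi [/= a0 [ab b1]]] := h.
  have [M0 HM1] := HM' (exist _ (phi, a, b) h).
  set M1 := M _ in M0 HM1 *; simpl in HM1.
  have c0 : continuous (fun _ : X => 0 : R) by move=> x; exact: cvg_cst.
  have := @lin_dist X v Hv phi (fun=> 0) M1 a b cphi c0 a0 (ltW ab) b1.
  rewrite lin_cst ?(ltW ab) // mulr0 subr0 => H.
  have d : 0 < b - a by rewrite subr_gt0.
  rewrite normrM gtr0_norm ?invr_gt0 // mulrC ler_pdivrMr // mulrC; apply: H.
  by move=> x; rewrite subr0.
Qed.

Definition mixV (l : R) (v w : V) : V := fun s => (1 - l) * v s + l * w s.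

Lemma mixV_contl l w : continuous (fun v => mixV l v w).
Proof.
apply: prod_continuous => s v; apply: cvgD; last exact: cvg_cst.
by apply: cvgM; [exact: cvg_cst | exact: (@prod_coord_continuous _ (fun=> R) s)].
Qed.

Lemma mixV_contr l v : continuous (fun w => mixV l v w).
Proof.
apply: prod_continuous => s w; apply: cvgD; first exact: cvg_cst.
by apply: cvgM; [exact: cvg_cst | exact: (@prod_coord_continuous _ (fun=> R) s)].
Qed.

Lemma mix_embed l al be : 0 <= l <= 1 -> HM X al -> HM X be ->
  HX X (mixV l (HM_embed X al) (HM_embed X be)).
Proof.
move=> l01 hal hbe U nU; have [F [e [e0 HF]]] := prod_nbhs_basis nU.
pose D0 := [seq (sval s).1.2 | s <- F] ++ [seq (sval s).2 | s <- F].
have [ga hga H] := hm_mix D0 hal hbe l01.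
exists (HM_embed X ga); split; first by exists ga.
apply: HF => s sF; suff -> : HM_embed X ga s = mixV l (HM_embed X al) (HM_embed X be) s.
  by rewrite subrr normr0.
have aD : (sval s).1.2 \in D0 by rewrite mem_cat (map_In _ sF).
have bD : (sval s).2 \in D0 by rewrite mem_cat (map_In _ sF) orbT.
rewrite /mixV !linE; case: s {sF} aD bD => -[[phi a] b] /= [cphi [/= a0 [ab b1]]] aD bD.
rewrite !lin_embed ?(ltW ab) // H ?(ltW ab) //; ring.
Qed.

Lemma HX_mix l v w : 0 <= l <= 1 -> HX X v -> HX X w -> HX X (mixV l v w).
Proof.
move=> l01 Hv; move: w; apply: (HX_ind (C := [set w | HX X (mixV l v w)])).
  exact: (closed_pre (@mixV_contr l v) (@HX_closed X)).
move=> be hbe /=; move: v Hv; apply: (HX_ind (C := [set v | HX X (mixV l v (HM_embed X be))])).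
  exact: (closed_pre (@mixV_contl l (HM_embed X be)) (@HX_closed X)).
by move=> al hal; exact: mix_embed.
Qed.

Definition T := set_type (HX X).
HB.instance Definition _ := Topological.on T.

Definition tv (x : T) : V := set_val x.

Lemma tv_HX (x : T) : HX X (tv x). Proof. exact: set_valP. Qed.

Definition mixT (l : R) (x y : T) : T :=
  if pselect (HX X (mixV l (tv x) (tv y))) is left h then SigSub (mem_set h) else x.

Lemma tv_mix l x y : 0 <= l <= 1 -> tv (mixT l x y) = mixV l (tv x) (tv y).
Proof.
move=> l01; rewrite /mixT; case: pselect => // -[].
by apply: HX_mix => //; exact: tv_HX.
Qed.

Lemma T_compact : compact [set: T].
Proof. exact: set_type_compact HX_compact. Qed.

Lemma tv_cont : continuous tv. Proof. exact: set_val_continuous. Qed.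

Lemma coord_cont (s : S_HM X) : continuous (fun x : T => tv x s).
Proof. exact: (continuous_o (@prod_coord_continuous _ _ s) tv_cont). Qed.

Lemma T_nbhs (x : T) U : nbhs x U -> exists (F : seq (S_HM X)) (e : R), 0 < e /\
  forall y : T, (forall s, List.In s F -> `|tv y s - tv x s| < e) -> U y.
Proof.
move=> /set_type_nbhs[W nW WU]; have [F [e [e0 H]]] := prod_nbhs_basis nW.
by exists F, e; split => // y Hy; apply: WU; apply: H.
Qed.

Lemma mixT_near x y U : nbhs x U -> exists2 l, 0 < l <= 1 & U (mixT l x y).
Proof.
move=> /T_nbhs[F [e [e0 HF]]].
have [M [M0 HM]] : exists M : R, 0 < M /\ forall s, List.In s F -> `|tv y s - tv x s| < M.
  elim: F {HF} => [|s F [M [M0 IH]]]; first by exists 1.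
  exists (M + `|tv y s - tv x s| + 1); split; first by have := normr_ge0 (tv y s - tv x s); lra.
  move=> s' [<-|/IH h]; first by have := M0; lra.
  by have := normr_ge0 (tv y s - tv x s); lra.
pose l := Num.min 1 (e / M).
have l0 : 0 < l by rewrite lt_min ltr01 divr_gt0.
have l1 : l <= 1 by rewrite ge_min lexx.
exists l; first by rewrite l0.
apply: HF => s sF; rewrite tv_mix ?(ltW l0) // /mixV.
have -> : (1 - l) * tv x s + l * tv y s - tv x s = l * (tv y s - tv x s) by ring.
rewrite normrM gtr0_norm //; apply: lt_le_trans (_ : l * M <= _).
  by rewrite ltr_pM2l //; exact: HM.
by rewrite -ler_pdivlMr // ge_min lexx orbT.
Qed.

End HXspace.

(** * Open equivalence relations *)

(** For compact [X], these are the kernels of open maps onto compact Hausdorff spaces. *)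
Record open_equiv (X : topologicalType) (e : X -> X -> Prop) : Prop := OpenEquiv {
  oe_refl : forall x, e x x;
  oe_sym : forall x y, e x y -> e y x;
  oe_trans : forall x y z, e x y -> e y z -> e x z;
  oe_closed : closed [set p : X * X | e p.1 p.2];
  oe_open : forall x x' U, e x x' -> nbhs x' U ->
    \forall y \near x, exists2 y', e y y' & U y' }.

Definition invariant (X Z : Type) (e : X -> X -> Prop) (phi : X -> Z) :=
  forall x y, e x y -> phi x = phi y.

Section ClassMax.
Variables (X : topologicalType) (e : X -> X -> Prop).
Hypotheses (cX : compact [set: X]) (oe : open_equiv e).
Variable w : X -> R.
Hypothesis cw : continuous w.

(** The maximum of [w] over the class of [p]; it turns any continuous function into a continuous
    invariant one. *)
Definition emax (p : X) : R := - slice_inf e (fun q => - w q) p.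

Let cNw : continuous (fun q => - w q).
Proof. by move=> q; apply: cvgN; exact: cw. Qed.

Let e0 p : e p !=set0. Proof. by exists p; exact: (oe_refl oe). Qed.

Lemma emax_cont : continuous emax.
Proof.
move=> p; apply: cvgN.
exact: (slice_inf_continuous cX cNw (oe_closed oe) e0 (oe_open oe)).
Qed.

Lemma emax_att p : exists2 q, e p q & w q = emax p.
Proof.
have [[q epq E] _] := slice_infP cX cNw (oe_closed oe) e0 p.
by exists q => //; rewrite /emax -E opprK.
Qed.

Lemma emax_ge p q : e p q -> w q <= emax p.
Proof.
move=> epq; have [_ H] := slice_infP cX cNw (oe_closed oe) e0 p.
by rewrite lerNr; exact: H.
Qed.

Lemma emax_inv : invariant e emax.
Proof.
move=> p q epq; apply/eqP; rewrite eq_le.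
have [p' ep pE] := emax_att p; have [q' eq' qE] := emax_att q.
apply/andP; split.
  by rewrite -pE; apply: emax_ge; exact: (oe_trans oe (oe_sym oe epq) ep).
by rewrite -qE; apply: emax_ge; exact: (oe_trans oe epq eq').
Qed.

End ClassMax.

(** * The relation induced on HX by an open equivalence relation *)

Section HRel.
Variable X : topologicalType.
Hypothesis cX : compact [set: X].
Notation T := (T X).

(* When [e] is the kernel of a quotient map [X -> Y], this is the kernel of the induced map [HX -> HY]. *)
Definition hrel (e : X -> X -> Prop) (x y : T) : Prop :=
  forall phi a b, continuous phi -> invariant e phi -> lin (tv x) phi a b = lin (tv y) phi a b.

Lemma lin_tv_cont phi a b : continuous (fun x : T => lin (tv x) phi a b).
Proof. exact: (continuous_o (@lin_cont X phi a b) (@tv_cont X)). Qed.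

Lemma lin_mix l (x y : T) (phi : X -> R) a b : 0 <= l <= 1 ->
  lin (tv (mixT l x y)) phi a b = (1 - l) * lin (tv x) phi a b + l * lin (tv y) phi a b.
Proof.
move=> l01; rewrite tv_mix // /lin; case: pselect => h; last by rewrite !mulr0 addr0.
by rewrite /mixV; ring.
Qed.

Definition embT (al : R -> X) (h : HM X al) : T := SigSub (mem_set (HX_embed h)).

Lemma T_ind (C : set T) : closed C -> (forall al (h : HM X al), C (embT h)) -> forall x, C x.
Proof.
move=> cC H x; apply: cC => U /set_type_nbhs[W nW WU].
have [_ [[al hal <-] Wal]] := @tv_HX X x _ nW.
by exists (embT hal); split; [exact: H | exact: WU].
Qed.

Variable e : X -> X -> Prop.
Hypothesis oe : open_equiv e.

Lemma hrel_closed : closed [set p : T * T | hrel e p.1 p.2].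
Proof.
have -> : [set p : T * T | hrel e p.1 p.2] =
    \bigcap_(k in [set k : (X -> R) * R * R | continuous k.1.1 /\ invariant e k.1.1])
      [set p : T * T | lin (tv p.1) k.1.1 k.1.2 k.2 - lin (tv p.2) k.1.1 k.1.2 k.2 = 0].
  apply/seteqP; split => -[x y] /=.
    by move=> H [[phi a] b] [/= c1 c2]; rewrite H // subrr.
  by move=> H phi a b c1 c2; apply/eqP; rewrite -subr_eq0; apply/eqP; exact: (H (phi, a, b)).
apply: closed_bigI => k _.
apply: (@closed_pre _ _ (fun p : T * T => lin (tv p.1) k.1.1 k.1.2 k.2 - lin (tv p.2) k.1.1 k.1.2 k.2)
  [set 0]).
  move=> p; apply: cvgB.
    exact: (continuous_o (@lin_tv_cont _ _ _) (@continuous_fst T T)).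
  exact: (continuous_o (@lin_tv_cont _ _ _) (@continuous_snd T T)).
by apply: accessible_closed_set1; apply: hausdorff_accessible; exact: R_hausdorff.
Qed.

Section Lift.
Variables (n : nat) (t : nat -> R) (w : nat -> X -> R).
Hypothesis pt : partition01 n t.
Hypothesis cw : forall j, continuous (w j).

Let Lam (y : T) : R := \sum_(j < n) lin (tv y) (w j) (t j) (t j.+1).
Let Up (y : T) : R := \sum_(j < n) lin (tv y) (emax e (w j)) (t j) (t j.+1).

Let sum_cont (f : nat -> X -> R) :
  continuous (fun y : T => \sum_(j < n) lin (tv y) (f j) (t j) (t j.+1)).
Proof.
by apply: (sum_continuous (f := fun j y => lin (tv y) (f j) (t j) (t j.+1))) => j; exact: lin_tv_cont.
Qed.

Let tj j : (j < n)%N -> [/\ 0 <= t j, t j <= t j.+1 & t j.+1 <= 1].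
Proof.
move=> jn; have [_ _ ts] := pt.
have /andP[? _] := part01 pt (ltnW jn); have /andP[_ ?] := part01 pt jn.
by split => //; exact: ltW (ts j jn).
Qed.

(** For a step function, each value is moved within its class to a maximum point of the weight of
    the current interval; the result is again a step function. Closedness of [hrel e] and
    compactness extend this to all of [HX]. *)
Lemma lift_max (y : T) : exists2 y', hrel e y y' & Up y <= Lam y'.
Proof.
have cU := @emax_cont X e cX oe.
suff : [set y : T | exists y' : T, (hrel e y y' /\ Up y <= Lam y')] y.
  by move=> [y' [h1 h2]]; exists y'.
apply: T_ind; first apply: (closed_exists (@T_compact X cX)
    (G := [set p : T * T | hrel e p.1 p.2 /\ Up p.1 <= Lam p.2])).
  have -> : [set p : T * T | hrel e p.1 p.2 /\ Up p.1 <= Lam p.2] =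
      [set p : T * T | hrel e p.1 p.2] `&`
      (fun p : T * T => Up p.1 - Lam p.2) @^-1` [set z | z <= 0].
    by apply/seteqP; split => p /=; rewrite subr_le0.
  apply: closedI; first exact: hrel_closed.
  apply: closed_pre; last exact: closed_le.
  have cUp : continuous Up by exact: (@sum_cont (fun j => emax e (w j))).
  have cLam : continuous Lam by exact: (@sum_cont w).
  move=> p; apply: cvgB; first exact: (continuous_o cUp (@continuous_fst T T)).
  exact: (continuous_o cLam (@continuous_snd T T)).
move=> al hal.
have /choice[g gP] : forall p : nat * X, exists q, e p.2 q /\ w p.1 q = emax e (w p.1) p.2.
  by move=> p; have [q q1 q2] := emax_att cX oe (@cw p.1) p.2; exists q.
pose al' s := g (part_idx n t s, al s).
have hal' : HM X al' by exact: (HM_map2 (fun i x => g (i, x)) (HM_idx pt) hal).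
exists (embT hal'); split.
  move=> phi a b cphi inv; rewrite /tv /=.
  have [ok|nok] := pselect (okS phi a b); last by rewrite /lin; case: pselect.
  have [_ [/= a0 [/ltW ab b1]]] := ok; rewrite !lin_embed //.
  by apply: hm_int_eq => s _; apply: inv; have [] := gP (part_idx n t s, al s).
rewrite /Up /Lam; apply: ler_sum => j _; have [t0 tt t1] := tj (ltn_ord j).
rewrite /tv /= !lin_embed //; last exact: emax_cont.
rewrite (hm_int_eq (al' := al') (psi' := w j)) // => s h.
by have [_] := gP (part_idx n t s, al s); rewrite /al' /= (part_idxE pt (ltn_ord j) h).
Qed.

(** [Up] is continuous, depends only on the class, and dominates [Lam] on it; [lift_max] attains it
    over nearby classes. *)
Lemma near_lift (x x' : T) (eta : R) : hrel e x x' -> 0 < eta ->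
  \forall y \near x, exists2 y', hrel e y y' & Lam x' - eta < Lam y'.
Proof.
move=> rx eta0; have cU := @emax_cont X e cX oe.
have le1 : Lam x' <= Up x.
  rewrite /Lam /Up; apply: ler_sum => j _; have [t0 tt t1] := tj (ltn_ord j).
  rewrite rx; [|exact: emax_cont|exact: emax_inv].
  apply: lin_le => //; [exact: tv_HX | exact: emax_cont|].
  by move=> p; apply: emax_ge => //; exact: (oe_refl oe).
have : \forall y \near x, Up x - eta < Up y.
  by apply: near_gt; [exact: (@sum_cont (fun j => emax e (w j))) | rewrite ltrBlDr ltrDl].
apply: filterS => y Uy; have [y' ry le2] := lift_max y.
by exists y' => //; lra.
Qed.

End Lift.

Lemma lin_sum (x : T) (N : nat) (k : nat -> R) (f : nat -> X -> R) a b :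
  (forall i, continuous (f i)) -> 0 <= a -> a <= b -> b <= 1 ->
  lin (tv x) (fun p => \sum_(i < N) k i * f i p) a b =
  \sum_(i < N) k i * lin (tv x) (f i) a b.
Proof.
move=> cf a0 ab b1; elim: N => [|N IH].
  rewrite big_ord0; under eq_fun do rewrite big_ord0.
  by rewrite (@lin_cst X _ (@tv_HX X x)) // mulr0.
rewrite big_ord_recr /= -IH; under eq_fun do rewrite big_ord_recr /=.
rewrite (@lin_lin X _ (@tv_HX X x)) //.
apply: (sum_continuous (f := fun i p => k i * f i p)) => j p.
by apply: cvgM; [exact: cvg_cst | exact: cf].
Qed.

Lemma lin_part (x : T) (phi : X -> R) n t i j : continuous phi -> partition01 n t ->
  (i <= j)%N -> (j <= n)%N ->
  lin (tv x) phi (t i) (t j) = \sum_(k < n | (i <= k < j)%N) lin (tv x) phi (t k) (t k.+1).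
Proof.
move=> cphi pt; elim: j => [|j IH]; first by
  rewrite leqn0 => /eqP-> _; rewrite big1 => [|k /andP[]] //; rewrite /lin; case: pselect => // h;
  rewrite subrr mul0r.
rewrite leq_eqVlt => /orP[/eqP<- _|].
  rewrite big1 => [|k /andP[h1 h2]]; last by rewrite leqNgt h2 in h1.
  by rewrite /lin; case: pselect => // h; rewrite subrr mul0r.
rewrite ltnS => ij jn.
have /andP[i0 _] := part01 pt (leq_trans ij (ltnW jn)).
have /andP[_ j1] := part01 pt jn.
rewrite (@lin_add X _ (@tv_HX X x) phi (t i) (t j) (t j.+1)) //; last 2 first.
- exact: (part_le pt ij (ltnW jn)).
- exact: (part_le pt (leqnSn j) jn).
rewrite IH ?(ltnW jn) // [RHS](bigD1 (Ordinal jn)) /= ?ij ?ltnSn // addrC; congr (_ + _).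
apply: eq_bigl => k; rewrite -val_eqE /= ltnS.
by case: (ltngtP k j); rewrite ?andbT ?andbF // => ->; rewrite ij.
Qed.

Section Functional.
Variables (N : nat) (s : nat -> S_HM X).

(** Brings a linear functional in finitely many coordinates into the form required by [near_lift],
    with one weight function per interval. *)
Lemma functional_part : exists n t, partition01 n t /\ forall lam : nat -> R,
  exists w : nat -> X -> R,
  (forall j, continuous (w j)) /\
  forall y : T, \sum_(i < N) lam i * tv y (s i) = \sum_(j < n) lin (tv y) (w j) (t j) (t j.+1).
Proof.
pose phi i := (sval (s i)).1.1; pose a i := (sval (s i)).1.2; pose b i := (sval (s i)).2.
have ok i : [/\ continuous (phi i), 0 <= a i, a i < b i & b i <= 1].
  by rewrite /phi /a /b; case: (s i) => -[[? ?] ?] [? [? []]].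
have [n [t [pt tD]]] := partition_through (mkseq a N ++ mkseq b N).
have ex i : exists kl : nat * nat, (i < N)%N ->
    [/\ (kl.1 <= kl.2)%N, (kl.2 <= n)%N, t kl.1 = a i & t kl.2 = b i].
  have [iN|] := boolP (i < N)%N; last by exists (0, 0)%N.
  have [cphi a0 ab b1] := ok i.
  have [||k kn tk] := tD (a i); last have [||l ln tl] := tD (b i).
  - by rewrite mem_cat; apply/orP; left; apply: map_f; rewrite mem_iota.
  - by rewrite a0 (le_trans (ltW ab)).
  - by rewrite mem_cat; apply/orP; right; apply: map_f; rewrite mem_iota.
  - by rewrite b1 (le_trans a0 (ltW ab)).
  exists (k, l) => _; split => //=; rewrite leqNgt; apply/negP => lk.
  by have := part_le pt (ltnW lk) kn; rewrite tk tl leNgt ab.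
have {ex}/choice[kl klP] := ex.
exists n, t; split => // lam.
pose c i j : R := if ((kl i).1 <= j < (kl i).2)%N then lam i / (b i - a i) else 0.
exists (fun j p => \sum_(i < N) c i j * phi i p); split.
  move=> j; apply: (sum_continuous (f := fun i p => c i j * phi i p)) => i p.
  by apply: cvgM; [exact: cvg_cst | have [cphi _ _ _] := ok i; exact: cphi].
move=> y.
have tj (j : 'I_n) : [/\ 0 <= t j, t j <= t j.+1 & t j.+1 <= 1].
  have [_ _ ts] := pt; have jn := ltn_ord j.
  have /andP[? _] := part01 pt (ltnW jn); have /andP[_ ?] := part01 pt jn.
  by split => //; exact: ltW (ts j jn).
under [RHS]eq_bigr => j _.
  have [t0 tt t1] := tj j.
  rewrite (lin_sum y N (c ^~ j)) //; last by move=> i; have [] := ok i.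
  over.
rewrite exchange_big /=; apply: eq_bigr => i _.
have [cphi a0 ab b1] := ok i; have [h1 h2 h3 h4] := klP i (ltn_ord i).
rewrite linE -/(phi i) -/(a i) -/(b i) -h3 -h4 (lin_part y cphi pt h1 h2) h3 h4.
rewrite mulrA mulr_sumr big_mkcond /=; apply: eq_bigr => j _.
by rewrite /c; case: ifP => _ //; rewrite mul0r.
Qed.

End Functional.

End HRel.

Lemma In_nth_size (A : Type) (a0 a : A) (F : seq A) :
  List.In a F -> exists2 i, (i < size F)%N & nth a0 F i = a.
Proof.
elim: F => //= b F IH [->|/IH[i iF <-]]; first by exists 0%N.
by exists i.+1.
Qed.

Section HRelGood.
Variable X : topologicalType.
Hypothesis cX : compact [set: X].
Notation T := (T X).
Variable e : X -> X -> Prop.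
Hypothesis oe : open_equiv e.

Lemma hrel_refl x : hrel e x x. Proof. by []. Qed.

Lemma hrel_sym x y : hrel e x y -> hrel e y x.
Proof. by move=> H phi a b c1 c2; rewrite H. Qed.

Lemma hrel_trans x y z : hrel e x y -> hrel e y z -> hrel e x z.
Proof. by move=> H H' phi a b c1 c2; rewrite H // H'. Qed.

Lemma hrel_mix l x y z : 0 <= l <= 1 -> hrel e x y -> hrel e x z -> hrel e x (mixT l y z).
Proof.
move=> l01 H H' phi a b c1 c2; rewrite lin_mix // -H // -H' //; ring.
Qed.

Lemma coords_bounded (N : nat) (s : nat -> S_HM X) :
  exists B : R, 0 < B /\ forall i (z : T), (i < N)%N -> `|tv z (s i)| <= B.
Proof.
have /choice[M HM'] : forall i, exists M : R, 0 <= M /\ forall z : T, `|tv z (s i)| <= M.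
  by move=> i; apply: compact_bounded_fun; [exact: T_compact | exact: coord_cont].
exists (1 + \sum_(i < N) M i); split.
  by rewrite ltr_wpDr // sumr_ge0 // => i _; have [] := HM' i.
move=> i z iN; apply: le_trans ((HM' i).2 z) _.
rewrite (bigD1 (Ordinal iN)) //= addrCA lerDl addr_ge0 // sumr_ge0 // => j _.
by have [] := HM' j.
Qed.

(* Minimise the squared distance to [x'] over the class of [y]: the first order condition
   at the minimum bounds a linear functional on the class, and [near_lift] bounds the same
   functional from below, uniformly over a cube of functionals. *)
Lemma hrel_open x x' U : hrel e x x' -> nbhs x' U ->
  \forall y \near x, exists2 y', hrel e y y' & U y'.
Proof.
move=> rx /T_nbhs[F [eps [eps0 HF]]].
case: F HF => [|s0 F0] HF.
  apply: (@filterS _ (nbhs x) _ setT); last exact: filterT.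
  by move=> y _; exists y => //; exact: HF.
set F := s0 :: F0 in HF; pose N := size F; pose s i := nth s0 F i.
have {}HF : forall y : T, (forall i, (i < N)%N -> `|tv y (s i) - tv x' (s i)| < eps) -> U y.
  move=> y H; apply: HF => s' sF.
  have [i iN <-] := In_nth_size s0 sF.
  exact: H.
have [B [B0 HB]] := coords_bounded N s.
(* Coefficients in [- 2 B, 2 B], which contains all differences of coordinates; in particular the
   gradient at the minimum is among them. *)
pose lam (q : Q) i : R := 4 * B * cu q i + - (2 * B).
pose Lam (q : Q) (y : T) : R := \sum_(i < N) lam q i * tv y (s i).
(* The error [eta] is spent three times in [near2]: once in [near1], and once at each of [x'] and
   [y'] when [q] is replaced by a nearby point. *)
have eta0 : 0 < eps ^+ 2 / 3 by rewrite divr_gt0 // exprn_gt0.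
set eta := eps ^+ 2 / 3 in eta0.
have near1 q : \forall y \near x, exists2 y', hrel e y y' & Lam q x' - eta < Lam q y'.
  have [n [t [pt H]]] := functional_part N s.
  have [w [cw wE]] := H (lam q).
  have := near_lift cX oe pt cw rx eta0; apply: filterS => y [y' ry ly].
  by exists y' => //; rewrite /Lam !wE.
have cu_near q q' : \sum_(i < N) `|lam q i - lam q' i| * B < eta ->
    forall z, `|Lam q z - Lam q' z| <= eta.
  move=> h z; apply: le_trans (ltW h); rewrite /Lam -sumrB.
  apply: le_trans (ler_norm_sum _ _ _) _; apply: ler_sum => i _.
  by rewrite -mulrBl normrM ler_wpM2l //; exact: HB.
have near2 : \forall y \near x, forall q : Q,
    exists2 y', hrel e y y' & Lam q x' - 3 * eta < Lam q y'.
  have /compact_near_coveringP cN := @cube_compact nat.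
  have sub : \forall y \near x, [set: Q] `<=`
      (fun q => exists2 y', hrel e y y' & Lam q x' - 3 * eta < Lam q y').
    apply: (cN T (nbhs x) (fun y q => exists2 y', hrel e y y' & Lam q x' - 3 * eta < Lam q y')).
    move=> q _.
    have nq : \forall q' \near q, \sum_(i < N) `|lam q i - lam q' i| * B < eta.
      apply: near_lt; last by rewrite big1 // => i _; rewrite subrr normr0 mul0r.
      apply: (sum_continuous (f := fun i q' => `|lam q i - lam q' i| * B)) => i.
      apply: cont_mul; last exact: cont_cst.
      apply: cont_norm; apply: cont_sub; first exact: cont_cst.
      by apply: continuous_affine; exact: cu_continuous.
    exists ([set q' | \sum_(i < N) `|lam q i - lam q' i| * B < eta],
      [set y | exists2 y', hrel e y y' & Lam q x' - eta < Lam q y']).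
      by split => //=; exact: near1.
    move=> -[q' y] [/= h1 [y' ry h2]]; exists y' => //.
    have := cu_near _ _ h1 y'; have := cu_near _ _ h1 x'.
    by rewrite !ler_norml => /andP[? ?] /andP[? ?]; lra.
  by apply: filterS sub => y H q; exact: H.
apply: filterS near2 => y Hy.
pose d i (z : T) := tv z (s i) - tv x' (s i).
pose D (z : T) : R := \sum_(i < N) d i z ^+ 2.
have cD : continuous D.
  apply: (sum_continuous (f := fun i z => d i z ^+ 2)) => i.
  by apply: cont_mul; apply: cont_sub; [exact: coord_cont|exact: cont_cst|exact: coord_cont|exact: cont_cst].
have clC : closed (hrel e y).
  have -> : hrel e y = (fun z => (y, z)) @^-1` [set p : T * T | hrel e p.1 p.2] by [].
  by apply: closed_pre; [exact: continuous_pairl | exact: hrel_closed].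
have cC : compact (hrel e y) by apply: subclosed_compact clC (T_compact cX) _.
have [|z /set_mem rz zmin] := compact_EVT_min (f := D) (ex_intro _ y (hrel_refl y)) cC.
  exact: continuous_subspaceT.
have q01 i : 0 <= ((if (i < N)%N then - d i z / (2 * B) else 0) + 1) / 2 <= 1.
  case: ifP => iN; last by apply/andP; split; lra.
  have : `|- d i z / (2 * B)| <= 1.
    rewrite normrM normfV normrN (gtr0_norm (mulr_gt0 _ B0)) // ler_pdivrMr ?mulr_gt0 // mul1r.
    apply: le_trans (ler_normB _ _) _.
    by have := HB i z iN; have := HB i x' iN; lra.
  by rewrite ler_norml => /andP[? ?]; apply/andP; split; lra.
pose q : Q := mk_cube q01.
have lamE i : (i < N)%N -> lam q i = - d i z.
  move=> iN; rewrite /lam cu_mk iN.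
  have B0' : B != 0 by rewrite gt_eqF.
  by field.
have [y' ry' hy'] := Hy q.
exists z => //; apply: HF => i iN.
have foc : \sum_(j < N) (- d j z) * (tv y' (s j) - tv z (s j)) <= 0.
  set S := \sum_(j < N) _; rewrite leNgt; apply/negP => S0.
  pose K := \sum_(j < N) (tv y' (s j) - tv z (s j)) ^+ 2.
  have K0 : 0 <= K by rewrite sumr_ge0 // => j _; rewrite sqr_ge0.
  pose l := Num.min 1 (S / (K + 1)).
  have K1 : 0 < K + 1 by lra.
  have l0 : 0 < l by rewrite lt_min ltr01 divr_gt0.
  have l1 : l <= 1 by rewrite ge_min lexx.
  have lS : l * (K + 1) <= S by rewrite -ler_pdivlMr // ge_min lexx orbT.
  have l01 : 0 <= l <= 1 by rewrite (ltW l0).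
  have := zmin (mixT l z y') (mem_set (hrel_mix l01 rz ry')).
  have -> : D (mixT l z y') = D z - 2 * l * S + l ^+ 2 * K.
    rewrite /D /S /K !mulr_sumr -sumrB -big_split /=; apply: eq_bigr => j _.
    by rewrite /d tv_mix // /mixV; ring.
  move=> h; have : l * (2 * S - l * K) <= 0 by move: h; rewrite expr2; lra.
  by rewrite pmulr_rle0 // => h'; lra.
have e1 : Lam q y' - Lam q x' = \sum_(j < N) (- d j z) * (tv y' (s j) - tv z (s j)) - D z.
  rewrite /Lam /D -!sumrB; apply: eq_bigr => j _; rewrite lamE //.
  by rewrite /d; ring.
have D3 : D z < eps ^+ 2.
  have e3 : 3 * eta = eps ^+ 2 by rewrite /eta mulrC divfK.
  by lra.
have di : d i z ^+ 2 <= D z.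
  by rewrite /D (bigD1 (Ordinal iN)) //= lerDl sumr_ge0 // => j _; rewrite sqr_ge0.
rewrite -/(d i z) ltNge; apply/negP => h.
have : eps ^+ 2 <= `|d i z| ^+ 2 by rewrite ler_pXn2r // nnegrE ltW.
by rewrite real_normK ?num_real // => h'; lra.
Qed.

Lemma hrel_good : good_rel (@mixT X) (hrel e).
Proof.
split; [exact: hrel_refl | exact: hrel_sym | exact: hrel_trans | exact: hrel_closed
  | exact: hrel_open | exact: hrel_mix].
Qed.

End HRelGood.

(** * From open systems to cubes *)

Lemma urysohn_cpt (X : topologicalType) (A B : set X) : hausdorff_space X -> compact [set: X] ->
  closed A -> closed B -> A `&` B = set0 ->
  exists f : X -> R, [/\ continuous f, forall x, 0 <= f x <= 1,
    forall x, A x -> f x = 0 & forall x, B x -> f x = 1].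
Proof.
move=> hX cX cA cB AB.
have [f [cf fA fB f01]] := @urysohn_ext_itv X R (compact_normal hX cX) A B 0 1 cA cB AB ltr01.
exists f; split => // [x|x Ax|x Bx].
- by have /= := f01 (f x); rewrite in_itv /=; apply; exists x.
- by apply: fA; exists x.
- by apply: fB; exists x.
Qed.

Lemma closed_point (X : topologicalType) (x : X) : hausdorff_space X -> closed [set x].
Proof. by move=> hX; apply: accessible_closed_set1; exact: hausdorff_accessible. Qed.

Lemma bigmax_continuous (X : topologicalType) (k : nat) (f : 'I_k -> X -> R) :
  (forall i, continuous (f i)) -> continuous (fun x => \big[Num.max/0]_(i < k) f i x).
Proof.
move=> cf; elim: (index_enum _) => [|i s IH].
  by under eq_fun do rewrite big_nil; exact: cont_cst.
by under eq_fun do rewrite big_cons; apply: max_continuous.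
Qed.

Lemma countable_range (I : countType) (Z : Type) (f : I -> Z) : countable (range f).
Proof. exact: sub_countable (card_image_le _ _) (countableP _). Qed.

Lemma finite_cover (X : topologicalType) (U : X -> set X) : compact [set: X] ->
  (forall x, nbhs x (U x)) -> exists s : seq X, forall x, exists2 x', x' \in s & U x' x.
Proof.
move=> cX nU; apply: contrapT => nH.
have [|s|s t|x Hx] := compact_directed cX
    (F := fun s : seq X => [set x | forall x', x' \in s -> ~ interior (U x') x]) [::].
- move=> s; have -> : [set x | forall x', x' \in s -> ~ interior (U x') x] =
      \bigcap_(x' in [set x' | x' \in s]) ~` interior (U x') by [].
  by apply: closed_bigI => x' _; rewrite closedC; exact: open_interior.
- apply: contrapT => h; apply: nH; exists s => x; apply: contrapT => h'.
  by apply: h; exists x => x' xs /interior_subset xU; apply: h'; exists x'.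
- by exists (s ++ t) => x h; split => x' x's; apply: h; rewrite mem_cat x's ?orbT.
- by apply: (Hx [:: x] x); [rewrite mem_head | exact: nU].
Qed.

(* [e a] stands for the kernel of the projection of [X] to the term [X_a] of an omega-system with
   open bonding maps; [os_dense] expresses that [X_a] is metrizable. *)
Record open_system (X : topologicalType) (A : Type) (le : A -> A -> Prop)
    (e : A -> X -> X -> Prop) : Prop := OpenSystem {
  os_refl : forall a, le a a;
  os_trans : forall a b c, le a b -> le b c -> le a c;
  os_oe : forall a, open_equiv (e a);
  os_mono : forall a b, le a b -> forall x y, e b x y -> e a x y;
  os_lub : forall B : set A, countable B -> exists c, (forall b, B b -> le b c) /\
    (directed_subset A le B -> forall x y, (forall b, B b -> e b x y) -> e c x y);
  os_sep : forall x y, (forall a, e a x y) -> x = y;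
  os_dense : forall a, exists d : nat -> X -> R,
    (forall n, continuous (d n) /\ invariant (e a) (d n)) /\
    forall phi, continuous phi -> invariant (e a) phi -> forall eps : R, 0 < eps ->
      exists n, forall x, `|phi x - d n x| <= eps }.

Section Oscillation.
Variables (X : topologicalType) (I : Type) (F : I -> X -> X -> Prop) (i0 : I).
Hypothesis cX : compact [set: X].
Hypothesis clF : forall i, closed [set p : X * X | F i p.1 p.2].
Hypothesis dF : forall i j, exists k, forall x y, F k x y -> F i x y /\ F j x y.

(** Pairs on which [phi] varies by [eps] form a compact set, so if they occurred in every [F i], one
    of them would lie in all. *)
Lemma family_osc (phi : X -> R) (eps : R) : continuous phi -> 0 < eps ->
  (forall x y, (forall i, F i x y) -> phi x = phi y) ->
  exists i, forall x y, F i x y -> `|phi x - phi y| < eps.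
Proof.
move=> cphi eps0 H; apply: contrapT => nH.
have cXX : compact [set: X * X] by rewrite -setXTT; exact: compact_setX.
have [|||[x y] Hxy] := compact_directed cXX (F := fun i =>
    [set p : X * X | F i p.1 p.2] `&` [set p : X * X | eps <= `|phi p.1 - phi p.2|]) i0.
- move=> i; apply: closedI; first exact: clF.
  apply: (@closed_pre _ _ (fun p : X * X => `|phi p.1 - phi p.2|) [set z | eps <= z]); last exact: closed_ge.
  apply: cont_norm; apply: cont_sub.
    exact: (continuous_o cphi (@continuous_fst _ _)).
  exact: (continuous_o cphi (@continuous_snd _ _)).
- move=> i; apply: contrapT => h; apply: nH; exists i => x y Fxy; rewrite ltNge.
  by apply/negP => h'; apply: h; exists (x, y).
- move=> i j; have [k Hk] := dF i j; exists k => -[x y] [/= /Hk[h1 h2] h3].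
  by split; split.
have e : phi x = phi y by apply: H => i; have [] := Hxy i.
have [_ /=] := Hxy i0; rewrite e subrr normr0.
by rewrite leNgt eps0.
Qed.

(** By [family_osc], a function invariant under [E] is uniformly close to its class maximum for a
    single [F i], whose integrals at [x] and [y] agree. *)
Lemma hrel_bigcap (E : X -> X -> Prop) (x y : T X) :
  (forall i, open_equiv (F i)) ->
  (forall p q, (forall i, F i p q) -> E p q) ->
  (forall i, hrel (F i) x y) -> hrel E x y.
Proof.
move=> oF HE H phi a b cphi inv.
have [ok|nok] := pselect (okS phi a b); last by rewrite /lin; case: pselect.
have [_ [/= a0 [/ltW ab b1]]] := ok.
apply/eqP; rewrite -subr_eq0 -normr_le0; apply/ler_addgt0Pr => d d0; rewrite add0r.
have d2 : 0 < d / 2 by rewrite divr_gt0.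
have [i Hi] := family_osc cphi d2 (fun p q h => inv p q (HE p q h)).
pose psi := emax (F i) phi.
have cpsi : continuous psi by apply: emax_cont.
have near p : `|phi p - psi p| <= d / 2.
  have [q Fq qE] := emax_att cX (oF i) cphi p.
  by rewrite /psi -qE; apply: ltW; exact: Hi.
have Ei : lin (tv x) psi a b = lin (tv y) psi a b.
  by apply: H => //; apply: emax_inv.
have h1 := @lin_dist X _ (@tv_HX X x) phi psi (d / 2) a b cphi cpsi a0 ab b1 near.
have h2 := @lin_dist X _ (@tv_HX X y) phi psi (d / 2) a b cphi cpsi a0 ab b1 near.
have ba : (b - a) * (d / 2) <= d / 2 by rewrite ger_pMl //; lra.
move: h1 h2; rewrite -Ei !ler_norml => /andP[? ?] /andP[? ?].
by apply/andP; split; lra.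
Qed.

End Oscillation.

(** * Factorization through stages, and oscillating functions *)

Section System.
Variables (X : topologicalType) (A : Type) (le : A -> A -> Prop) (e : A -> X -> X -> Prop).
Hypothesis cX : compact [set: X].
Hypothesis os : open_system le e.
Hypothesis nondeg : forall a x, exists y, e a x y /\ x <> y.

Let oe a := os_oe os a.

Let mono a b x y : le a b -> e b x y -> e a x y.
Proof. by move=> ab; exact: (os_mono os ab). Qed.

Lemma le_pair a b : exists c, le a c /\ le b c.
Proof.
have [c [H _]] := os_lub os (B := [set a; b]) (finite_set_countable (finite_set2 a b)).
by exists c; split; apply: H; [left | right].
Qed.

Lemma seq_lub (u : nat -> A) : (forall n, le (u n) (u n.+1)) ->
  exists c, (forall n, le (u n) c) /\ forall x y, (forall n, e (u n) x y) -> e c x y.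
Proof.
move=> um.
have umn m n : (m <= n)%N -> le (u m) (u n).
  by apply: (chain_le _ _ um); [exact: (os_refl os) | exact: (os_trans os)].
have [|c [H1 H2]] := os_lub os (B := range u).
  exact: card_image_le.
exists c; split; first by move=> n; apply: H1; exists n.
move=> x y H; apply: H2; last by move=> _ [n _ <-].
split; first by exists (u 0%N), 0%N.
move=> _ _ [m _ <-] [n _ <-]; exists (u (maxn m n)); first by exists (maxn m n).
by split; apply: umn; rewrite ?leq_maxl ?leq_maxr.
Qed.

Lemma dir_e a b : exists c, forall x y, e c x y -> e a x y /\ e b x y.
Proof.
have [c [ac bc]] := le_pair a b; exists c => x y h.
by split; [exact: mono ac h | exact: mono bc h].
Qed.

Lemma lub_countable (I : countType) a (b : I -> A) : exists c, le a c /\ forall i, le (b i) c.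
Proof.
have [c [H _]] := os_lub os (@countable_range _ _ (fun o => oapp b a o)).
by exists c; split; [apply: H; exists None | move=> i; apply: H; exists (Some i)].
Qed.

(** For every [n] some stage reduces the oscillation of [g] on classes below [1 / n.+1]; an upper
    bound of these countably many stages reduces it to zero. *)
Lemma exact_index a (g : X -> R) : continuous g -> exists b, le a b /\ invariant (e b) g.
Proof.
move=> cg.
have ex n : exists b, forall x y, e b x y -> `|g x - g y| < n.+1%:R^-1.
  apply: (family_osc a cX (fun i => oe_closed (oe i)) dir_e cg); first by rewrite invr_gt0 ltr0n.
  by move=> x y /(os_sep os) ->.
have /choice[b bP] := ex.
have [c [ac H]] := lub_countable a b; exists c; split => //.
move=> x y h; apply/eqP; rewrite -subr_eq0 -normr_le0; apply/ler_addgt0Pr => d d0; rewrite add0r.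
have := bP _ x y (os_mono os (H (Num.truncn d^-1)) h); move/ltW/le_trans; apply.
by rewrite invf_ple ?posrE ?ltr0n // ltW // truncnS_gt.
Qed.

Hypothesis hX : hausdorff_space X.

Definition vec_osc xi sigma k (G : 'I_k -> X -> R) :=
  [/\ le xi sigma, forall i, continuous (G i), forall i, invariant (e sigma) (G i),
    forall i x, 0 <= G i x <= 1 &
    forall x, exists i y z, [/\ e xi x y, e xi x z & 1 / 2 <= G i z - G i y]].

(** A Urysohn function separating two points of one class still oscillates by 1 / 2 on nearby
    classes, because [e xi] is open; finitely many such functions serve all classes. *)
Lemma vec_osc_ex xi : exists sigma k (G : 'I_k -> X -> R), vec_osc xi sigma G.
Proof.
have /choice[f fP] : forall x, exists f : X -> R, [/\ continuous f, forall z, 0 <= f z <= 1 &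
    exists y, [/\ e xi x y, f x = 0 & f y = 1]].
  move=> x; have [y [exy xy]] := nondeg xi x.
  have [|f [cf f01 fx fy]] := urysohn_cpt (A := [set x]) (B := [set y]) hX cX
    (@closed_point _ x hX) (@closed_point _ y hX).
    by apply/seteqP; split => // z [/= -> /xy].
  by exists f; split => //; exists y; rewrite fx ?fy.
pose U x := [set x' | exists y z, [/\ e xi x' y, e xi x' z & 1 / 2 <= f x z - f x y]].
have nU x : nbhs x (U x).
  have [cf _ [y [exy fx fy]]] := fP x.
  have n1 : nbhs x [set z | f x z < 1 / 4] by apply: near_lt; [exact: cf | rewrite fx].
  have n2 : nbhs y [set z | 3 / 4 < f x z] by apply: near_gt; [exact: cf | rewrite fy; lra].
  have h1 := oe_open (oe xi) (oe_refl (oe xi) x) n1.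
  have h2 := oe_open (oe xi) exy n2.
  apply: filterS2 h1 h2 => x' [y' /= ? ?] [z' /= ? ?].
  by exists y', z'; split => //; lra.
have [s sX] := finite_cover cX nU.
pose G (i : 'I_(size s)) := f (tnth (in_tuple s) i).
have /choice[b bP] : forall i, exists b, le xi b /\ invariant (e b) (G i).
  by move=> i; apply: exact_index; have [] := fP (tnth (in_tuple s) i).
have [sigma [s1 s2]] := lub_countable xi b.
exists sigma, (size s), G; split => //.
- by move=> i; have [] := fP (tnth (in_tuple s) i).
- move=> i x y h; have [_] := bP i; apply; exact: mono (s2 i) h.
- by move=> i; have [] := fP (tnth (in_tuple s) i).
move=> x; have [x' xD [y [z [h1 h2 h3]]]] := sX x.
have /tnthP[i iE] : x' \in in_tuple s by exact: xD.
by exists i, y, z; rewrite /G -iE.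
Qed.

Section Dist.
Variables (k : nat) (G : 'I_k -> X -> R) (v : 'I_k -> R).

Definition vdist (x : X) : R := \big[Num.max/0]_(i < k) `|G i x - v i|.

Lemma vdist_cont : (forall i, continuous (G i)) -> continuous vdist.
Proof.
move=> cG; apply: bigmax_continuous => i; apply: cont_norm; apply: cont_sub => //.
exact: cont_cst.
Qed.

Lemma vdist_le x (c : R) : vdist x <= c -> forall i, `|G i x - v i| <= c.
Proof. by move=> /bigmax_leP[_ H] i; exact: H. Qed.

End Dist.

Definition grid k (w : {ffun 'I_k -> 'I_51}) (i : 'I_k) : R := (w i)%:R / 50.

Lemma grid_near k (r : 'I_k -> R) : (forall i, 0 <= r i <= 1) ->
  exists w, forall i, `|r i - grid w i| <= 1 / 50.
Proof.
move=> r01; exists [ffun i => inord (Num.truncn (50 * r i))] => i.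
have /andP[r0 r1] := r01 i.
have r50 : 0 <= 50 * r i by rewrite mulr_ge0.
rewrite /grid ffunE inordK; last first.
  have : (Num.truncn (50 * r i))%:R <= 50%:R :> R.
    by have /andP[h _] := truncn_itv r50; apply: le_trans h _; lra.
  by rewrite ler_nat ltnS.
have /andP[h2 h1] := truncn_itv r50; move: h1.
set t := Num.truncn _ in h2 *; rewrite -(natr1 t) => h1; rewrite ler_norml; apply/andP; split; lra.
Qed.

(** Minus the sup-distance from the grid point [w] to the image of the [xi]-class under [G]. For all
    [w] together, these numbers describe that image up to the mesh. *)
Definition class_dist (xi : A) k (G : 'I_k -> X -> R) (w : {ffun 'I_k -> 'I_51}) :=
  emax (e xi) (fun x => - vdist G (grid w) x).

(** Codes: the size of the family and, for every grid point, an index in a dense sequence. They are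
    countably many, so a single stage bounds a realization of each realizable code. *)
Let ctype := {k : nat & {ffun {ffun 'I_k -> 'I_51} -> nat}}.

Definition dense_fam a := sval (cid (os_dense os a)).

Definition realized (a xi sigma : A) (tau : ctype) := le a xi /\
  exists G : 'I_(tag tau) -> X -> R, vec_osc xi sigma G /\
    forall w x, `|class_dist xi G w x - dense_fam a (tagged tau w) x| <= 1 / 50.

Lemma next_index a : exists b, le a b /\ forall tau, (exists xi sigma, realized a xi sigma tau) ->
  exists xi sigma, realized a xi sigma tau /\ le sigma b.
Proof.
have /choice[f fP] : forall tau, exists sigma, (exists xi sigma, realized a xi sigma tau) ->
    exists xi, realized a xi sigma tau.
  move=> tau; have [[xi [sigma H]]|nH] := pselect (exists xi sigma, realized a xi sigma tau).
    by exists sigma => _; exists xi.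
  by exists a.
have [b [ab fb]] := lub_countable a f; exists b; split=> // tau H.
by have [xi h] := fP tau H; exists xi, (f tau).
Qed.

(* A pressing-down argument.  A stage [xi] records a finite family [G] that oscillates on every
   [e xi]-class, coded up to 1/50 by finitely many members of a countable dense family at an
   earlier stage.  Along an increasing sequence of stages closed under codes, the limit stage has
   the same code as an earlier one, whose family [G0] is already constant on the limit classes;
   the distance between [G0] and [G] is then small somewhere and large somewhere on each class. *)
Lemma oscillating_function a : exists (g : X -> R) (d : R), [/\ continuous g, 0 < d &
  forall x, exists y z, [/\ e a x y, e a x z & d <= g z - g y]].
Proof.
have /choice[nx nxP] := next_index.
pose u n := iter n nx a.
have uS n : le (u n) (u n.+1) by rewrite /u iterS; have [] := nxP (iter n nx a).
have umn m n : (m <= n)%N -> le (u m) (u n).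
  by apply: (chain_le _ _ uS); [exact: (os_refl os) | exact: (os_trans os)].
have [xi [uxi xiE]] := seq_lub uS.
have [sigma [k [G HG]]] := vec_osc_ex xi.
have [_ cG _ G01 Gosc] := HG.
have cN k0 (G0 : 'I_k0 -> X -> R) w : (forall i, continuous (G0 i)) ->
    continuous (fun x => - vdist G0 (grid w) x).
  by move=> cG0 x; apply: cvgN; exact: vdist_cont.
have cK w : continuous (class_dist xi G w) by apply: emax_cont => //; exact: cN.
have dir i j : exists l, forall x y, e (u l) x y -> e (u i) x y /\ e (u j) x y.
  exists (maxn i j) => x y h; split; apply: (mono _ h); apply: umn.
    exact: leq_maxl.
  exact: leq_maxr.
(* These functions are invariant at the limit stage [xi], hence almost invariant at some [u n]; this
   is the pressing down. *)
have /choice[n nP] : forall w : {ffun 'I_k -> 'I_51}, exists n, forall x y, e (u n) x y ->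
    `|class_dist xi G w x - class_dist xi G w y| < 1 / 100.
  move=> w; apply: (family_osc 0%N cX (fun i => oe_closed (oe (u i))) dir (cK w)); first lra.
  by move=> x y /xiE; apply: emax_inv => //; exact: cN.
pose N := \max_w n w.
have NP w x y : e (u N) x y -> `|class_dist xi G w x - class_dist xi G w y| < 1 / 100.
  move=> h; apply: nP; apply: (mono _ h); apply: umn.
  exact: (leq_bigmax w).
have [cd_ dP] := svalP (cid (os_dense os (u N))).
have /choice[idx idxP] : forall w : {ffun 'I_k -> 'I_51}, exists m, forall x,
    `|class_dist xi G w x - dense_fam (u N) m x| <= 1 / 50.
  move=> w; pose m := emax (e (u N)) (class_dist xi G w).
  have [|||j jP] := dP m _ _ (1 / 100 : R); [exact: emax_cont|exact: emax_inv|lra|].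
  exists j => x; have [x' h hE] := emax_att cX (oe (u N)) (cK w) x.
  have := NP w x x' h; have := jP x; rewrite /m -hE -/(dense_fam (u N)).
  rewrite !ler_norml ltr_norml => /andP[? ?] /andP[? ?].
  by apply/andP; split; lra.
pose tau : ctype := existT _ k [ffun w => idx w].
have [_ /(_ tau)] := nxP (u N); case.
  exists xi, sigma; split; first exact: uxi.
  by exists G; split => // w x; rewrite /= ffunE; exact: idxP.
move=> xi0 [sigma0 [[Nxi0 [/= G0 [HG0 app0]]] s0]].
have {}s0 : le sigma0 xi by apply: (os_trans os s0); exact: uxi N.+1.
have [_ cG0 iG0 _ _] := HG0.
have au m : le a (u m) by exact: (umn 0%N).
pose g x : R := \big[Num.max/0]_(i < k) `|G0 i x - G i x|.
have cg : continuous g.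
  by apply: bigmax_continuous => i; apply: cont_norm; apply: cont_sub.
have G0xi i x y : e xi x y -> G0 i x = G0 i y by move=> h; apply: iG0; exact: mono s0 h.
(* On each class [g] reaches 1 / 4, as some [G i] varies by 1 / 2 where [G0 i] is constant; and it
   goes down to 3 / 25, as at [x''] both families are within 3 / 50 of the grid point [w]. *)
exists g, (1 / 10 : R); split; [exact: cg | by rewrite divr_gt0 |].
move=> x.
have [w wP] := grid_near (fun i => G01 i x).
have near0 : vdist G (grid w) x <= 1 / 50.
  by apply: bigmax_le => [|i _]; [lra | exact: wP].
have K1 : - (1 / 50) <= class_dist xi G w x.
  apply: le_trans (emax_ge cX (oe xi) (@cN _ G w cG) (oe_refl (oe xi) x)).
  by rewrite lerN2.
have K2 : - (3 / 50) <= class_dist xi0 G0 w x.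
  have := app0 w x; have := idxP w x; rewrite /= ffunE !ler_norml => /andP[? ?] /andP[? ?].
  by lra.
have [x' exx' x'E] := emax_att cX (oe xi0) (@cN _ G0 w cG0) x.
have Nxx' : e (u N) x x' by exact: mono Nxi0 exx'.
have K3 : - (3 / 50) <= class_dist xi G w x'.
  have := NP w x x' Nxx'; rewrite ltr_norml => /andP[? ?]; lra.
have [x'' ex'' x''E] := emax_att cX (oe xi) (@cN _ G w cG) x'.
have axi : le a xi by exact: uxi 0%N.
have axx'' : e a x x''.
  apply: (oe_trans (oe a)); first exact: mono (au N) Nxx'.
  exact: mono axi ex''.
have gx'' : g x'' <= 3 / 25.
  apply: bigmax_le => [|i _]; first lra.
  have h1 : vdist G0 (grid w) x' <= 3 / 50.
    by move: K2; rewrite /class_dist -x'E lerN2.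
  have h2 : vdist G (grid w) x'' <= 3 / 50.
    by move: K3; rewrite /class_dist -x''E lerN2.
  have := vdist_le h1 i; have := vdist_le h2 i; rewrite -(G0xi i _ _ ex'').
  rewrite !ler_norml => /andP[? ?] /andP[? ?].
  by apply/andP; split; lra.
have [i [y [z [xy xz yz]]]] := Gosc x.
have [p [xp pg]] : exists p, e xi x p /\ 1 / 4 <= g p.
  have gy := le_bigmax 0 (fun i => `|G0 i y - G i y|) i.
  have gz := le_bigmax 0 (fun i => `|G0 i z - G i z|) i.
  rewrite -/(g y) -(G0xi i _ _ xy) in gy; rewrite -/(g z) -(G0xi i _ _ xz) in gz.
  move: gy gz; rewrite /= !ler_norml => /andP[? ?] /andP[? ?].
  have [h|h] := leP (1 / 4) (g y); first by exists y.
  by exists z; split => //; lra.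
exists x'', p; split => //; first exact: mono axi xp.
lra.
Qed.

End System.

Section LinBounds.
Variables (X : topologicalType).
Hypothesis cX : compact [set: X].

Lemma lin_bound (x : T X) (phi : X -> R) (a b M : R) : continuous phi ->
  0 <= a -> a <= b -> b <= 1 -> (forall p, `|phi p| <= M) ->
  `|lin (tv x) phi a b| <= (b - a) * M.
Proof.
move=> cphi a0 ab b1 HM.
have := @lin_dist X _ (@tv_HX X x) phi (fun=> 0) M a b cphi (@cont_cst X R 0) a0 ab b1.
rewrite (@lin_cst X _ (@tv_HX X x)) // mulr0 subr0; apply => p.
by rewrite subr0.
Qed.

Lemma lin01 (x : T X) (phi : X -> R) : continuous phi -> (forall p, 0 <= phi p <= 1) ->
  0 <= lin (tv x) phi 0 1 <= 1.
Proof.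
move=> cphi H.
have := @lin_le X _ (@tv_HX X x) (fun=> 0) phi 0 1 (@cont_cst X R 0) cphi (lexx _) ler01 (lexx _).
have := @lin_le X _ (@tv_HX X x) phi (fun=> 1) 0 1 cphi (@cont_cst X R 1) (lexx _) ler01 (lexx _).
rewrite !(@lin_cst X _ (@tv_HX X x)) // mulr0 mulr1 subr0 => h1 h2.
by rewrite h1 ?h2 // => p; have /andP[] := H p.
Qed.

(** The integral depends continuously on its endpoints. Hence countably many functionals per
    function suffice. *)
Lemma lin_rat_determined (x y : T X) (phi : X -> R) a b : continuous phi ->
  (forall p q : rat, 0 <= ratr p :> R -> ratr p < ratr q :> R -> ratr q <= 1 :> R ->
    lin (tv x) phi (ratr p) (ratr q) = lin (tv y) phi (ratr p) (ratr q)) ->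
  lin (tv x) phi a b = lin (tv y) phi a b.
Proof.
move=> cphi H.
have [[_ [/= a0 [ab b1]]]|nok] := pselect (okS phi a b); last by rewrite /lin; case: pselect.
have [M [M0 HM]] := compact_bounded_fun cX cphi.
apply/eqP; rewrite -subr_eq0 -normr_le0; apply/ler_addgt0Pr => d d0; rewrite add0r.
pose r := d / (4 * M + 1).
have r0 : 0 < r by rewrite divr_gt0 // ltr_wpDl // mulr_ge0.
have rM : 4 * r * M <= d.
  have : r * (4 * M + 1) = d by rewrite divfK // gt_eqF // ltr_wpDl // mulr_ge0.
  by lra.
pose m := (a + b) / 2.
have [p] : exists p : rat, ratr p \in `]a, Num.min m (a + r)[.
  by apply: rat_in_itvoo; rewrite lt_min; apply/andP; split; rewrite /m; lra.
rewrite in_itv /= lt_min => /and3P[ap pm pr].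
have [q] : exists q : rat, ratr q \in `]Num.max m (b - r), b[.
  by apply: rat_in_itvoo; rewrite gt_max; apply/andP; split; rewrite /m; lra.
rewrite in_itv /= gt_max => /andP[/andP[mq rq] qb].
set p' := ratr p in ap pm pr; set q' := ratr q in mq rq qb.
have pq : p' < q' by exact: lt_trans pm mq.
have split3 z : lin (tv z) phi a b =
    lin (tv z) phi a p' + (lin (tv z) phi p' q' + lin (tv z) phi q' b).
  rewrite (@lin_add X _ (@tv_HX X z) phi a p' b) //; [|lra|lra].
  by rewrite (@lin_add X _ (@tv_HX X z) phi p' q' b) //; lra.
have bnd z : `|lin (tv z) phi a p'| <= r * M /\ `|lin (tv z) phi q' b| <= r * M.
  split.
    apply: le_trans (@lin_bound z phi a p' M cphi a0 _ _ HM) _; [lra|lra|].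
    by apply: ler_wpM2r => //; lra.
  apply: le_trans (@lin_bound z phi q' b M cphi _ _ b1 HM) _; [lra|lra|].
  by apply: ler_wpM2r => //; lra.
have E : lin (tv x) phi p' q' = lin (tv y) phi p' q'.
  by apply: H => //; [exact: le_trans a0 (ltW ap) | exact: le_trans (ltW qb) b1].
have [h1 h2] := bnd x; have [h3 h4] := bnd y.
rewrite !split3 E; move: h1 h2 h3 h4; rewrite !ler_norml.
by move=> /andP[? ?] /andP[? ?] /andP[? ?] /andP[? ?]; apply/andP; split; lra.
Qed.

End LinBounds.

(** Recursion for values specified by a relation; [a0] stands in for the values that are not yet
    defined, which by the last hypothesis [P w] ignores. *)
Lemma wf_rec (W A : Type) (lt : W -> W -> Prop) (a0 : A) (P : W -> (W -> A) -> A -> Prop) :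
  well_founded lt ->
  (forall w f, exists a, P w f a) ->
  (forall w f g a, (forall v, lt v w -> f v = g v) -> P w f a -> P w g a) ->
  exists f, forall w, P w f (f w).
Proof.
move=> wf ex ext.
have /choice[F FP] : forall wf : W * (W -> A), exists a, P wf.1 wf.2 a by move=> [w f]; exact: ex.
pose G w (rec : forall v, lt v w -> A) :=
  F (w, fun v => match pselect (lt v w) with left h => rec v h | right _ => a0 end).
pose f := Fix wf (fun _ => A) G.
have fE w : f w = G w (fun v _ => f v).
  apply: Fix_eq => w' f' g' fg; congr F; congr pair; apply/funext => v.
  by case: pselect => // h; exact: fg.
exists f => w; rewrite fE; apply: ext (FP (w, _)) => v vw /=.
by case: pselect.
Qed.

Lemma countable_enum (T : Type) (C : set T) (x0 : T) : countable C ->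
  exists s : nat -> T, forall x, C x -> exists n, s n = x.
Proof.
move=> /countable_injP[f finj].
have /choice[s sP] : forall n, exists x, (exists y, C y /\ f y = n) -> C x /\ f x = n.
  move=> n; have [[y h]|h] := pselect (exists y, C y /\ f y = n); first by exists y.
  by exists x0.
exists s => x Cx; exists (f x); have [|h1 h2] := sP (f x); first by exists x.
by apply: finj => //; rewrite inE.
Qed.

(** * The transfinite tower of trivial bundles *)

Section Core.
Variables (X : topologicalType) (A : Type) (le : A -> A -> Prop) (e : A -> X -> X -> Prop).
Hypothesis cX : compact [set: X].
Hypothesis hX : hausdorff_space X.
Hypothesis os : open_system le e.
Hypothesis nondeg : forall a x, exists y, e a x y /\ x <> y.

Let oe a := os_oe os a.

Let mono a b x y : le a b -> e b x y -> e a x y.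
Proof. by move=> ab; exact: (os_mono os ab). Qed.

(** An oscillating function is rescaled by its minimum and maximum over [E]-classes. Both are
    continuous, and they differ because every [E]-class contains an [e a]-class. *)
Lemma normalized_oscillation a (E : X -> X -> Prop) : open_equiv E -> (forall x y, e a x y -> E x y) ->
  exists (g : X -> R) b, [/\ continuous g /\ (forall x, 0 <= g x <= 1),
    forall x, exists2 y, E x y & g y = 0, forall x, exists2 y, E x y & g y = 1,
    le a b & invariant (e b) g].
Proof.
move=> oE aE; have [g0 [d [cg d0 osc]]] := oscillating_function cX os nondeg hX a.
have cN : continuous (fun x => - g0 x) by move=> x; apply: cvgN; exact: cg.
pose M := emax E g0; pose m x := - emax E (fun x => - g0 x) x.
have cM : continuous M by exact: emax_cont.
have cm : continuous m by move=> x; apply: cvgN; exact: emax_cont.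
have mg x : m x <= g0 x by rewrite lerNl; exact: (emax_ge cX oE cN (oe_refl oE x)).
have gM x : g0 x <= M x by exact: (emax_ge cX oE cg (oe_refl oE x)).
have iM : invariant E M by exact: emax_inv.
have im : invariant E m by move=> x y h; congr (- _); exact: emax_inv.
have gap x : 0 < M x - m x.
  have [y [z [xy xz yz]]] := osc x.
  by rewrite (iM _ _ (aE _ _ xz)) (im _ _ (aE _ _ xy)); have := mg y; have := gM z; lra.
pose g x := (g0 x - m x) / (M x - m x).
have cg' : continuous g.
  apply: cont_mul; first exact: cont_sub.
  by move=> x; apply: cvgV; [rewrite gt_eqF | exact: (cont_sub cM cm)].
have [b [ab gb]] := exact_index cX os a cg'.
exists g, b; split => //.
- split => // x; apply/andP; split.
    by apply: divr_ge0; [rewrite subr_ge0 | exact: ltW].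
  by rewrite /g ler_pdivrMr // mul1r lerD2r.
- move=> x; have [y xy yE] := emax_att cX oE cN x; exists y => //.
  have gm : g0 y = m y by rewrite -(im _ _ xy) /m -yE opprK.
  by rewrite /g gm subrr mul0r.
- move=> x; have [y xy yE] := emax_att cX oE cg x; exists y => //.
  have gM' : g0 y = M y by rewrite -(iM _ _ xy).
  by rewrite /g gM' divff // gt_eqF.
Qed.

Lemma countable_determination a : exists c : nat -> T X -> R,
  [/\ forall j, continuous (c j),
    forall j l x y, 0 <= l <= 1 -> c j (mixT l x y) = (1 - l) * c j x + l * c j y &
    forall x y, hrel (e a) x y <-> forall j, c j x = c j y].
Proof.
have [d [d1 d2]] := os_dense os a.
pose c j (x : T X) : R := if @unpickle (nat * rat * rat)%type j is Some k
  then lin (tv x) (d k.1.1) (ratr k.1.2) (ratr k.2) else 0.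
exists c; split.
- move=> j; rewrite /c; case: unpickle => [k|]; last exact: cont_cst.
  exact: lin_tv_cont.
- move=> j l x y l01; rewrite /c; case: unpickle => [k|]; last by rewrite !mulr0 addr0.
  exact: lin_mix.
move=> x y; split => [H j|H].
  by rewrite /c; case: unpickle => [k|] //; apply: H; have [] := d1 k.1.1.
move=> phi s t cphi inv; apply: lin_rat_determined => // p q p0 pq q1.
apply/eqP; rewrite -subr_eq0 -normr_le0; apply/ler_addgt0Pr => z z0; rewrite add0r.
have z2 : 0 < z / 2 by rewrite divr_gt0.
have [n nP] := d2 phi cphi inv _ z2.
have Hn := H (pickle (n, p, q)); rewrite /c pickleK /= in Hn.
have [cd _] := d1 n.
have h1 := @lin_dist X _ (@tv_HX X x) phi (d n) (z / 2) _ _ cphi cd p0 (ltW pq) q1 nP.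
have h2 := @lin_dist X _ (@tv_HX X y) phi (d n) (z / 2) _ _ cphi cd p0 (ltW pq) q1 nP.
have ba : (ratr q - ratr p) * (z / 2) <= z / 2 :> R by rewrite ger_pMl //; lra.
move: h1 h2; rewrite -Hn !ler_norml => /andP[? ?] /andP[? ?].
by apply/andP; split; lra.
Qed.

(** The last four clauses say that [HX] modulo [hrel (e a)] is [Q] times [HX] modulo [hrel E]. Here
    [a] is the limit of stages at each of which a normalized function oscillates on the previous
    classes, so that [absorb] applies. *)
Lemma block a0 (E : X -> X -> Prop) : open_equiv E -> (forall x y, e a0 x y -> E x y) ->
  exists a (Psi : T X -> Q), [/\ le a0 a, continuous Psi,
    forall x y, hrel (e a) x y -> Psi x = Psi y,
    forall x y, hrel E x y -> Psi x = Psi y -> hrel (e a) x y &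
    forall x q, exists2 y, hrel E x y & Psi y = q].
Proof.
move=> oE aE.
have [g0 [b0 [[cg0 g001] g0z g0o ab0 ig0]]] := normalized_oscillation oE aE.
have /choice[f fP] : forall a, exists gb : (X -> R) * A,
   [/\ continuous gb.1 /\ (forall x, 0 <= gb.1 x <= 1),
    forall x, exists2 y, e a x y & gb.1 y = 0, forall x, exists2 y, e a x y & gb.1 y = 1,
    le a gb.2 & invariant (e gb.2) gb.1].
  move=> a; have [g [b H]] := normalized_oscillation (oe a) (fun x y (h : e a x y) => h).
  by exists (g, b).
pose u n := iter n (fun a => (f a).2) b0.
pose g n := if n is m.+1 then (f (u m)).1 else g0.
pose F n := if n is m.+1 then e (u m) else E.
have oF n : open_equiv (F n) by case: n => [|n]; [exact: oE | exact: oe].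
have gP n : [/\ continuous (g n), forall x, 0 <= g n x <= 1,
    forall x, exists2 y, F n x y & g n y = 0, forall x, exists2 y, F n x y & g n y = 1 &
    invariant (e (u n)) (g n)].
  by case: n => [|n] //; have [[]] := fP (u n).
have uS n : le (u n) (u n.+1) by have [] := fP (u n).
have FS n x y : e (u n) x y -> F n x y.
  case: n => [|n]; last exact: mono.
  by move=> h; apply: aE; exact: mono h.
have [a [ua aE']] := seq_lub os uS.
have /choice[cd cdP] := countable_determination.
(* Index 0 is reserved for the functional that attains 0 and 1 on every class; the others determine
   the stage [u n]. *)
pose c n j (x : T X) : R := if j is i.+1 then cd (u n) i x else lin (tv x) (g n) 0 1.
have p1 : partition01 1 (fun i => i%:R) by split => // -[|] //= _; rewrite ltr01.
(* [lift_max] for the partition with one interval: if [w] has maximum [k] on every class, so has its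
   integral on every class in [HX]. It is used for [g n] and [- g n]. *)
have att n (w : X -> R) (k : R) (x : T X) : continuous w -> (forall p, exists2 q, F n p q & w q = k) ->
    (forall p, w p <= k) -> exists2 y, hrel (F n) x y & k <= lin (tv y) w 0 1.
  move=> cw H wk; have [y xy h] := lift_max cX (oF n) p1 (fun _ : nat => cw) x.
  exists y => //; move: h; rewrite !big_ord1 /=.
  have -> : emax (F n) w = fun=> k.
    apply/funext => p; apply/eqP; rewrite eq_le; apply/andP; split.
      by have [q _ <-] := emax_att cX (oF n) cw p; exact: wk.
    by have [q h <-] := H p; exact: (emax_ge cX (oF n) cw h).
  by rewrite (@lin_cst X _ (@tv_HX X x)) // subr0 mul1r.
have [|||||||Psi [P1 P2 P3 P4]] := @absorb (T X) (@mixT X) (@T_compact X cX) (@mixT_near X)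
   (fun n => hrel (F n)) c.
- by move=> n; apply: hrel_good.
- move=> n [|j] /=; first exact: lin_tv_cont.
  by have [H _ _] := cdP (u n); exact: H.
- move=> n [|j] l x y l01 /=; first exact: lin_mix.
  by have [_ H _] := cdP (u n); exact: H.
- move=> n x y /=; have [_ _ H] := cdP (u n); split=> [h|[_ h]].
    split => [phi s t cphi inv|[|j] /=].
    - by apply: h => // p q /FS; exact: inv.
    - by apply: h; have [] := gP n.
    - exact: (proj1 (H x y)).
  by apply/H => j; exact: (h j.+1).
- by move=> n y /=; have [cg g01 _ _ _] := gP n; exact: lin01.
- move=> n x /=; have [cg g01 gz go _] := gP n.
  have cN : continuous (fun p => - g n p) by move=> p; apply: cvgN; exact: cg.
  have [|p|y xy h] := att n (fun p => - g n p) 0 x cN.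
  - by move=> p; have [q pq qE] := gz p; exists q; rewrite ?qE ?oppr0.
  - by rewrite oppr_le0; have /andP[] := g01 p.
  exists y => //; apply/eqP; rewrite eq_le; have /andP[-> _] := lin01 y cg g01.
  rewrite andbT -oppr_ge0; apply: le_trans h _.
  have := @lin_lin X _ (@tv_HX X y) (fun=> 0) (g n) (-1) 0 1 (@cont_cst X R 0) cg (lexx _) ler01 (lexx _).
  rewrite (@lin_cst X _ (@tv_HX X y)) // mulr0 add0r mulN1r => <-.
  by under [X in _ <= lin _ X _ _]eq_fun do rewrite mulN1r add0r.
- move=> n x /=; have [cg g01 gz go _] := gP n.
  have [p|y xy h] := att n (g n) 1 x cg go; first by have /andP[] := g01 p.
  by exists y => //; apply/eqP; rewrite eq_le h andbT; have /andP[] := lin01 y cg g01.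
have Fa n x y : hrel (e a) x y -> hrel (F n) x y.
  move=> h phi s t cphi inv; apply: h => // p q pq; apply: inv; apply: FS.
  exact: mono (ua n) pq.
exists a, Psi; split => //.
- exact: (os_trans os ab0 (ua 0%N)).
- by move=> x y h; apply: P2 => n; exact: Fa.
move=> x y hE Pxy; have Hn := P3 x y hE Pxy.
apply: (@hrel_bigcap X nat (fun n => e (u n)) 0%N cX (fun n => oe_closed (oe (u n))) _ _ x y (fun n => oe (u n)) aE').
  move=> i j; have umn m n : (m <= n)%N -> le (u m) (u n).
    by apply: (chain_le _ _ uS); [exact: (os_refl os) | exact: (os_trans os)].
  exists (maxn i j) => p q h; split; apply: (mono _ h); apply: umn.
    exact: leq_maxl.
  exact: leq_maxr.
by move=> n; exact: (Hn n.+1).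
Qed.

Lemma hrel_total (x y : T X) (E : X -> X -> Prop) : (forall p q, E p q) -> hrel E x y.
Proof.
move=> tot phi a b cphi inv.
have [ok|nok] := pselect (okS phi a b); last by rewrite /lin; case: pselect.
have [_ [/= a0 [/ltW ab b1]]] := ok.
have [k ->] : exists k : R, phi = fun=> k.
  have [[p _]|np] := pselect (exists p : X, True).
    by exists (phi p); apply/funext => q; exact: inv.
  by exists 0; apply/funext => p; case: np; exists p.
by rewrite (@lin_cst X _ (@tv_HX X x)) // (@lin_cst X _ (@tv_HX X y)).
Qed.

Lemma hrel_eq (x y : T X) : hrel (fun p q => p = q) x y -> x = y.
Proof.
move=> H; apply: val_inj; apply/funext => s.
have [cphi _] := svalP s; rewrite [LHS](linE s) [RHS](linE s); congr (_ * _).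
by apply: H => // p q ->.
Qed.

Variables (W : Type) (lt : W -> W -> Prop).
Hypothesis lt_wf : well_founded lt.
Hypothesis lt_trans : forall u v w, lt u v -> lt v w -> lt u w.
Hypothesis lt_total : forall v w, v = w \/ lt v w \/ lt w v.
Hypothesis lt_countable : forall w, countable [set v | lt v w].
Variables (x0 : X) (w0 : W) (a0 : A) (H : W -> W -> A).
Hypothesis Hsep : forall x y, x <> y -> exists u v, ~ e (H u v) x y.

Let below (f : W -> A) w x y := forall v, lt v w -> e (f v) x y.

Let increasing_below (f : W -> A) w := forall u v, lt u v -> lt v w -> le (f u) (f v).

Lemma below_stage f w : increasing_below f w -> exists a, [/\ forall v, lt v w -> le (f v) a,
  forall u v, (lt u w \/ u = w) -> (lt v w \/ v = w) -> le (H u v) a,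
  open_equiv (below f w) & forall x y, e a x y -> below f w x y].
Proof.
move=> incf; have [s sP] := countable_enum w (lt_countable w).
have [c [Bc cB]] := os_lub os (B := [set f v | v in [set v | lt v w]])
  (sub_countable (card_image_le _ _) (lt_countable w)).
have {}Bc v : lt v w -> le (f v) c by move=> vw; apply: Bc; exists v.
pose sW o := oapp s w o.
have sWP v : lt v w \/ v = w -> exists o, sW o = v.
  by move=> [/sP[n <-]|->]; [exists (Some n) | exists None].
have [a [ca aH]] := lub_countable os c (fun p : option nat * option nat => H (sW p.1) (sW p.2)).
exists a; split.
- by move=> v vw; exact: (os_trans os (Bc v vw) ca).
- by move=> u v /sWP[k <-] /sWP[k' <-]; exact: (aH (k, k')).
- have [[v vw]|nv] := pselect (exists v, lt v w); last first.
    have -> : below f w = fun _ _ => True.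
      by apply/funext => x; apply/funext => y; apply/propext; split => // _ v vw; case: nv; exists v.
    split => //.
    by move=> x x' U _ nU; apply: filterE => y; exists x' => //; exact: nbhs_singleton.
  have -> : below f w = e c.
    apply/funext => x; apply/funext => y; apply/propext; split; last first.
      by move=> h u uw; exact: mono (Bc u uw) h.
    move=> h; apply: cB; last by move=> _ [u uw <-]; exact: h.
    split; first by exists (f v), v.
    move=> _ _ [u uw <-] [u' u'w <-].
    have [<-|[uu'|u'u]] := lt_total u u'.
    - by exists (f u); [exists u | split; exact: (os_refl os)].
    - by exists (f u'); [exists u' | split; [exact: incf | exact: (os_refl os)]].
    - by exists (f u); [exists u | split; [exact: (os_refl os) | exact: incf]].
  exact: oe.
- move=> x y h v vw; exact: mono (os_trans os (Bc v vw) ca) h.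
Qed.

Lemma tower_exists : exists (f : W -> A) (Psi : W -> T X -> Q),
  [/\ forall u v, lt u v -> le (f u) (f v), forall u v w, (lt u w \/ u = w) -> (lt v w \/ v = w) -> le (H u v) (f w) &
   forall w, [/\ continuous (Psi w),
    forall x y, hrel (e (f w)) x y -> Psi w x = Psi w y,
    forall x y, hrel (below f w) x y -> Psi w x = Psi w y -> hrel (e (f w)) x y &
    forall x q, exists2 y, hrel (below f w) x y & Psi w y = q]].
Proof.
pose P w f a := increasing_below f w -> [/\ forall v, lt v w -> le (f v) a,
  forall u v, (lt u w \/ u = w) -> (lt v w \/ v = w) -> le (H u v) a &
  exists Psi : T X -> Q, [/\ continuous Psi,
    forall x y, hrel (e a) x y -> Psi x = Psi y,
    forall x y, hrel (below f w) x y -> Psi x = Psi y -> hrel (e a) x y &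
    forall x q, exists2 y, hrel (below f w) x y & Psi y = q]].
have [w f|w f g a fg|f fP] := wf_rec a0 (P := P) lt_wf.
- have [incf|ninc] := pselect (increasing_below f w); last by exists a0.
  have [b [b1 b2 b3 b4]] := below_stage incf.
  have [a [Psi [ba p1 p2 p3 p4]]] := block b3 b4.
  exists a => _; split; last by exists Psi.
    by move=> v vw; exact: (os_trans os (b1 v vw) ba).
  by move=> u v uw vw; exact: (os_trans os (b2 u v uw vw) ba).
- move=> Pf incg.
  have incf : increasing_below f w.
    by move=> u v uv vw; rewrite !fg //; [exact: incg | exact: lt_trans vw].
  have bE : below g w = below f w.
    apply/funext => x; apply/funext => y; apply/propext; split => h v vw; have := h v vw; by rewrite fg.
  rewrite bE; have [h1 h2 h3] := Pf incf; split => // v vw; rewrite -fg //; exact: h1.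
have inc w : increasing_below f w.
  elim/(well_founded_ind lt_wf): w => w IH u v uv vw.
  by have [h _ _] := fP v (IH v vw); exact: h.
have /choice[Psi PP] : forall w, exists Psi : T X -> Q, [/\ continuous Psi,
    forall x y, hrel (e (f w)) x y -> Psi x = Psi y,
    forall x y, hrel (below f w) x y -> Psi x = Psi y -> hrel (e (f w)) x y &
    forall x q, exists2 y, hrel (below f w) x y & Psi y = q].
  by move=> w; have [_ _] := fP w (inc w).
exists f, Psi; split => // [u v uv|u v w].
  by have [h _ _] := fP v (inc v); exact: h.
by have [_ h _] := fP w (inc w); exact: h.
Qed.

(** Points with equal images are identified at every stage, by induction along [lt], and the stages
    [H u v] below the tower separate points of [X]. Surjectivity is [tower_onto]. *)
Lemma cube_map : exists Phi : T X -> cube (W * nat)%type, [/\ continuous Phi,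
  forall x y, Phi x = Phi y -> x = y & forall z, exists x, Phi x = z].
Proof.
have [f [Psi [incf fH PP]]] := tower_exists.
pose Phi (x : T X) : cube (W * nat)%type := mk_cube (fun k : W * nat => cuP (Psi k.1 x) k.2).
have PhiE x w n : cu (Phi x) (w, n) = cu (Psi w x) n by rewrite cu_mk.
have dir (I : W -> Prop) (i j : {v | I v}) :
    exists k : {v | I v}, forall x y, e (f (sval k)) x y -> e (f (sval i)) x y /\ e (f (sval j)) x y.
  have [ij|[h|h]] := lt_total (sval i) (sval j).
  - by exists i => x y h; rewrite -ij.
  - by exists j => x y h'; split => //; exact: mono (incf _ _ h) h'.
  - by exists i => x y h'; split => //; exact: mono (incf _ _ h) h'.
have inj_below w x y : (forall v, lt v w -> hrel (e (f v)) x y) -> hrel (below f w) x y.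
  move=> h; have [[v vw]|nv] := pselect (exists v, lt v w); last first.
    by apply: hrel_total => p q v vw; case: nv; exists v.
  apply: (@hrel_bigcap X {v | lt v w} (fun v => e (f (sval v))) (exist _ v vw) cX
    (fun v => oe_closed (oe (f (sval v)))) (@dir (lt ^~ w)) (below f w) x y (fun v => oe (f (sval v)))).
    by move=> p q h' u uw; exact: (h' (exist _ u uw)).
  by move=> [u uw]; exact: h.
exists Phi; split.
- apply: cube_continuous => -[w n].
  under eq_fun do rewrite PhiE.
  by apply: continuous_cu; have [] := PP w.
- move=> x y Exy; apply: hrel_eq.
  have Psixy w : Psi w x = Psi w y.
    by apply: cu_inj => n; rewrite -!PhiE Exy.
  have Hw w : hrel (e (f w)) x y.
    elim/(well_founded_ind lt_wf): w => w IH.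
    by have [_ _ h _] := PP w; apply: h => //; exact: inj_below.
  have dirW i j : exists k, forall x y, e (f k) x y -> e (f i) x y /\ e (f j) x y.
    have [k Hk] := dir (fun _ => True) (exist _ i I) (exist _ j I).
    by exists (sval k).
  apply: (@hrel_bigcap X W (fun v => e (f v)) w0 cX (fun v => oe_closed (oe (f v))) dirW (fun p q => p = q) x y (fun v => oe (f v))) => //.
  move=> p q h; apply: contrapT => /Hsep[u [v]]; apply.
  have [uv|[uv|vu]] := lt_total u v.
  - by apply: mono (h v); apply: fH; right.
  - by apply: mono (h v); apply: fH; [left | right].
  - by apply: mono (h u); apply: fH; [right | left].
move=> z.
pose q w : Q := mk_cube (fun n : nat => cuP z (w, n)).
have [||||x _ xq] := @tower_onto (T X) Q W lt (T_compact cX) (@cube_hausdorff nat) lt_wf lt_trans lt_total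
   setT Psi q.
- exact: closedT.
- by exists (embT (HM_cst x0)).
- by move=> w; have [] := PP w.
- move=> w x _; have [_ _ _ p4] := PP w; have [y xy yq] := p4 x (q w).
  exists y; split => // v vw; have [_ h _ _] := PP v; apply/esym/h.
  by move=> phi a b cphi inv; apply: xy => // r r' rr'; apply: inv; exact: rr'.
by exists x; apply: cu_inj => -[w n]; rewrite PhiE xq cu_mk.
Qed.

End Core.

Lemma compact_bijection_homeomorphic (V U : topologicalType) (A : set V) (B : set U)
    (Phi : set_type A -> set_type B) (a0 : set_type A) :
  compact [set: set_type A] -> hausdorff_space (set_type B) -> continuous Phi ->
  (forall x y, Phi x = Phi y -> x = y) -> (forall z, exists x, Phi x = z) -> homeomorphic A B.
Proof.
move=> cA hB cPhi inj /choice[G GP].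
have cG : continuous G.
  apply: closed_graph_continuous => //.
  have -> : [set p : set_type B * set_type A | G p.1 = p.2] = [set p | p.1 = Phi p.2].
    apply/seteqP; split => -[b a] /=; first by move=> <-; rewrite GP.
    by move=> ->; apply: inj; rewrite GP.
  apply: closed_coincidence => //; first exact: continuous_fst.
  exact: (continuous_o cPhi (@continuous_snd _ _)).
pose f v := if pselect (A v) is left h then set_val (Phi (SigSub (mem_set h))) else set_val (Phi a0).
pose g u := if pselect (B u) is left h then set_val (G (SigSub (mem_set h))) else set_val a0.
have fE (a : set_type A) : f (set_val a) = set_val (Phi a).
  rewrite /f; case: pselect => [h|]; last by case; exact: set_valP.
  by congr (set_val (Phi _)); exact: val_inj.
have gE (b : set_type B) : g (set_val b) = set_val (G b).
  rewrite /g; case: pselect => [h|]; last by case; exact: set_valP.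
  by congr (set_val (G _)); exact: val_inj.
have eA v : A v -> exists a : set_type A, v = set_val a by move=> h; exists (SigSub (mem_set h)).
have eB v : B v -> exists a : set_type B, v = set_val a by move=> h; exists (SigSub (mem_set h)).
exists f, g; split; [|split; [|split; [|split; [|split]]]].
- by move=> _ /eA[a ->]; rewrite fE; exact: set_valP.
- by move=> _ /eB[a ->]; rewrite gE; exact: set_valP.
- by move=> _ /eA[a ->]; rewrite fE gE; congr set_val; apply: inj; rewrite GP.
- by move=> _ /eB[b ->]; rewrite gE fE GP.
- apply/subspace_sigL_continuousP.
  have -> : sigL A f = fun a => set_val (Phi a) by apply/funext => a; rewrite /sigL /= fE.
  exact: (continuous_o (@set_val_continuous _ _) cPhi).
- apply/subspace_sigL_continuousP.
  have -> : sigL B g = fun a => set_val (G a) by apply/funext => a; rewrite /sigL /= gE.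
  exact: (continuous_o (@set_val_continuous _ _) cG).
Qed.

Lemma wf_min (W : Type) (lt : W -> W -> Prop) :
  (forall P : set W, P !=set0 -> exists2 m, P m & forall y, P y -> ~ lt y m) -> well_founded lt.
Proof.
move=> H w; apply: contrapT => nw.
have [m nm mmin] := H [set v | ~ Acc lt v] (ex_intro _ w nw).
by apply: nm; constructor => v vm; apply: contrapT => nv; exact: (mmin v nv).
Qed.

Theorem tychonov_of_system (X : topologicalType) (A : Type) (le : A -> A -> Prop)
    (e : A -> X -> X -> Prop) (B : set (set X)) :
  compact [set: X] -> hausdorff_space X -> open_system le e ->
  (forall a x, exists y, e a x y /\ x <> y) ->
  basis B -> card_le_omega1 B -> ~ @second_countable X ->
  exists J : Type, ~ countable [set: J] /\ homeomorphic (HX X) (tychonov_cube J).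
Proof.
move=> cX hX os nondeg [oB bB] [r [rirr [rtr [rtot [rmin rcnt]]]]] nsc.
have [a0 _] := os_lub os (B := set0) (countable0 _).
have [x0 _] : exists x : X, True.
  apply: contrapT => nX; apply: nsc; exists set0; first exact: countable0.
  by split=> [U //|x]; case: nX; exists x.
pose W := {U : set X | B U}; pose lt (u v : W) := r (sval u) (sval v).
have Winj (u v : W) : sval u = sval v -> u = v.
  by case: u v => [u Bu] [v Bv] /= uv; subst v; congr exist; exact: Prop_irrelevance.
have Bnbhs x V : nbhs x V -> exists u : W, sval u x /\ sval u `<=` V.
  by move=> /(bB x)[U [/= BU Ux] UV]; exists (exist _ U BU).
have [w0 _] := Bnbhs x0 setT filterT.
have lt_wf : well_founded lt.
  apply: wf_min => P [w Pw].
  have [||m [v Pv <-] mmin] := rmin (sval @` P).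
  - by move=> _ [v _ <-]; exact: svalP.
  - by exists (sval w), w.
  by exists v => // u Pu; apply: mmin; exists u.
have lt_trans u v w : lt u v -> lt v w -> lt u w by apply: rtr; exact: svalP.
have lt_total u v : u = v \/ lt u v \/ lt v u.
  by have [/Winj->|] := rtot _ _ (svalP u) (svalP v); [left | right].
have lt_cnt w : countable [set v | lt v w].
  have /countable_injP[f finj] := rcnt _ (svalP w).
  apply/countable_injP; exists (fun v => f (sval v)) => u v; rewrite !inE => uw vw fuv.
  by apply: Winj; apply: finj => //; rewrite inE; split => //; exact: svalP.
(* One stage for each pair of basic sets that a function separates. As distinct points lie in such a
   pair, these stages distinguish all points. *)
have /choice[H HP] : forall p : W * W, exists a,
    (exists f : X -> R, [/\ continuous f, forall x, sval p.1 x -> f x < 1 / 3 &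
      forall x, sval p.2 x -> 2 / 3 < f x]) -> forall x y, sval p.1 x -> sval p.2 y -> ~ e a x y.
  move=> [u v]; have [[f [cf fu fv]]|nf] := pselect (exists f : X -> R, [/\ continuous f,
    forall x, sval u x -> f x < 1 / 3 & forall x, sval v x -> 2 / 3 < f x]); last by exists a0.
  have [a [_ af]] := exact_index cX os a0 cf; exists a => _ x y /= /fu h1 /fv h2 /af h3.
  by rewrite h3 in h1; lra.
have [|Phi [cPhi inj onto]] := cube_map cX hX os nondeg lt_wf lt_trans lt_total lt_cnt x0 w0 a0 (H := fun u v => H (u, v)).
  move=> x y xy.
  have [|f [cf f01 fx fy]] := urysohn_cpt (A := [set x]) (B := [set y]) hX cX
    (@closed_point _ x hX) (@closed_point _ y hX).
    by apply/seteqP; split => // z [/= -> /xy].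
  have [|u [ux uf]] := Bnbhs x [set z | f z < 1 / 3].
    by apply: near_lt; [exact: cf | rewrite fx //; lra].
  have [|v [vy vf]] := Bnbhs y [set z | 2 / 3 < f z].
    by apply: near_gt; [exact: cf | rewrite fy //; lra].
  by exists u, v; apply: HP => //; exists f.
exists (W * nat)%type; split.
  move=> cW; apply: nsc; exists B => //.
  have -> : B = (fun p : W * nat => sval p.1) @` setT.
    apply/seteqP; split => [U BU|_ [p _ <-]]; last exact: svalP.
    by exists (exist _ U BU, 0%N).
  exact: sub_countable (card_image_le _ _) cW.
apply: (compact_bijection_homeomorphic (Phi := Phi) (embT (HM_cst x0))) => //.
- exact: (T_compact cX).
- exact: (@cube_hausdorff (W * nat)%type).
Qed.

(** * Systems of openly generated compacta *)

Section SaturatedBasis.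
Variables (X : topologicalType) (e : X -> X -> Prop) (V : nat -> set X).
Hypothesis cX : compact [set: X].
Hypothesis oV : forall n, open (V n).
Hypothesis bV : forall x U, open U -> (forall y, e x y -> U y) -> exists n, V n x /\ V n `<=` U.

Definition cupV (l : seq nat) := [set x | exists2 n, n \in l & V n x].

Lemma sat_cover (C O : set X) : closed C -> open O ->
  (forall x y, C x -> e x y -> O y) -> exists l, C `<=` cupV l /\ cupV l `<=` O.
Proof.
move=> cC oO CO.
have /choice[n nP] : forall x, exists n, C x -> V n x /\ V n `<=` O.
  move=> x; have [Cx|nCx] := pselect (C x); last by exists 0%N.
  by have [n h] := bV oO (fun y => @CO x y Cx); exists n.
have [x|s sP] := @finite_cover X (fun x => if pselect (C x) then V (n x) else ~` C) cX.
  case: pselect => h; apply: open_nbhs_nbhs; split => //; first by have [] := nP x h.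
  by rewrite openC.
exists [seq n x | x <- s & `[< C x >]]; split.
  move=> x Cx; have [y ys] := sP x; case: pselect => // Cy Vx.
  by exists (n y) => //; apply: map_f; rewrite mem_filter ys andbT; apply/asboolP.
move=> x [m /mapP[y]]; rewrite mem_filter => /andP[/asboolP Cy _] -> Vx.
by have [_ h] := nP y Cy; exact: h.
Qed.

Definition sep_fun (l : seq nat * seq nat) (u : X -> R) :=
  [/\ continuous u, invariant e u, forall x, 0 <= u x <= 1, forall x, cupV l.1 x -> u x = 0 &
   forall x, cupV l.2 x -> u x = 1].

Lemma sep_fun_ex (phi : X -> R) (s t : R) : continuous phi -> invariant e phi -> s < t ->
  exists l, (exists u, sep_fun l u) /\ (forall x, phi x <= s -> cupV l.1 x) /\
    (forall x, t <= phi x -> cupV l.2 x).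
Proof.
move=> cphi inv st.
pose s1 := (2 * s + t) / 3; pose t1 := (s + 2 * t) / 3.
have st1 : s < s1 by rewrite /s1; lra.
have s1t1 : s1 < t1 by rewrite /s1 /t1; lra.
have t1t : t1 < t by rewrite /t1; lra.
have [|||l1 [h1 k1]] := @sat_cover [set x | phi x <= s] [set x | phi x < s1].
- exact: (closed_pre (D := [set z | z <= s]) cphi (@closed_le _ s)).
- exact: (open_comp (f := phi) (D := [set z | z < s1]) (fun x _ => cphi x) (@open_lt _ s1)).
- by move=> x y /= xs /inv <-; exact: le_lt_trans xs st1.
have [|||l2 [h2 k2]] := @sat_cover [set x | t <= phi x] [set x | t1 < phi x].
- exact: (closed_pre (D := [set z | t <= z]) cphi (@closed_ge _ t)).
- exact: (open_comp (f := phi) (D := [set z | t1 < z]) (fun x _ => cphi x) (@open_gt _ t1)).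
- by move=> x y /= xs /inv <-; exact: lt_le_trans t1t xs.
have d0 : 0 < t1 - s1 by rewrite subr_gt0.
exists (l1, l2); split => //.
exists (fun x => Num.min (Num.max ((t1 - s1)^-1 * phi x + - ((t1 - s1)^-1 * s1)) 0) 1); split.
- apply: min_continuous; last exact: cont_cst.
  by apply: max_continuous; [exact: continuous_affine | exact: cont_cst].
- by move=> x y /inv ->.
- by move=> x; rewrite le_min ge_min le_max lexx orbT ler01 lexx orbT.
- move=> x /k1/= h; rewrite -mulrBr max_r ?min_l //.
  by rewrite pmulr_rle0 ?invr_gt0 // subr_le0 ltW.
- move=> x /k2/= h; rewrite -mulrBr min_r // le_max; apply/orP; left.
  by rewrite mulrC ler_pdivlMr // mul1r lerD2r ltW.
Qed.

(** One invariant function is chosen for each separable pair of finite unions of the [V n]. Any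
    invariant [phi] is then near a staircase: the sum of equal rational multiples of the functions
    that separate [phi <= s i] from [s i.+1 <= phi]. *)
Lemma dense_invariant : exists d : nat -> X -> R, (forall n, continuous (d n) /\ invariant e (d n)) /\
  forall phi, continuous phi -> invariant e phi -> forall eps : R, 0 < eps ->
      exists n, forall x, `|phi x - d n x| <= eps.
Proof.
have /choice[u uP] : forall l, exists u : X -> R, continuous u /\ invariant e u /\
    ((exists u, sep_fun l u) -> sep_fun l u).
  move=> l; have [[u h]|h] := pselect (exists u, sep_fun l u).
    by exists u; split; [|split]; have [] := h.
  by exists (fun=> 0); split; [exact: cont_cst | split].
pose D (k : rat * rat * seq (seq nat * seq nat)) x : R :=
  ratr k.1.1 + ratr k.1.2 * \sum_(i < size k.2) u (nth ([::], [::]) k.2 i) x.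
have cD k : continuous (D k).
  apply: cont_add; first exact: cont_cst.
  apply: cont_mul; first exact: cont_cst.
  apply: (sum_continuous (f := fun i => u (nth ([::], [::]) k.2 i))) => j.
  by have [] := uP (nth ([::], [::]) k.2 j).
exists (fun n => if unpickle n is Some k then D k else fun=> 0); split.
  move=> n; case: unpickle => [k|]; last by split => //; exact: cont_cst.
  split => // x y exy; rewrite /D; congr (_ + _ * _); apply: eq_bigr => i _.
  by have [_ [h _]] := uP (nth ([::], [::]) k.2 i); exact: h.
move=> phi cphi inv eps eps0.
have [M [M0 HM]] := compact_bounded_fun cX cphi.
have [q] := rat_in_itvoo eps0; rewrite in_itv /= => /andP[q0 qe].
set z := ratr q in q0 qe.
pose K := (Num.truncn (M / z)).+1.
have KM : M < K%:R * z.
  rewrite -ltr_pdivrMr //; exact: truncnS_gt.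
pose s i : R := - (K%:R * z) + i%:R * z.
have sS i : s i.+1 = s i + z by rewrite /s -natr1; ring.
have ss i : s i < s i.+1 by rewrite sS ltrDl.
have /choice[l lP] := fun i => sep_fun_ex cphi inv (ss i).
pose N := (2 * K)%N.
exists (pickle (- (K%:R * q), q, mkseq l N)) => x; rewrite pickleK /D; cbn [fst snd]; rewrite size_mkseq.
have -> : ratr (- (K%:R * q)) = s 0%N by rewrite /s mul0r addr0 rmorphN rmorphM /= ratr_nat.
rewrite -/z.
under eq_bigr => i _ do rewrite nth_mkseq //.
have uu i : [/\ 0 <= u (l i) x <= 1, phi x <= s i -> u (l i) x = 0 &
    s i.+1 <= phi x -> u (l i) x = 1].
  have [h1 [h2 h3]] := lP i; have [_ [_ /(_ h1)[_ _ h4 h5 h6]]] := uP (l i).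
  by split => // h; [apply: h5; exact: h2 | apply: h6; exact: h3].
(* The first [n] steps approximate [phi] below the level [s n], and equal [s n] above it. *)
have P n : (phi x <= s n -> - z <= phi x - (s 0%N + z * \sum_(i < n) u (l i) x) <= z) /\
    (s n <= phi x -> s 0%N + z * \sum_(i < n) u (l i) x = s n).
  elim: n => [|n [IH1 IH2]].
    rewrite big_ord0 mulr0 addr0; split => // h.
    have := HM x; rewrite ler_norml => /andP[h' _].
    have : s 0%N < phi x by rewrite /s mul0r addr0; lra.
    by rewrite ltNge h.
  rewrite big_ord_recr /= mulrDr addrA.
  have [/andP[u0 u1] uz uo] := uu n.
  split=> h; last first.
    by rewrite IH2 ?uo // ?sS ?mulr1 //; apply: le_trans h; exact: ltW.
  have [h'|h'] := leP (phi x) (s n); first by rewrite uz // mulr0 addr0; exact: IH1.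
  rewrite IH2 ?(ltW h') //; rewrite sS in h.
  have zu : z * u (l n) x <= z by rewrite ger_pMr.
  have zu0 : 0 <= z * u (l n) x by rewrite mulr_ge0 // ltW.
  by apply/andP; split; lra.
have [h _] := P N; have := HM x; rewrite !ler_norml => /andP[_ phM].
have /h/andP[h1 h2] : phi x <= s N by rewrite /s /N natrM; lra.
by apply/andP; split; lra.
Qed.

End SaturatedBasis.

(** * Projections of the limit of an open omega-system *)

Section LimitOfSystem.
Variables (X : topologicalType) (A : Type) (le : A -> A -> Prop) (Xs : A -> topologicalType)
  (p : forall a b : A, Xs b -> Xs a) (q : forall a, X -> Xs a).
Arguments p : clear implicits.
Hypothesis cX : compact [set: X].
Hypothesis hX : hausdorff_space X.
Hypothesis sys : omega_system A le Xs p.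
Hypothesis p_open : forall a b, le a b -> open_map (p a b).
Hypothesis cq : forall a, continuous (q a).
Hypothesis pq : forall a b x, le a b -> p a b (q b x) = q a x.
Hypothesis q_inj : forall x y, (forall a, q a x = q a y) -> x = y.
Hypothesis q_onto_lim : forall z : forall a, Xs a, (forall a b, le a b -> p a b (z b) = z a) ->
  exists x, forall a, q a x = z a.

Let le_refl a : le a a. Proof. by have [[]] := sys. Qed.
Let le_trans' a b c : le a b -> le b c -> le a c.
Proof. by have [[_ [H _]] _] := sys; exact: H. Qed.
Let le_dir a b : exists c, le a c /\ le b c.
Proof. by have [_ [[_ H] _]] := sys; have [c _ ?] := H a b I I; exists c. Qed.
Let hXs a : hausdorff_space (Xs a).
Proof. by have [_ [_ [_ [_ [_ [H _]]]]]] := sys; have [] := H a. Qed.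
Let cXs a : compact [set: Xs a].
Proof. by have [_ [_ [_ [_ [_ [H _]]]]]] := sys; have [_ []] := H a. Qed.
Let p_onto a b : le a b -> forall y : Xs a, exists x : Xs b, p a b x = y.
Proof. by have [_ [_ [_ [_ [_ [_ H]]]]]] := sys; exact: H. Qed.
Let p_comp a b c (x : Xs c) : le a b -> le b c -> p a b (p b c x) = p a c x.
Proof. by have [_ [_ [_ [[_ [H _]] _]]]] := sys; exact: H. Qed.
Let p_cont a b : le a b -> continuous (p a b).
Proof. by have [_ [_ [_ [[_ [_ H]] _]]]] := sys; exact: H. Qed.

(** Families that have the value [y] at [a] and are coherent below [c] form closed nonempty sets in
    the product, decreasing in [c]; a common element is a point of the limit. *)
Lemma q_onto a (y : Xs a) : exists x, q a x = y.
Proof.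
have ne b : exists z : Xs b, True.
  have [c [ac bc]] := le_dir a b; have [z _] := p_onto ac y.
  by exists (p b c z).
pose d b : Xs b := sval (cid (ne b)).
pose P := prod_topology Xs.
have cP : compact [set: P].
  have -> : [set: P] = [set f | forall i, [set: Xs i] (f i)] by apply/seteqP; split.
  by apply: (@tychonoff {classic A} Xs (fun i => [set: Xs i])) => i; exact: cXs.
pose F (c : {c | le a c}) : set P := [set z : P | z a = y] `&`
  \bigcap_(b in [set b | le b (sval c)]) [set z : P | z b = p b (sval c) (z (sval c))].
have coordP b : continuous (fun z : P => z b) by exact: prod_coord_continuous.
have [|[c ac]|[c ac] [c' ac']|z Hz] := compact_directed cP (F := F) (exist _ a (le_refl a)).
- move=> [c ac]; apply: closedI.
    by apply: closed_coincidence => //; exact: cont_cst.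
  apply: closed_bigI => b bc; apply: closed_coincidence => //.
  by apply: (@continuous_o P _ _ (p b c) (fun z : P => z c)) => //; exact: p_cont.
- have [x xy] := p_onto ac y.
  exists (fun b => if pselect (le b c) is left _ then p b c x else d b).
  split => /=; first by case: pselect.
  move=> b /= bc; case: pselect => // _; case: pselect => // cc.
  by rewrite p_comp.
- have [m [cm c'm]] := le_dir c c'.
  exists (exist _ m (le_trans' ac cm)) => z [/= za zb].
  have zE b : le b m -> z b = p b m (z m) by exact: zb.
  split; split => // b bc /=.
    by rewrite (zE b (le_trans' bc cm)) (zE c cm) p_comp.
  by rewrite (zE b (le_trans' bc c'm)) (zE c' c'm) p_comp.
have [|x xz] := q_onto_lim (z := z).
  move=> b b' bb'; have [c [ac b'c]] := le_dir a b'.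
  have [/= _ H] := Hz (exist _ c ac).
  by rewrite (H b') // (H b (le_trans' bb' b'c)) /= p_comp.
exists x; rewrite xz; have [h _] := Hz (exist _ a (le_refl a)); exact: h.
Qed.

Definition fib a (x y : X) := q a x = q a y.

Let fib_mono a b x y : le a b -> fib b x y -> fib a x y.
Proof. by move=> ab h; rewrite /fib -!(pq _ ab) h. Qed.

Let fib_closed a : closed [set r : X * X | fib a r.1 r.2].
Proof.
apply: closed_coincidence => //.
  exact: (continuous_o (@cq a) (@continuous_fst _ _)).
exact: (continuous_o (@cq a) (@continuous_snd _ _)).
Qed.

Let fib_class_closed a x : closed (fib a x).
Proof. by apply: closed_coincidence => //; exact: cont_cst. Qed.

Lemma fib_saturated a x U : open U -> (forall y, fib a x y -> U y) ->
  exists V : set (Xs a), [/\ open V, V (q a x) & q a @^-1` V `<=` U].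
Proof.
move=> oU xU; pose K := q a @` (~` U).
have cK : closed K.
  apply: compact_closed => //; apply: continuous_compact; first exact: continuous_subspaceT.
  by apply: (subclosed_compact _ cX) => //; rewrite closedC.
exists (~` K); split; first by rewrite openC.
  by move=> [y nUy yx]; apply: nUy; apply: xU; rewrite /fib yx.
by move=> y /= nK; apply: contrapT => nUy; apply: nK; exists y.
Qed.

Lemma fib_small (I : Type) (i0 : I) (u : I -> A) x U : open U ->
  (forall i j, exists k, le (u i) (u k) /\ le (u j) (u k)) ->
  (forall y, (forall i, fib (u i) x y) -> U y) -> exists i, forall y, fib (u i) x y -> U y.
Proof.
move=> oU dir xU; apply: contrapT => nH.
have [|i|i j|y Hy] := compact_directed cX (F := fun i => fib (u i) x `&` ~` U) i0.
- by move=> i; apply: closedI => //; rewrite closedC.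
- apply: contrapT => h; apply: nH; exists i => y xy; apply: contrapT => nU.
  by apply: h; exists y.
- have [k [ik jk]] := dir i j; exists k => y [xy nU].
  by split; split => //; apply: fib_mono xy.
have [_] := Hy i0; apply; apply: xU => i; by have [] := Hy i.
Qed.

(** A neighbourhood of [x'] contains the preimage of an open set at some stage [b] above [a], and
    the image of that set under [p a b] is open. *)
Lemma fib_open a : open_equiv (fib a).
Proof.
split.
- by [].
- by [].
- by move=> x y z; rewrite /fib => ->.
- exact: fib_closed.
move=> x x' U xx' nU.
have [b [ab bU]] : exists b, le a b /\ forall y, fib b x' y -> interior U y.
  have [||[b ab] bU] := @fib_small {b | le a b} (exist _ a (le_refl a)) sval x' (interior U) (@open_interior _ U).
  - move=> [i ai] [j aj]; have [k [ik jk]] := le_dir i j.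
    by exists (exist _ k (le_trans' ai ik)).
  - move=> y Hy; have <- : x' = y; last exact: nU.
    apply: q_inj => c; have [k [ak ck]] := le_dir a c.
    exact: fib_mono ck (Hy (exist _ k ak)).
  by exists b.
have [V [oV Vx' VU]] := fib_saturated (@open_interior _ U) bU.
have nO : nbhs x (q a @^-1` (p a b @` V)).
  apply: cq; apply: open_nbhs_nbhs; split; first exact: p_open.
  by exists (q b x') => //; rewrite pq.
apply: filterS nO => y [v Vv vy].
have [y' y'v] := q_onto v; exists y'.
  by rewrite /fib -(pq y' ab) y'v vy.
by apply: interior_subset; apply: VU; rewrite /= y'v.
Qed.

Lemma fib_basis a : exists V : nat -> set X, (forall n, open (V n)) /\
  forall x U, open U -> (forall y, fib a x y -> U y) -> exists n, V n x /\ V n `<=` U.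
Proof.
have [_ [_ [_ [_ [_ [/(_ a)[_ [_ [B cB [oB bB]]]] _]]]]]] := sys.
have [s sP] := countable_enum (set0 : set (Xs a)) cB.
exists (fun n => if pselect (open (s n)) then q a @^-1` (s n) else set0); split.
  move=> n; case: pselect => h; last exact: open0.
  by apply: open_comp => // x _; exact: cq.
move=> x U oU xU; have [W [oW Wx WU]] := fib_saturated oU xU.
have [|V [/= BV Vx] VW] := bB (q a x) W; first exact: open_nbhs_nbhs.
have [n nV] := sP V BV; exists n; rewrite nV; case: pselect => h; last by case: h; exact: oB.
by split=> // y /VW /WU.
Qed.

Lemma fib_system : open_system le fib.
Proof.
split => //.
- exact: fib_open.
- by move=> a b ab x y; exact: fib_mono.
- move=> B cB; have [_ [_ [oc [_ [cs _]]]]] := sys.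
  have [c lc] := oc B cB; exists c; split; first by have [] := lc.
  move=> dB x y H; have [g [_ [_ [gf _]]]] := cs B c cB dB lc.
  rewrite /fib -(gf (q c x)) // -(gf (q c y)) //; congr g; apply/functional_extensionality_dep => -[b Bb] /=.
  by have [lb _] := lc; rewrite (pq x (lb b Bb)) (pq y (lb b Bb)); exact: H.
- move=> a; have [V [oV bV]] := fib_basis a; exact: dense_invariant cX oV bV.
Qed.

(** Each member of the base contains the fibre of [x] at some stage; at an upper bound of these
    stages the fibre lies in all members. *)
Lemma countable_local_base_stage x a (B : set (set X)) : countable B -> local_base x B ->
  exists b, le a b /\ forall y, fib b x y -> x = y.
Proof.
move=> cB [B1 B2]; have [s sP] := countable_enum (set0 : set X) cB.
have dirA i j : exists k, le i k /\ le j k by exact: le_dir.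
have /choice[u uP] : forall n, exists b, B (s n) -> forall y, fib b x y -> s n y.
  move=> n; have [Bn|nBn] := pselect (B (s n)); last by exists a.
  have [oU Ux] := B1 _ Bn.
  have [y Hy|b bU] := @fib_small A a id x (s n) oU dirA; last by exists b.
  by have <- : x = y by apply: q_inj.
have [b [ab bu]] := lub_countable fib_system a u.
exists b; split => // y xy; apply: contrapT => /eqP nxy.
have := hX; rewrite open_hausdorff => /(_ _ _ nxy)[[U V] /= [Ux Vy] [oU oV UV]].
have [|W BW WU] := B2 U; first by apply: open_nbhs_nbhs; split => //; exact: set_mem.
have [n nW] := sP W BW; rewrite -nW in WU BW.
have Uy : U y by apply: WU; apply: (uP n BW); apply: fib_mono xy; exact: bu.
have : (U `&` V) y by split => //; exact: set_mem.
by rewrite (eqP UV).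
Qed.

Lemma singleton_local_base a x : (forall y, fib a x y -> x = y) ->
  exists B, countable B /\ local_base x B.
Proof.
move=> ax; have [V [oV bV]] := fib_basis a.
exists [set U | (exists n, V n = U) /\ U x]; split.
  apply: sub_countable (countable_range V); apply: subset_card_le => U [[n nU] _].
  by exists n.
split; first by move=> U [[n <-] Vx].
move=> U nU; have [|n [Vx VU]] := bV x (interior U) (@open_interior _ U).
  by move=> y /ax <-; exact: nU.
by exists (V n); [split => //; exists n | exact: subset_trans VU (@interior_subset _ U)].
Qed.

Lemma injective_stage_second_countable a : (forall x y, fib a x y -> x = y) -> @second_countable X.
Proof.
move=> inj; have [V [oV bV]] := fib_basis a.
exists (range V); first exact: countable_range.
split=> [_ [n _ <-] //|x U nU].
have [|n [Vx VU]] := bV x (interior U) (@open_interior _ U).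
  by move=> y /inj <-; exact: nU.
by exists (V n); [split => //; exists n | exact: subset_trans VU (@interior_subset _ U)].
Qed.

(** A one-point fibre makes the character countable at [x], hence everywhere, so every point has a
    one-point fibre at some stage. Closing off countably often gives a stage [c] at which a sequence
    of points, meeting every open set that contains an earlier fibre, has one-point fibres; then all
    fibres at [c] are points. *)
Lemma nondegenerate_fibers : chi_homogeneous X -> ~ @second_countable X ->
  forall a x, exists y, fib a x y /\ x <> y.
Proof.
move=> chi nsc a x; apply: contrapT => nH.
have ax y : fib a x y -> x = y.
  by move=> xy; apply: contrapT => nxy; apply: nH; exists y.
have [Bx [cBx lBx]] := singleton_local_base ax.
have sing z b : exists c, le b c /\ forall y, fib c z y -> z = y.
  have [Bz [lBz cz]] := chi z x Bx lBx.
  by apply: countable_local_base_stage lBz; exact: sub_countable cz cBx.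
have /choice[nx nxP] : forall b, exists c, le b c /\ exists Z : nat -> X,
    (forall n y, fib c (Z n) y -> Z n = y) /\
    (forall z U, open U -> (forall y, fib b z y -> U y) -> exists n, U (Z n)).
  move=> b; have [V [oV bV]] := fib_basis b.
  have /choice[Z ZP] : forall n, exists z, (exists z, V n z) -> V n z.
    move=> n; have [[z Vz]|nV] := pselect (exists z, V n z); first by exists z.
    by exists x.
  have /choice[k kP] := fun n => sing (Z n) b.
  have [c [bc kc]] := lub_countable fib_system b k.
  exists c; split => //; exists Z; split.
    move=> n y h; have [_] := kP n; apply; exact: fib_mono (kc n) h.
  move=> z U oU zU; have [n [Vz VU]] := bV z U oU zU.
  by exists n; apply: VU; apply: ZP; exists z.
pose u n := iter n nx a.
have uS n : le (u n) (u n.+1) by have [] := nxP (u n).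
have umn m n : (m <= n)%N -> le (u m) (u n).
  by apply: (chain_le _ _ uS); [exact: le_refl | exact: le_trans'].
have [c [uc cE]] := seq_lub fib_system uS.
apply: nsc; apply: (@injective_stage_second_countable c) => y z cyz; apply: contrapT => nyz.
(* The points with a nondegenerate fibre form an open set; if it were nonempty, it would contain
   some [Z m]. *)
pose O := [set x | exists y, fib c x y /\ x <> y].
have oO : open O.
  rewrite openE => y1 [y2 [y12 /eqP n12]].
  have := hX; rewrite open_hausdorff => /(_ _ _ n12)[[U V] /= [Ux Vy] [oU oV UV]].
  have nV : nbhs y2 V by apply: open_nbhs_nbhs; split => //; exact: set_mem.
  have nU : nbhs y1 U by apply: open_nbhs_nbhs; split => //; exact: set_mem.
  have := oe_open (fib_open c) y12 nV; apply: filterS2 nU => y1' Uy1' [y2' h12 Vy2'].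
  exists y2'; split => // E; rewrite E in Uy1'.
  by have : (U `&` V) y2' by []; rewrite (eqP UV).
have yO t : fib c y t -> O t.
  move=> yt; have [ty|nty] := pselect (t = z); last by exists z; split => //; rewrite /fib -yt.
  by exists y; split; [exact/esym | move=> E; apply: nyz; rewrite -ty E].
have [||n nO] := @fib_small nat 0%N u y O oO.
- move=> i j; exists (maxn i j); split; apply: umn; [exact: leq_maxl | exact: leq_maxr].
- by move=> t ht; apply: yO; exact: cE.
have [_ [Z [Z1 Z2]]] := nxP (u n).
have [m [t [h1 h2]]] := Z2 y O oO nO.
by apply: h2; apply: (Z1 m); exact: fib_mono (uc n.+1) h1.
Qed.

End LimitOfSystem.

Theorem tychonov_of_openly_generated (X : topologicalType) :
  hausdorff_space X -> compact [set: X] ->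
  openly_generated X -> chi_homogeneous X -> weight_omega1 X ->
  exists J : Type, ~ countable [set: J] /\ homeomorphic (HX X) (tychonov_cube J).
Proof.
move=> hX cX [A [le [Xs [p [sys [p_open [f [g [fL [gX [gf [fg [cf cg]]]]]]]]]]]]] chi [[B [bB cB]] nsc].
pose q a (x : X) : Xs a := f x (exist _ a I).
have cq a : continuous (q a).
  have {}cf : continuous f by apply/continuous_subspace_setT.
  exact: (continuous_o (@prod_coord_continuous _ _ (exist _ a I)) cf).
have pq a b x : le a b -> p a b (q b x) = q a x.
  by move=> ab; exact: (fL x I (exist _ a I) (exist _ b I) ab).
have q_inj x y : (forall a, q a x = q a y) -> x = y.
  move=> H; rewrite -(gf x I) -(gf y I); congr g.
  by apply/functional_extensionality_dep => -[a []]; exact: H.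
have q_lim (z : forall a, Xs a) : (forall a b, le a b -> p a b (z b) = z a) ->
    exists x, forall a, q a x = z a.
  move=> Hz; pose z' (i : {a : A | setT a}) : Xs (sval i) := z (sval i).
  have z'L : lim_set A le Xs p setT z' by move=> i j ij; exact: Hz.
  by exists (g z') => a; rewrite /q fg.
have os : open_system le (fib q) by exact: (fib_system cX sys p_open cq pq q_inj q_lim).
have nd : forall a x, exists y, fib q a x y /\ x <> y.
  exact: (nondegenerate_fibers cX hX sys p_open cq pq q_inj q_lim chi nsc).
exact: (tychonov_of_system cX hX os nd bB cB nsc).
Qed.

(** * Systems given by functions *)

Lemma compact_injection_homeo (Y Z : topologicalType) (f : Y -> Z) (B : set Z) (y0 : Y) :
  compact [set: Y] -> hausdorff_space Z -> continuous f -> (forall x y, f x = f y -> x = y) ->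
  (forall y, B (f y)) -> (forall z, B z -> exists y, f y = z) -> homeo_via [set: Y] B f.
Proof.
move=> cY hZ cf inj fB onto.
have /choice[g gP] : forall z, exists y, B z -> f y = z.
  move=> z; have [Bz|nBz] := pselect (B z); last by exists y0.
  by have [y <-] := onto z Bz; exists y.
exists g; split; [by []|split; [by []|split; [|split; [by []|split]]]].
- by move=> y _; apply: inj; exact: gP.
- exact: continuous_subspaceT.
apply/subspace_sigL_continuousP; apply: closed_graph_continuous => //.
have -> : [set p : set_type B * Y | sigL B g p.1 = p.2] = [set p | set_val p.1 = f p.2].
  apply/seteqP; split => -[b y] /=; rewrite /sigL /=.
    by move=> <-; rewrite gP //; exact: set_valP.
  by move=> E; apply: inj; rewrite gP ?E //; rewrite -E; exact: set_valP.
apply: closed_coincidence => //.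
  exact: (continuous_o (@set_val_continuous _ _) (@continuous_fst _ _)).
exact: (continuous_o cf (@continuous_snd _ _)).
Qed.

(** Finite intersections of preimages of rational intervals: by compactness they shrink to the
    common level sets of the [d n]. *)
Lemma function_basis (Y : topologicalType) (d : nat -> Y -> R) :
  compact [set: Y] -> (forall n, continuous (d n)) ->
  exists V : nat -> set Y, (forall n, open (V n)) /\
    forall x U, open U -> (forall y, (forall n, d n x = d n y) -> U y) -> exists n, V n x /\ V n `<=` U.
Proof.
move=> cY cd.
pose V (l : seq (nat * rat * rat)) := [set y | forall k, k \in l ->
  ratr k.1.2 < d k.1.1 y /\ d k.1.1 y < ratr k.2].
have oV l : open (V l).
  elim: l => [|k l IH].
    by have -> : V [::] = setT by [apply/seteqP; split]; exact: openT.
  have -> : V (k :: l) = ((d k.1.1 @^-1` [set z | ratr k.1.2 < z]) `&`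
      (d k.1.1 @^-1` [set z | z < ratr k.2])) `&` V l.
    apply/seteqP; split => y.
      move=> H; split; first by apply: H; rewrite mem_head.
      by move=> k' k'l; apply: H; rewrite inE k'l orbT.
    by move=> [h1 h2] k'; rewrite inE => /orP[/eqP->|/h2].
  apply: openI => //; apply: openI; apply: open_comp => [x _|]; first exact: cd.
  - exact: open_gt.
  - exact: cd.
  - exact: open_lt.
exists (fun n => if unpickle n is Some l then V l else set0); split.
  by move=> n; case: unpickle => [l|]; [exact: oV | exact: open0].
move=> x U oU xU.
pose K (l : {l | V l x}) := (~` U) `&`
  [set y | forall k, k \in sval l -> ratr k.1.2 <= d k.1.1 y /\ d k.1.1 y <= ratr k.2].
have x0 : V [::] x by [].
have [[l lx] Kl] : exists l, forall y, ~ K l y.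
  apply: contrapT => nH; have [l|l|[l1 h1] [l2 h2]|y Ky] := compact_directed cY (F := K) (exist (fun l => V l x) [::] x0).
  - apply: closedI; first by rewrite closedC.
    have -> : [set y | forall k, k \in sval l -> ratr k.1.2 <= d k.1.1 y /\ d k.1.1 y <= ratr k.2] =
        \bigcap_(k in [set k | k \in sval l]) ((d k.1.1 @^-1` [set z | ratr k.1.2 <= z]) `&`
      (d k.1.1 @^-1` [set z | z <= ratr k.2])) by [].
    by apply: closed_bigI => k _; apply: closedI; apply: closed_pre.
  - by apply: contrapT => h; apply: nH; exists l => y Ky; apply: h; exists y.
  - have h12 : V (l1 ++ l2) x by move=> k; rewrite mem_cat => /orP[/h1|/h2].
    exists (exist (fun l => V l x) _ h12) => y [nUy H]; split; split => // k kl; apply: H; rewrite mem_cat kl ?orbT //.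
  have H n (a b : rat) : ratr a < d n x -> d n x < ratr b -> ratr a <= d n y /\ d n y <= ratr b.
    move=> ha hb; have abx : V [:: (n, a, b)] x by move=> k; rewrite inE => /eqP->.
    by have [_ h] := Ky (exist (fun l => V l x) _ abx); apply: (h (n, a, b)); rewrite mem_head.
  have up n : exists b : rat, d n x < ratr b.
    have [|b] := @rat_in_itvoo R (d n x) (d n x + 1); first by rewrite ltrDl.
    by rewrite in_itv => /andP[h _]; exists b.
  have dn n : exists b : rat, ratr b < d n x.
    have [|b] := @rat_in_itvoo R (d n x - 1) (d n x); first by rewrite ltrBlDr ltrDl.
    by rewrite in_itv => /andP[_ h]; exists b.
  have yx n : d n x = d n y.
    apply/eqP; rewrite eq_sym; apply: contrapT => /negP; rewrite neq_lt => /orP[h|h].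
      have [a] := rat_in_itvoo h; rewrite in_itv /= => /andP[a1 a2].
      have [b b1] := up n; have [h1 _] := H n a b a2 b1.
      by move: a1; rewrite ltNge h1.
    have [b] := rat_in_itvoo h; rewrite in_itv /= => /andP[b1 b2].
    have [a a1] := dn n; have [_ h1] := H n a b a1 b1.
    by move: b2; rewrite ltNge h1.
  by have [h _] := Ky (exist (fun l => V l x) [::] x0); apply: h; exact: xU.
exists (pickle l); rewrite pickleK; split => // y Vy.
apply: contrapT => nUy; apply: (Kl y); split => // k kl /=.
by have [/ltW ? /ltW ?] := Vy k kl.
Qed.

Lemma second_countable_functions (Y : topologicalType) (d : nat -> Y -> R) :
  compact [set: Y] -> (forall n, continuous (d n)) ->
  (forall x y, (forall n, d n x = d n y) -> x = y) -> @second_countable Y.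
Proof.
move=> cY cd sep; have [V [oV bV]] := function_basis cY cd.
exists (range V); first exact: countable_range.
split=> [_ [n _ <-] //|x U nU].
have [|n [Vx VU]] := bV x (interior U) (@open_interior _ U).
  by move=> y /sep <-; exact: nU.
by exists (V n); [split => //; exists n | exact: subset_trans VU (@interior_subset _ U)].
Qed.

Section FunctionSystem.
Variables (X : topologicalType) (A : Type) (le : A -> A -> Prop) (c : A -> nat -> X -> R) (x0 : X).
Hypothesis cX : compact [set: X].
Hypothesis po : partial_order A le.
Hypothesis dir : directed_subset A le setT.
Hypothesis oc : omega_complete A le.
Hypothesis cc : forall a n, continuous (c a n).
Let e a x y := forall n, c a n x = c a n y.
Hypothesis oe : forall a, open_equiv (e a).
Hypothesis mono : forall a b, le a b -> forall x y, e b x y -> e a x y.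
Hypothesis lub : forall (B : set A) a, countable B -> directed_subset A le B -> is_lub A le B a ->
  forall x y, (forall b, B b -> e b x y) -> e a x y.
Hypothesis sep : forall x y, (forall a, e a x y) -> x = y.

Let V := prod_topology (fun _ : nat => R).
Let img a : set V := range (fun x n => c a n x).
Let Xs a : topologicalType := set_type (img a).
Let q a x : Xs a := SigSub (mem_set (ex_intro2 _ _ x I erefl : img a (fun n => c a n x))).

Let qE a x y : q a x = q a y <-> e a x y.
Proof.
split=> [/(congr1 set_val) h n|h]; first exact: (congr1 (fun v : V => v n) h).
by apply: val_inj; apply/funext => n; exact: h.
Qed.

Let cq a : continuous (q a).
Proof. by apply: set_type_continuous; apply: prod_continuous => n; exact: cc. Qed.

Let q_onto a (y : Xs a) : exists x, q a x = y.
Proof. by have [x _ xy] := set_valP y; exists x; apply: val_inj. Qed.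

Let hXs a : hausdorff_space (Xs a).
Proof. by apply: set_type_hausdorff; apply: prod_hausdorff => _; exact: R_hausdorff. Qed.

Let cXs a : compact [set: Xs a].
Proof.
have -> : [set: Xs a] = q a @` setT by apply/seteqP; split => // y _; have [x <-] := q_onto y; exists x.
by apply: continuous_compact => //; apply: continuous_subspaceT.
Qed.

(** Choosing preimages makes [p] total; for [le a b] the value does not depend on the choice. *)
Let p a b (y : Xs b) : Xs a := q a (sval (cid (q_onto y))).

Let pq a b x : le a b -> p a (q b x) = q a x.
Proof. by move=> ab; apply/qE; apply: mono ab _ _ _; apply/qE; case: cid. Qed.

Let p_onto a b : le a b -> forall y : Xs a, exists x : Xs b, p a x = y.
Proof. by move=> ab y; have [x <-] := q_onto y; exists (q b x); exact: pq. Qed.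

Let p_cont a b : le a b -> continuous (@p a b).
Proof.
move=> ab; apply/continuous_closedP => C cC.
have -> : @p a b @^-1` C = q b @` (q a @^-1` C).
  apply/seteqP; split => y /=; first by have [x <-] := q_onto y; rewrite pq // => Cx; exists x.
  by move=> [x Cx <-]; rewrite pq.
apply: compact_closed; first exact: hXs.
apply: continuous_compact; first exact: continuous_subspaceT.
by apply: (subclosed_compact _ cX) => //; exact: closed_pre.
Qed.

Let q_open a U : open U -> open (q a @` U).
Proof.
move=> oU; pose S := [set x | exists y, U y /\ e a x y].
have oS : open S.
  rewrite openE => x [y [Uy xy]].
  have := oe_open (oe a) xy (open_nbhs_nbhs (conj oU Uy)).
  by apply: filterS => x' [y' h1 h2]; exists y'.
have -> : q a @` U = ~` (q a @` (~` S)).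
  apply/seteqP; split.
    by move=> _ [x Ux <-] [y nSy /qE yx]; apply: nSy; exists x.
  move=> z nz; have [x xz] := q_onto z.
  have [y [Uy /qE xy]] : S x by apply: contrapT => nS; apply: nz; exists x.
  by exists y; rewrite -?xy.
rewrite openC; apply: compact_closed; first exact: hXs.
apply: continuous_compact; first exact: continuous_subspaceT.
by apply: (subclosed_compact _ cX) => //; rewrite closedC.
Qed.

Let p_open a b : le a b -> open_map (@p a b).
Proof.
move=> ab U oU.
have -> : @p a b @` U = q a @` (q b @^-1` U).
  apply/seteqP; split => _ [y Uy <-].
    by have [x xy] := q_onto y; exists x; rewrite /= -?xy ?pq // xy.
  by exists (q b y) => //; exact: pq.
by apply: q_open; apply: open_comp => // x _; exact: cq.
Qed.

Let p_comp a b d (x : Xs d) : le a b -> le b d -> p a (p b x) = p a x.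
Proof.
move=> ab bd; have [y <-] := q_onto x; have [_ [tr _]] := po.
by rewrite (pq _ bd) (pq _ ab) (pq _ (tr _ _ _ ab bd)).
Qed.

(** Serves both to identify [X] with the limit and to prove that the system is continuous. *)
Let lim_homeo (Y : topologicalType) (B : set A) (r : forall i : {a | B a}, Y -> Xs (sval i)) :
  compact [set: Y] -> directed_subset A le B -> (forall i, continuous (r i)) ->
  (forall i j y, le (sval i) (sval j) -> p (sval i) (r j y) = r i y) ->
  (forall x y, (forall i, r i x = r i y) -> x = y) -> (forall i z, exists y, r i y = z) ->
  homeo_via [set: Y] (lim_set A le Xs p B) (fun y i => r i y).
Proof.
move=> cY [[b0 Bb0] dB] cr pr inj onto; have [y0 _] := onto (exist _ b0 Bb0) (q b0 x0).
apply: compact_injection_homeo => //.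
- by apply: prod_hausdorff => i; exact: hXs.
- by apply: prod_continuous => i; exact: cr.
- by move=> x y E; apply: inj => i; exact: (congr1 (fun z : forall i : {a | B a}, Xs (sval i) => z i) E).
- by move=> y i j ij; exact: pr.
move=> z zL; have [i|i|[i Bi] [j Bj]|y Hy] := compact_directed cY
    (F := fun i => [set y | r i y = z i]) (exist _ b0 Bb0).
- by apply: closed_coincidence => //; exact: cont_cst.
- exact: onto.
- have [k Bk [ik jk]] := dB i j Bi Bj; exists (exist _ k Bk) => y /= yk.
  split; first by rewrite -(zL (exist _ i Bi) (exist _ k Bk) ik) -yk pr.
  by rewrite /= -(zL (exist _ j Bj) (exist _ k Bk) jk) -yk pr.
by exists y; apply/functional_extensionality_dep => i; exact: Hy.
Qed.

Lemma openly_generated_of_functions : openly_generated X.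
Proof.
have [prefl [ptr _]] := po.
exists A, le, Xs, p; split; last first.
  split; first exact: p_open.
  exists (fun x i => q (sval i) x); apply: (@lim_homeo X setT (fun i => q (sval i))) => //.
  - by move=> i j y ij; exact: pq.
  - move=> x y H; apply: sep => a; apply/qE; exact: (H (exist _ a I)).
split; [exact: po|split; [exact: dir|split; [exact: oc|split; [|split; [|split]]]]].
- split; [|split].
  + by move=> a y; have [x <-] := q_onto y; rewrite pq.
  + by move=> a b d x; exact: p_comp.
  + by move=> a b; exact: p_cont.
- move=> B d cB dB lB; have [uB _] := lB.
  apply: (@lim_homeo (Xs d) B (fun i => @p (sval i) d)) => //.
  + by move=> [i Bi] /=; apply: p_cont; exact: uB.
  + by move=> [i Bi] [j Bj] y /= ij; apply: p_comp => //; exact: uB.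
  + move=> y z; have [x <-] := q_onto y; have [x' <-] := q_onto z => H.
    apply/qE; apply: (lub cB dB lB) => b Bb; apply/qE.
    by have := H (exist _ b Bb); rewrite /= !pq //; exact: uB.
  + by move=> [i Bi] z /=; apply: p_onto; exact: uB.
- move=> a; split; [exact: hXs | split; first exact: cXs].
  apply: (@second_countable_functions _ (fun n (y : Xs a) => (set_val y : V) n)) => //.
    move=> n; exact: (continuous_o (@prod_coord_continuous nat (fun=> R) n) (@set_val_continuous _ _)).
  by move=> x y h; apply: val_inj; apply/funext => n; exact: h.
- exact: p_onto.
Qed.

End FunctionSystem.

(** * Well-orders with countable initial segments *)

Lemma well_order_exists (J : Type) : exists lt : J -> J -> Prop,
  [/\ forall i, ~ lt i i, forall i j k, lt i j -> lt j k -> lt i k,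
    forall i j, i = j \/ lt i j \/ lt j i &
    forall P : set J, P !=set0 -> exists2 m, P m & forall i, P i -> ~ lt i m].
Proof.
have [r wo] := wochoice.well_ordering_principle {classic J}.
have least (P : set J) : P !=set0 -> exists m, [/\ P m, forall i, P i -> r m i &
    forall m', P m' -> (forall i, P i -> r m' i) -> m = m'].
  move=> [i Pi]; have [|m [[Pm mP] mu]] := wo [pred j : {classic J} | `[< P j >]].
    by exists i; exact/asboolP.
  exists m; split; first exact/asboolP.
    by move=> k Pk; apply: mP; exact/asboolP.
  move=> m' Pm' m'P; apply: mu; split; first exact/asboolP.
  by move=> k /asboolP; exact: m'P.
have refl i : r i i.
  by have [|m [-> mP _]] := least [set i]; [exists i | exact: mP].
have anti i j : r i j -> r j i -> i = j.
  move=> ij ji; have [|m [Pm _ mu]] := least [set i; j]; first by exists i; left.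
  have -> : i = m by apply/esym; apply: mu; [left | move=> k [->|->]].
  by apply: mu; [right | move=> k [->|->]].
have total i j : r i j \/ r j i.
  have [|m [[] -> mP _]] := least [set i; j]; first by exists i; left.
    by left; apply: mP; right.
  by right; apply: mP; left.
have trans i j k : r i j -> r j k -> r i k.
  move=> ij jk; have [|m [[[]|] mE mP _]] := least [set i; j; k]; first by exists i; left; left.
  - by rewrite -mE; apply: mP; right.
  - have ji : r j i by rewrite -mE; apply: mP; left; left.
    by rewrite (anti i j ij ji).
  - have kj : r k j by rewrite -mE; apply: mP; left; right.
    by rewrite -(anti j k jk kj).
exists (fun i j => r i j /\ i <> j); split.
- by move=> i [].
- move=> i j k [ij nij] [jk njk]; split; first exact: trans jk.
  by move=> ik; apply: nij; apply: anti => //; rewrite ik.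
- move=> i j; have [->|nij] := pselect (i = j); first by left.
  by right; have [h|h] := total i j; [left | right]; split => // /esym.
- move=> P /least[m [Pm mP _]]; exists m => // i Pi [im nim]; apply: nim.
  by apply: anti => //; exact: mP.
Qed.

(** Each element of the union receives one key (m, n), and keys are ordered lexicographically. *)
Lemma countable_initial_union (J Y : Type) (M : set J) (V : J -> nat -> Y) :
  card_le_omega1 M -> card_le_omega1 [set y | exists m n, M m /\ V m n = y].
Proof.
move=> [r [irr [tr [tot [mn cnt]]]]]; set S := [set y | _].
have [[y0 [m0 [n0 _]]]|S0] := pselect (exists y, S y); last first.
  have nS y : ~ S y by move=> h; apply: S0; exists y.
  exists (fun _ _ => False); split; [|split; [|split; [|split]]].
  - by move=> y _ [].
  - by [].
  - by move=> y z Sy; case: (nS y).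
  - by move=> P PS [y Py]; case: (nS y); exact: PS.
  - by move=> y Sy; case: (nS y).
have /choice[key keyP] : forall y, exists k : J * nat, S y -> M k.1 /\ V k.1 k.2 = y.
  move=> y; have [[m [n h]]|nS] := pselect (S y); first by exists (m, n).
  by exists (m0, n0).
exists (fun y z => r (key y).1 (key z).1 \/ ((key y).1 = (key z).1 /\ ((key y).2 < (key z).2)%N)).
split; [|split; [|split; [|split]]].
- move=> y /keyP[My _] [|[_]]; first exact: irr.
  by rewrite ltnn.
- move=> x y z /keyP[Mx _] /keyP[My _] /keyP[Mz _] [h|[h1 h2]] [h'|[h1' h2']].
  + by left; exact: tr h h'.
  + by left; rewrite -h1'.
  + by left; rewrite h1.
  + by right; split; [rewrite h1 | exact: ltn_trans h2 h2'].
- move=> y z /keyP[My yE] /keyP[Mz zE].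
  have [h|[h|h]] := tot _ _ My Mz; [|by right; left; left|by right; right; left].
  have [lt|lt|e] := ltngtP (key y).2 (key z).2; [by right; left; right|by right; right; right|].
  by left; rewrite -yE -zE h e.
- move=> P PS [y Py].
  have [||m [x Px xm] mmin] := mn [set m | exists2 x, P x & (key x).1 = m].
  - by move=> _ [x /PS/keyP[Mx _] <-].
  - by exists (key y).1; exists y.
  have ex : exists n, `[< exists2 x, P x & (key x).1 = m /\ (key x).2 = n >].
    by exists (key x).2; apply/asboolP; exists x.
  case: (ex_minnP ex) => n /asboolP[z Pz [zm zn]] nmin.
  exists z => // t Pt [h|[h1 h2]].
    by apply: (mmin (key t).1); [exists t | rewrite -zm].
  have : (n <= (key t).2)%N by apply: nmin; apply/asboolP; exists t => //; rewrite h1.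
  by rewrite leqNgt -zn h2.
- move=> z /keyP[Mz _]; have [s sP] := countable_enum (key z).1 (cnt _ Mz).
  apply: (@sub_countable _ _ _ (range (fun k : option nat * nat => V (oapp s (key z).1 k.1) k.2))); last first.
    exact: countable_range.
  apply: subset_card_le => y [/keyP[My yE] [h|[h _]]].
    by have [|n sn] := sP (key y).1; [split | exists (Some n, (key y).2) => //=; rewrite sn].
  by exists (None, (key y).2) => //=; rewrite -h.
Qed.

(** Along the well-order of [S] a new element of [B] is always available, because only countably
    many have been used before. *)
Lemma card_le_omega1_uncountable (T U : Type) (S : set T) (B : set U) :
  card_le_omega1 S -> ~ countable B -> (S #<= B)%card.
Proof.
move=> [r [irr [tr [tot [mn cnt]]]]] ncB.
have [b0 Bb0] : exists b, B b.
  apply: contrapT => h; apply: ncB; have -> : B = set0 by apply/seteqP; split => b // Bb; apply: h; exists b.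
  exact: countable0.
pose W := {x : T | S x}; pose lt (u v : W) := r (sval u) (sval v).
have lt_wf : well_founded lt.
  apply: wf_min => P [w Pw].
  have [||m [v Pv <-] mmin] := mn (sval @` P).
  - by move=> _ [v _ <-]; exact: svalP.
  - by exists (sval w), w.
  by exists v => // u Pu; apply: mmin; exists u.
have [u f|u f g b fg|f fP] := wf_rec b0 (P := fun u (f : W -> U) b => B b /\ forall v, lt v u -> f v <> b) lt_wf.
- have [s sP] := countable_enum (sval u) (cnt _ (svalP u)).
  apply: contrapT => nH; apply: ncB.
  pose h n := if pselect (S (s n)) is left Sn then f (exist _ (s n) Sn) else b0.
  apply: (@sub_countable _ _ _ (range h)); last exact: countable_range.
  apply: subset_card_le => b Bb; apply: contrapT => nb; apply: nH; exists b; split => // v vu vb.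
  have [|n sn] := sP (sval v); first by split; [exact: svalP | exact: vu].
  apply: nb; exists n => //; rewrite /h; case: pselect => [Sn|]; last by rewrite sn; case; exact: svalP.
  rewrite -vb; congr f; move: Sn; rewrite sn => Sn.
  by case: v {vu vb sn} Sn => v Sv Sn; congr exist; exact: Prop_irrelevance.
- by move=> [Bb H]; split => // v vu; rewrite -fg //; exact: H.
pose F x := if pselect (S x) is left Sx then f (exist _ x Sx) else b0.
have Finj : {in S &, injective F}.
  move=> x y; rewrite !inE /F => Sx Sy; case: pselect => // Sx'; case: pselect => // Sy' E.
  have [//|[h|h]] := tot _ _ Sx Sy.
    by have [_ H] := fP (exist _ y Sy'); case: (H (exist _ x Sx')).
  by have [_ H] := fP (exist _ x Sx'); case: (H (exist _ y Sy')).
rewrite -(card_le_eql (inj_card_eq Finj)); apply: subset_card_le => _ [x Sx <-].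
by rewrite /F; case: pselect => // Sx'; have [] := fP (exist _ x Sx').
Qed.

(** * Compacta X for which HX is a cube *)

(** By [family_osc], finitely many of the [c i] determine [f] up to [1 / n.+1], for each [n]. *)
Lemma countable_dependence (M : topologicalType) (I : Type) (i0 : I) (c : I -> M -> R) (f : M -> R) :
  compact [set: M] -> (forall i, continuous (c i)) -> continuous f ->
  (forall x y, (forall i, c i x = c i y) -> f x = f y) ->
  exists d : nat -> I, forall x y, (forall k, c (d k) x = c (d k) y) -> f x = f y.
Proof.
move=> cM cc cf H.
pose F (l : seq I) x y := forall i, List.In i l -> c i x = c i y.
have /choice[l lP] : forall n, exists l, forall x y, F l x y -> `|f x - f y| < n.+1%:R^-1.
  move=> n; apply: (@family_osc M (seq I) F [::] cM) => //.
  - move=> l; have -> : [set p : M * M | F l p.1 p.2] =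
        \bigcap_(i in [set i | List.In i l]) [set p : M * M | c i p.1 = c i p.2] by [].
    apply: closed_bigI => i _; apply: closed_coincidence; first exact: R_hausdorff.
      exact: (continuous_o (cc i) (@continuous_fst _ _)).
    exact: (continuous_o (cc i) (@continuous_snd _ _)).
  - move=> l1 l2; exists (l1 ++ l2) => x y h; split => i il; apply: h; apply: List.in_or_app.
      by left.
    by right.
  - by move=> x y h; apply: H => i; apply: (h [:: i]); left.
exists (fun k => if unpickle k is Some (n, m) then nth i0 (l n) m else i0) => x y h.
apply/eqP; rewrite -subr_eq0 -normr_le0; apply/ler_addgt0Pr => d d0; rewrite add0r.
have /ltW/le_trans : `|f x - f y| < (Num.truncn d^-1).+1%:R^-1.
  apply: lP => i /(In_nth_size i0)[m _ <-].
  by have := h (pickle (Num.truncn d^-1, m)); rewrite pickleK.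
by apply; rewrite invf_ple ?posrE ?ltr0n // ltW // truncnS_gt.
Qed.

Lemma cont_sqr (X : topologicalType) (phi : X -> R) : continuous phi -> continuous (fun x => phi x ^+ 2).
Proof. by move=> cphi; apply: cont_mul. Qed.

(** * Point masses and fast oscillation *)

Section PointMasses.
Variable X : topologicalType.

Definition dl (x : X) : T X := embT (HM_cst x).

Lemma lin_dl x phi a b : continuous phi -> 0 <= a -> a <= b -> b <= 1 ->
  lin (tv (dl x)) phi a b = (b - a) * phi x.
Proof.
move=> cphi a0 ab b1; rewrite /tv /= lin_embed //; last exact: HM_cst.
exact: hm_int_cst.
Qed.

Lemma dl_cont : continuous dl.
Proof.
apply: set_type_continuous; apply: prod_continuous => s.
have [cphi [/= a0 [ab b1]]] := svalP s.
have -> : (fun x => (set_val (dl x) : prod_topology (fun=> R)) s) = (sval s).1.1.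
  apply/funext => x; rewrite -/(tv (dl x) s) linE lin_dl // ?ltW // mulKf // gt_eqF //.
  by rewrite subr_gt0.
exact: cphi.
Qed.

Lemma lin_shift (L : T X) (phi : X -> R) (k : R) : continuous phi ->
  lin (tv L) (fun x => (phi x - k) ^+ 2) 0 1 =
  lin (tv L) (fun x => phi x ^+ 2) 0 1 - 2 * k * lin (tv L) phi 0 1 + k ^+ 2.
Proof.
move=> cphi; have c2 := cont_sqr cphi.
have -> : (fun x => (phi x - k) ^+ 2) = fun x => (phi x ^+ 2 + (- (2 * k)) * phi x) + k ^+ 2 * 1.
  by apply/funext => x; ring.
rewrite (@lin_lin X _ (@tv_HX X L)) //; last 2 first.
- by apply: cont_add => //; apply: cont_mul => //; exact: cont_cst.
- exact: cont_cst.
rewrite (@lin_lin X _ (@tv_HX X L)) // (@lin_cst X _ (@tv_HX X L)) //.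
by ring.
Qed.

Lemma embT_lin al (h : HM X al) phi a b : continuous phi -> 0 <= a -> a <= b -> b <= 1 ->
  lin (tv (embT h)) phi a b = hm_int al phi a b.
Proof. exact: lin_embed. Qed.

Lemma mixT_half_sym (x y : T X) : mixT (1 / 2) x y = mixT (1 / 2) y x.
Proof.
have h : 0 <= (1 / 2 : R) <= 1 by apply/andP; split; lra.
have E : tv (mixT (1 / 2) x y) = tv (mixT (1 / 2) y x).
  by rewrite !tv_mix //; apply/funext => s; rewrite /mixV; lra.
by apply: val_inj; exact: E.
Qed.

(** The average of two point masses is a limit of step functions alternating between the two points.
    What matters is that one switching function [be] serves both pairs. *)
Lemma fast_oscillation (a b : bool -> X) (U : set (T X * T X)) :
  nbhs (mixT (1 / 2) (dl (a false)) (dl (a true)), mixT (1 / 2) (dl (b false)) (dl (b true))) U ->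
  exists be (h : HM bool be), U (embT (HM_map a h), embT (HM_map b h)).
Proof.
have h2 : 0 <= (1 / 2 : R) <= 1 by apply/andP; split; lra.
case=> -[N1 N2] [/= /T_nbhs[F1 [e1 [e10 H1]]] /T_nbhs[F2 [e2 [e20 H2]]]] NU.
pose ends (F : seq (S_HM X)) := map (fun s => (sval s).1.2) F ++ map (fun s => (sval s).2) F.
have [be hbe beP] := hm_mix (ends F1 ++ ends F2) (HM_cst false) (HM_cst true) h2.
exists be, hbe; apply: NU.
have agree (f : bool -> X) (s : S_HM X) : (sval s).1.2 \in ends F1 ++ ends F2 ->
    (sval s).2 \in ends F1 ++ ends F2 ->
    tv (embT (HM_map f hbe)) s = tv (mixT (1 / 2) (dl (f false)) (dl (f true))) s.
  move=> sa sb; rewrite !linE; congr (_ * _).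
  have [cphi [/= a0 [/ltW ab b1]]] := svalP s.
  rewrite lin_mix // !lin_dl // embT_lin //.
  have := beP (fun i => (sval s).1.1 (f i)) _ _ sa sb a0 ab b1.
  by rewrite !(@hm_int_cst bool (fun=> _) _ _ _ _ ab (fun _ _ => erefl)) => <-.
have inE1 (F : seq (S_HM X)) s : List.In s F -> (sval s).1.2 \in ends F /\ (sval s).2 \in ends F.
  by move=> sF; rewrite !mem_cat; split; apply/orP; [left|right]; exact: (map_In _ sF).
split => /=.
  apply: H1 => s /inE1[s1 s2]; rewrite agree ?subrr ?normr0 // mem_cat.
    by rewrite s1.
  by rewrite s2.
apply: H2 => s /inE1[s1 s2]; rewrite agree ?subrr ?normr0 // mem_cat.
  by rewrite s1 orbT.
by rewrite s2 orbT.
Qed.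

Lemma lin_le_parts (L : T X) (f g : X -> R) n t : continuous f -> continuous g -> partition01 n t ->
  (forall k, (k < n)%N -> lin (tv L) f (t k) (t k.+1) <= lin (tv L) g (t k) (t k.+1)) ->
  lin (tv L) f 0 1 <= lin (tv L) g 0 1.
Proof.
move=> cf cg pt H; have [<- <- _] := pt.
rewrite (lin_part L cf pt (leq0n n) (leqnn n)) (lin_part L cg pt (leq0n n) (leqnn n)).
by apply: ler_sum => k _; exact: H.
Qed.

Section StepMarginals.
Variables (L : T X) (be : R -> bool) (phi psi : X -> R) (u v : bool -> R).
Hypothesis hbe : HM bool be.
Hypothesis cphi : continuous phi.
Hypothesis cpsi : continuous psi.
(** Assumed for a function and its square, this says that the function has mean [w i] and variance
    zero wherever [be] is [i]. *)
Let marginal (f : X -> R) (w : bool -> R) := forall i a b, 0 <= a -> a <= b -> b <= 1 ->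
  (forall s, a <= s < b -> be s = i) -> lin (tv L) f a b = (b - a) * w i.
Hypothesis m1 : marginal phi u.
Hypothesis m2 : marginal (fun x => phi x ^+ 2) (fun i => u i ^+ 2).
Hypothesis m3 : marginal psi v.
Hypothesis m4 : marginal (fun x => psi x ^+ 2) (fun i => v i ^+ 2).

Let step_partition : exists n t, partition01 n t /\ forall k, (k < n)%N ->
  [/\ 0 <= t k, t k <= t k.+1, t k.+1 <= 1 & exists i, forall s, t k <= s < t k.+1 -> be s = i].
Proof.
have [n [t [t0 [t1 [ts tc]]]]] := hbe.
have pt : partition01 n t by split.
exists n, t; split => // k kn.
have /andP[k0 _] := part01 pt (ltnW kn); have /andP[_ k1] := part01 pt kn.
split => //; first exact: ltW (ts k kn).
by have [i iP] := tc k kn; exists i => s /andP[h1 h2]; exact: iP.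
Qed.

Let cD : continuous (fun x => (phi x - psi x) ^+ 2).
Proof. by apply: cont_sqr; apply: cont_sub. Qed.

(** Since [(phi + psi - 2 u i) ^ 2] is nonnegative, the integrand is at most [2 phi ^ 2 + 2 psi ^ 2
    - 4 u i (phi + psi) + 4 (u i) ^ 2], whose integral where [be] is [i] is zero by the
    marginals. *)
Lemma equal_marginals : (forall i, u i = v i) -> lin (tv L) (fun x => (phi x - psi x) ^+ 2) 0 1 <= 0.
Proof.
move=> uv; have [n [t [pt tP]]] := step_partition.
have c0 := @cont_cst X R 0.
have := lin_le_parts (L := L) cD c0 pt.
rewrite (@lin_cst X _ (@tv_HX X L)) // mulr0; apply => k /tP[t0 tt t1 [i iP]].
pose g x := 2 * (phi x ^+ 2) + 2 * (psi x ^+ 2) + (- (4 * u i)) * phi x + (- (4 * u i)) * psi x + 4 * u i ^+ 2.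
pose g1 x := 4 * u i ^+ 2 + 2 * (phi x ^+ 2).
pose g2 x := g1 x + 2 * (psi x ^+ 2).
pose g3 x := g2 x + (- (4 * u i)) * phi x.
have c1 : continuous g1.
  by apply: cont_add; [exact: cont_cst | apply: cont_mul; [exact: cont_cst | exact: cont_sqr]].
have c2 : continuous g2.
  by apply: cont_add => //; apply: cont_mul; [exact: cont_cst | exact: cont_sqr].
have c3 : continuous g3 by apply: cont_add => //; apply: cont_mul => //; exact: cont_cst.
have c4 : continuous (fun x => g3 x + (- (4 * u i)) * psi x).
  by apply: cont_add => //; apply: cont_mul => //; exact: cont_cst.
apply: le_trans (@lin_le X _ (@tv_HX X L) _ (fun x => g3 x + (- (4 * u i)) * psi x) _ _ cD c4 t0 tt t1 _) _.
  move=> x; rewrite /g3 /g2 /g1.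
  by have := sqr_ge0 (phi x + psi x - 2 * u i); rewrite !expr2; lra.
rewrite (@lin_lin X _ (@tv_HX X L)) // (@lin_lin X _ (@tv_HX X L)) //.
rewrite (@lin_lin X _ (@tv_HX X L) g1) //; last exact: cont_sqr.
rewrite (@lin_lin X _ (@tv_HX X L) (fun=> 4 * u i ^+ 2)) //; last 2 first.
- exact: cont_cst.
- exact: cont_sqr.
rewrite !(@lin_cst X _ (@tv_HX X L)) // (m1 t0 tt t1 iP) (m2 t0 tt t1 iP) (m3 t0 tt t1 iP) (m4 t0 tt t1 iP).
by rewrite -uv !expr2; lra.
Qed.

(** With [c = u i - v i], the integrand is at least [2 c (phi - psi) - 1], whose mean where [be] is
    [i] is [2 c ^ 2 - 1 = 1]. *)
Lemma distant_marginals : (forall i, (u i - v i) ^+ 2 = 1) ->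
  1 <= lin (tv L) (fun x => (phi x - psi x) ^+ 2) 0 1.
Proof.
move=> uv; have [n [t [pt tP]]] := step_partition.
have c0 := @cont_cst X R 1.
have := lin_le_parts (L := L) c0 cD pt.
rewrite (@lin_cst X _ (@tv_HX X L)) // subr0 mulr1; apply => k /tP[t0 tt t1 [i iP]].
pose c := u i - v i.
have cc : c ^+ 2 = 1 by exact: uv.
have c1 : continuous (fun x => - 1 + (2 * c) * phi x).
  by apply: cont_add; [exact: cont_cst | apply: cont_mul => //; exact: cont_cst].
have c2 : continuous (fun x => - 1 + (2 * c) * phi x + (- (2 * c)) * psi x).
  by apply: cont_add => //; apply: cont_mul => //; exact: cont_cst.
apply: le_trans (@lin_le X _ (@tv_HX X L) (fun x => - 1 + (2 * c) * phi x + (- (2 * c)) * psi x) _ _ _ c2 cD t0 tt t1 _).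
  rewrite (@lin_lin X _ (@tv_HX X L)) // (@lin_lin X _ (@tv_HX X L) (fun=> - 1)) //; last exact: cont_cst.
  rewrite !(@lin_cst X _ (@tv_HX X L)) // (m1 t0 tt t1 iP) (m3 t0 tt t1 iP).
  have -> : (t k.+1 - t k) * -1 + 2 * c * ((t k.+1 - t k) * u i) + - (2 * c) * ((t k.+1 - t k) * v i) =
    (t k.+1 - t k) * (2 * c ^+ 2 - 1) by rewrite /c; ring.
  by rewrite cc; lra.
move=> x; have := sqr_ge0 (phi x - psi x - c).
have -> : (phi x - psi x - c) ^+ 2 = (phi x - psi x) ^+ 2 - 2 * c * phi x + 2 * c * psi x + c ^+ 2 by ring.
by rewrite cc; lra.
Qed.

End StepMarginals.

Lemma lin_affine (L : T X) (f : X -> R) (c d w a b : R) : continuous f ->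
  0 <= a -> a <= b -> b <= 1 -> lin (tv L) f a b = (b - a) * w ->
  lin (tv L) (fun x => f x ^+ 2) a b = (b - a) * w ^+ 2 ->
  lin (tv L) (fun x => c * f x + d) a b = (b - a) * (c * w + d) /\
  lin (tv L) (fun x => (c * f x + d) ^+ 2) a b = (b - a) * (c * w + d) ^+ 2.
Proof.
move=> cf a0 ab b1 h1 h2; have c2 := cont_sqr cf; have cd k := @cont_cst X R k.
split.
  have -> : (fun x => c * f x + d) = fun x => d + c * f x by apply/funext => x; rewrite addrC.
  by rewrite (@lin_lin X _ (@tv_HX X L)) // (@lin_cst X _ (@tv_HX X L)) // h1; ring.
have -> : (fun x => (c * f x + d) ^+ 2) = fun x => (d ^+ 2 + (2 * c * d) * f x) + c ^+ 2 * f x ^+ 2.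
  by apply/funext => x; ring.
rewrite (@lin_lin X _ (@tv_HX X L)) //; last by apply: cont_add => //; exact: cont_mul.
by rewrite (@lin_lin X _ (@tv_HX X L)) // (@lin_cst X _ (@tv_HX X L)) // h1 h2; ring.
Qed.

End PointMasses.

(** * Closed sets of cube coordinates and functionals *)

Section CubeHX.
Variables (X : topologicalType) (J : Type).
Hypothesis cX : compact [set: X].
Hypothesis hX : hausdorff_space X.
Variables (Phi : T X -> cube J) (Psi : cube J -> T X).
Hypothesis cPhi : continuous Phi.
Hypothesis cPsi : continuous Psi.
Hypothesis PhiK : forall L, Psi (Phi L) = L.
Hypothesis PsiK : forall z, Phi (Psi z) = z.
Hypothesis J_unc : ~ countable [set: J].

(* A closed set of nodes contains, with every coordinate of the cube, countably many functionals that
   determine it, and conversely; the countable closed sets will index an omega-system. *)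
Notation node := (J + S_HM X)%type.

Lemma okS_zero : okS (fun _ : X => 0) 0 1.
Proof. by split; [exact: cont_cst | rewrite lexx ltr01]. Qed.

Lemma J_inhabited : exists j : J, True.
Proof.
apply: contrapT => nJ; apply: J_unc.
have -> : [set: J] = set0 by apply/seteqP; split => j //= _; apply: nJ; exists j.
exact: countable0.
Qed.

Definition cube_support : {d : J -> nat -> S_HM X | forall j x y,
  (forall k, tv x (d j k) = tv y (d j k)) -> cu (Phi x) j = cu (Phi y) j}.
Proof.
apply: cid; have /choice[d dP] : forall j, exists d : nat -> S_HM X, forall x y,
    (forall k, tv x (d k) = tv y (d k)) -> cu (Phi x) j = cu (Phi y) j.
  move=> j; apply: (@countable_dependence (T X) (S_HM X) (mkS okS_zero) (fun s x => tv x s)).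
  - exact: T_compact.
  - by move=> s; exact: coord_cont.
  - by apply: continuous_cu.
  - by move=> x y h; have -> : x = y by apply: val_inj; apply/funext => s; exact: h.
by exists d.
Qed.

Definition coord_support : {d : S_HM X -> nat -> J | forall s z z',
  (forall k, cu z (d s k) = cu z' (d s k)) -> tv (Psi z) s = tv (Psi z') s}.
Proof.
apply: cid; have [j0 _] := J_inhabited.
have /choice[d dP] : forall s, exists d : nat -> J, forall z z',
    (forall k, cu z (d k) = cu z' (d k)) -> tv (Psi z) s = tv (Psi z') s.
  move=> s; apply: (@countable_dependence (cube J) J j0 (fun j z => cu z j)).
  - exact: cube_compact.
  - by move=> j; exact: cu_continuous.
  - exact: (continuous_o (@coord_cont X s) cPsi).
  - by move=> x y h; have -> : x = y by exact: cu_inj.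
by exists d.
Qed.

(* The nodes adjoined to [(phi, a, b)] besides cube coordinates: [(phi, p, q)] and [(phi ^ 2, p, q)]
   for rational [p < q]. *)
Definition variant (s : S_HM X) (k : nat) : S_HM X :=
  if @unpickle (bool * rat * rat)%type k is Some (b, p, q) then
    let phi := (sval s).1.1 in
    if pselect (okS (if b then fun x => phi x ^+ 2 else phi) (ratr p) (ratr q)) is left h
    then mkS h else s
  else s.

Definition out (n : node) (k : nat) : node :=
  match n with
  | inl j => inr (sval cube_support j k)
  | inr s => if odd k then inl (sval coord_support s k./2) else inr (variant s k./2)
  end.

Definition out_closed (E : set node) := forall n k, E n -> E (out n k).

Definition gen (n : node) : set node := range (fun p : seq nat => foldl out n p).

Lemma gen_closed n : out_closed (gen n).
Proof. by move=> _ k [p _ <-]; exists (rcons p k) => //; rewrite foldl_rcons. Qed.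

Lemma gen_self n : gen n n. Proof. by exists [::]. Qed.

Lemma gen_countable n : countable (gen n). Proof. exact: countable_range. Qed.

Lemma gen_min n E : out_closed E -> E n -> gen n `<=` E.
Proof.
move=> cE En _ [p _ <-]; elim/last_ind: p => [//|p k IH].
by rewrite foldl_rcons; exact: cE.
Qed.

Lemma out_closed_bigcup (I : Type) (D : set I) (E : I -> set node) :
  (forall i, D i -> out_closed (E i)) -> out_closed (\bigcup_(i in D) E i).
Proof. by move=> cE n k [i Di En]; exists i => //; exact: cE. Qed.

Definition funs (E : set node) : set (X -> R) := [set phi | exists2 s, E (inr s) & (sval s).1.1 = phi].

Lemma funs_cont E phi : funs E phi -> continuous phi.
Proof. by move=> [s _ <-]; have [] := svalP s. Qed.

Section Closed.
Variable E : set node.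
Hypothesis cE : out_closed E.

Lemma variant_in s b p q (h : okS (if b then fun x => (sval s).1.1 x ^+ 2 else (sval s).1.1) (ratr p) (ratr q)) :
  E (inr s) -> E (inr (mkS h)).
Proof.
move=> Es; have := cE (pickle (b, p, q)).*2 Es; rewrite /out odd_double doubleK /variant pickleK.
by case: pselect => // h'; congr (E (inr (mkS _))); exact: Prop_irrelevance.
Qed.

Lemma funs_sqr phi : funs E phi -> funs E (fun x => phi x ^+ 2).
Proof.
move=> [s Es <-].
have h : okS (fun x => (sval s).1.1 x ^+ 2) (ratr 0) (ratr 1).
  split; first by apply: cont_sqr; have [] := svalP s.
  by rewrite /= rmorph0 rmorph1 lexx ltr01.
by exists (mkS h) => //; exact: (@variant_in s true 0 1 h).
Qed.

Definition equivT (L L' : T X) := forall j, E (inl j) -> cu (Phi L) j = cu (Phi L') j.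

(** The purpose of closing [E] under [out]: its cube coordinates and its functionals carry the same
    information. *)
Lemma equivT_lin L L' : equivT L L' <->
  forall phi, funs E phi -> forall a b, lin (tv L) phi a b = lin (tv L') phi a b.
Proof.
split => [H phi [s Es <-] a b|H j Ej].
  apply: (lin_rat_determined cX); first by have [] := svalP s.
  move=> p q p0 pq q1; rewrite /lin; case: pselect => // h; congr (_ * _).
  rewrite -(PhiK L) -(PhiK L'); apply: (svalP coord_support) => k; apply: H.
  have Es' : E (inr (mkS h)) by exact: (@variant_in s false p q h).
  by have := cE k.*2.+1 Es'; rewrite /out /= odd_double /= uphalf_double.
apply: (svalP cube_support) => k.
by rewrite !linE; congr (_ * _); apply: H; exists (sval cube_support j k) => //; exact: (cE k Ej).
Qed.

End Closed.

Definition eqX (E : set node) (x y : X) := forall phi, funs E phi -> phi x = phi y.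

Lemma equivT_dl E x y : out_closed E -> equivT E (dl x) (dl y) <-> eqX E x y.
Proof.
move=> cE; rewrite equivT_lin //; split => H phi Ephi; have cphi := funs_cont Ephi.
  by have := H phi Ephi 0 1; rewrite !lin_dl // subr0 !mul1r.
move=> a b; have [[_ [/= a0 [ab b1]]]|nok] := pselect (okS phi a b); last first.
  by rewrite /lin; case: pselect.
by rewrite !lin_dl // ?ltW // (H phi).
Qed.

(** [L] is concentrated on the class of [y]: each [phi] of [E] has variance zero about [phi y], as
    [E] also contains squares. By compactness [f] is at most [d] plus a multiple of a finite sum of
    such squared deviations, for every positive [d]. *)
Lemma equivT_dl_support E L y (f : X -> R) : out_closed E -> equivT E L (dl y) -> continuous f ->
  (forall x, 0 <= f x) -> (forall x, eqX E y x -> f x = 0) -> lin (tv L) f 0 1 = 0.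
Proof.
move=> cE /(equivT_lin cE) H cf f0 fz.
have sq0 phi : funs E phi -> lin (tv L) (fun x => (phi x - phi y) ^+ 2) 0 1 = 0.
  move=> Ephi; rewrite lin_shift ?(funs_cont Ephi) //; last exact: funs_cont Ephi.
  rewrite (H _ Ephi) (H _ (funs_sqr cE Ephi)) !lin_dl //; last 2 first.
  - exact: funs_cont Ephi.
  - by apply: cont_sqr; exact: funs_cont Ephi.
  by ring.
have cphi (s : S_HM X) : continuous (sval s).1.1 by have [] := svalP s.
apply/eqP; rewrite -normr_le0; apply/ler_addgt0Pr => d d0; rewrite add0r.
pose K (l : seq (S_HM X)) := [set x | d <= f x] `&`
  \bigcap_(s in [set s | List.In s l /\ E (inr s)]) [set x | (sval s).1.1 x = (sval s).1.1 y].
have [l lP] : exists l, forall x, ~ K l x.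
  apply: contrapT => nH; have [|l|l1 l2|x Kx] := compact_directed cX (F := K) [::].
  - move=> l; apply: closedI.
      by apply: (closed_pre (D := [set z | d <= z])) => //; exact: closed_ge.
    apply: closed_bigI => s _; apply: closed_coincidence; [exact: R_hausdorff | exact: cphi |].
    exact: cont_cst.
  - apply: contrapT => h; apply: nH; exists l => x Kx; apply: h; by exists x.
  - exists (l1 ++ l2) => x [dx hx]; split; split => // s [sl Es]; apply: hx; split => //.
      by apply: List.in_or_app; left.
    by apply: List.in_or_app; right.
  have [dx _] := Kx [::]; move: dx; rewrite /= fz ?leNgt ?d0 // => phi [s Es <-].
  by have [_ h] := Kx [:: s]; apply/esym; apply: h; split => //; left.
pose w s x : R := if `[< E (inr s) >] then ((sval s).1.1 x - (sval s).1.1 y) ^+ 2 else 0.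
have w0 s x : 0 <= w s x by rewrite /w; case: ifP => // _; exact: sqr_ge0.
have cw s : continuous (w s).
  rewrite /w; case: asboolP => h; last exact: cont_cst.
  by apply: cont_sqr; apply: cont_sub => //; exact: cont_cst.
have linw s : lin (tv L) (w s) 0 1 = 0.
  rewrite /w; case: asboolP => h; first by apply: sq0; exists s.
  by rewrite (@lin_cst X _ (@tv_HX X L)) // mulr0.
pose s0 := mkS okS_zero; pose g x : R := \sum_(i < size l) w (nth s0 l i) x.
have cg : continuous g.
  by apply: (sum_continuous (f := fun i => w (nth s0 l i))) => i; exact: cw.
have g0 x : 0 <= g x by apply: sumr_ge0 => i _; exact: w0.
have gpos x : d <= f x -> 0 < g x.
  move=> dx; rewrite lt0r g0 andbT; apply/eqP => gx0; apply: (lP x); split => // s [sl Es].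
  have [i il is_] := In_nth_size s0 sl.
  have : w s x <= g x.
    rewrite /g (bigD1 (Ordinal il)) //= is_ lerDl; apply: sumr_ge0 => j _; exact: w0.
  rewrite gx0 /w; case: asboolP => // _ h.
  have /eqP : ((sval s).1.1 x - (sval s).1.1 y) ^+ 2 = 0.
    by apply/eqP; rewrite eq_le h sqr_ge0.
  by rewrite sqrf_eq0 subr_eq0 => /eqP.
have [C [C0 HC]] : exists C : R, 0 <= C /\ forall x, f x <= d + C * g x.
  (* Positive everywhere, and equal to [g] where [d <= f]; its lower bound gives one for [g]
     there. *)
  pose m x : R := Num.max (g x) (d - f x).
  have cm : continuous m by apply: max_continuous => //; apply: cont_sub => //; exact: cont_cst.
  have mpos x : 0 < m x.
    have [h|h] := leP d (f x); first by rewrite lt_max gpos.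
    by rewrite lt_max subr_gt0 h orbT.
  have cI : continuous (fun x => (m x)^-1) by move=> x; apply: cvgV; [rewrite gt_eqF | exact: cm].
  have [M [M0 HM]] := compact_bounded_fun cX cI.
  have [N [N0 HN]] := compact_bounded_fun cX cf.
  exists (N * M); split; first exact: mulr_ge0.
  move=> x; have [h|h] := leP d (f x); last first.
    by rewrite (le_trans (ltW h)) // lerDl !mulr_ge0.
  have mg : m x = g x by rewrite /m max_l // (le_trans _ (g0 x)) // subr_le0.
  have fN : f x <= N by apply: le_trans (HN x); exact: ler_norm.
  have gM : 1 <= M * g x.
    rewrite -mg -ler_pdivrMr // mul1r; apply: le_trans (HM x); exact: ler_norm.
  have : N * 1 <= N * (M * g x) by rewrite ler_wpM2l.
  by rewrite mulrA mulr1; lra.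
have linf0 : 0 <= lin (tv L) f 0 1.
  have := @lin_le X _ (@tv_HX X L) (fun=> 0) f 0 1 (@cont_cst X R 0) cf (lexx _) ler01 (lexx _) f0.
  by rewrite (@lin_cst X _ (@tv_HX X L)) // mulr0.
rewrite ger0_norm //.
have cdg : continuous (fun x => d + C * g x).
  by apply: cont_add; [exact: cont_cst | apply: cont_mul => //; exact: cont_cst].
have := @lin_le X _ (@tv_HX X L) f _ 0 1 cf cdg (lexx _) ler01 (lexx _) HC.
rewrite (@lin_lin X _ (@tv_HX X L) (fun=> d) g C) //; last exact: cont_cst.
rewrite (@lin_cst X _ (@tv_HX X L)) // subr0 mul1r.
suff -> : lin (tv L) g 0 1 = 0 by rewrite mulr0 addr0.
have -> : g = fun x => \sum_(i < size l) 1 * w (nth s0 l i) x.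
  by apply/funext => x; apply: eq_bigr => i _; rewrite mul1r.
rewrite (@lin_sum X L (size l) (fun=> 1) (fun i => w (nth s0 l i))) //.
by rewrite big1 // => i _; rewrite linw mulr0.
Qed.

(** Openness of the projections of a cube as an operation: it moves [L'] continuously into the
    [E]-class of [L], and fixes it if it is already there. *)
Definition glue (E : set node) (L L' : T X) : T X :=
  Psi (mk_cube (f := fun j => if `[< E (inl j) >] then cu (Phi L) j else cu (Phi L') j)
    (fun j => if `[< E (inl j) >] as b return 0 <= (if b then cu (Phi L) j else cu (Phi L') j) <= 1
              then cuP (Phi L) j else cuP (Phi L') j)).

Lemma cu_glue E L L' j : cu (Phi (glue E L L')) j = if `[< E (inl j) >] then cu (Phi L) j else cu (Phi L') j.
Proof. by rewrite /glue PsiK cu_mk. Qed.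

Lemma glue_left E L L' : equivT E (glue E L L') L.
Proof. by move=> j Ej; rewrite cu_glue; case: asboolP. Qed.

Lemma glue_right E E' L L' : (forall j, E (inl j) -> E' (inl j) -> cu (Phi L) j = cu (Phi L') j) ->
  equivT E' (glue E L L') L'.
Proof. by move=> H j Ej; rewrite cu_glue; case: asboolP => // h; exact: H. Qed.

Lemma Phi_inj L L' : (forall j, cu (Phi L) j = cu (Phi L') j) -> L = L'.
Proof. by move=> H; rewrite -(PhiK L) -(PhiK L'); congr Psi; exact: cu_inj. Qed.

Lemma glue_equiv E L L' : equivT E L L' -> glue E L L' = L'.
Proof. by move=> H; apply: Phi_inj => j; rewrite cu_glue; case: asboolP => // /H. Qed.

Lemma glue_cont E : continuous (fun p : T X * T X => glue E p.1 p.2).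
Proof.
apply: (continuous_o cPsi); apply: cube_continuous => j.
under eq_fun do rewrite cu_mk.
case: asboolP => _.
  exact: (continuous_o (continuous_cu cPhi) (@continuous_fst _ _)).
exact: (continuous_o (continuous_cu cPhi) (@continuous_snd _ _)).
Qed.

Lemma eqX_closed E : closed [set p : X * X | eqX E p.1 p.2].
Proof.
have -> : [set p : X * X | eqX E p.1 p.2] =
   \bigcap_(phi in funs E) [set p : X * X | phi p.1 = phi p.2] by [].
apply: closed_bigI => phi /funs_cont cphi; apply: closed_coincidence; first exact: R_hausdorff.
  exact: (continuous_o cphi (@continuous_fst _ _)).
exact: (continuous_o cphi (@continuous_snd _ _)).
Qed.

(** As [y] tends to [x], [glue E (dl y) (dl x')] tends to [dl x'], and it is concentrated on the
    class of [y]. If that class missed [U], a function vanishing off [U] would have integral zero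
    there. *)
Lemma eqX_open E : out_closed E -> open_equiv (eqX E).
Proof.
move=> cE; split.
- by [].
- by move=> x y h phi Ephi; rewrite h.
- by move=> x y z h h' phi Ephi; rewrite h // h'.
- exact: eqX_closed.
move=> x x' U xx' nU.
have [||psi [cpsi psi01 psi1 psi0]] := @urysohn_cpt X (~` interior U) [set x'] hX cX _ (closed_point hX).
- by rewrite closedC; exact: open_interior.
- by apply/seteqP; split => // z [/= h zx]; apply: h; rewrite zx; exact: nU.
pose g y := lin (tv (glue E (dl y) (dl x'))) psi 0 1.
have cg : continuous g.
  apply: (continuous_o (@lin_tv_cont X psi 0 1)).
  apply: (continuous_o (@glue_cont E) (f := fun y => (dl y, dl x'))).
  by apply: continuous_pair; [exact: dl_cont | exact: cont_cst].
have gx : 0 < g x.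
  rewrite /g glue_equiv; last exact/equivT_dl.
  by rewrite lin_dl // psi0 // subr0 mulr1.
apply: filterS (near_gt (cg x) gx) => y gy; apply: contrapT => nH.
move: gy; rewrite /g (@equivT_dl_support E _ y psi) ?ltxx //; first exact: glue_left.
  by move=> z; have /andP[] := psi01 z.
move=> z yz; apply: psi1 => /interior_subset Uz; apply: nH; by exists z.
Qed.

Lemma move_coord E a L : ~ E (inl a) -> exists M, equivT E M L /\ cu (Phi M) a <> cu (Phi L) a.
Proof.
move=> nEa; pose k : R := if cu (Phi L) a == 0 then 1 else 0.
have k01 : 0 <= k <= 1.
  by rewrite /k; case: ifP; rewrite ?lexx ?ler01.
exists (glue E L (Psi (mk_cube (fun _ : J => k01)))); split; first exact: glue_left.
rewrite cu_glue; case: asboolP => // _; rewrite PsiK cu_mk /k.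
case: eqP => [->|h] /eqP; first by rewrite oner_eq0.
by rewrite eq_sym => /eqP.
Qed.

(** [L] is concentrated on the [E]-class of [y], on which every function of [E'] is constant. *)
Lemma equivT_dl_widen E E' L y : out_closed E -> out_closed E' -> equivT E L (dl y) ->
  (forall x, eqX E y x -> eqX E' y x) -> equivT E' L (dl y).
Proof.
move=> cE cE' EL yE; apply/(equivT_lin cE') => phi Ephi a b.
have cphi := funs_cont Ephi.
have [[_ [/= a0 [/ltW ab b1]]]|nok] := pselect (okS phi a b); last by rewrite /lin; case: pselect.
pose g x := `|phi x - phi y|.
have cg : continuous g by apply: cont_norm; apply: cont_sub => //; exact: cont_cst.
have g0 x : 0 <= g x by exact: normr_ge0.
have lg : lin (tv L) g 0 1 = 0.
  apply: (equivT_dl_support cE EL cg g0) => x /yE/(_ phi Ephi) h.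
  by rewrite /g h subrr normr0.
have lpos s t : 0 <= s -> s <= t -> t <= 1 -> 0 <= lin (tv L) g s t.
  move=> s0 st t1.
  have := @lin_le X _ (@tv_HX X L) (fun=> 0) g s t (@cont_cst X R 0) cg s0 st t1 g0.
  by rewrite (@lin_cst X _ (@tv_HX X L)) // mulr0.
have b0 := le_trans a0 ab; have a1 := le_trans ab b1.
have lgab : lin (tv L) g a b <= 0.
  move: lg; rewrite (@lin_add X _ (@tv_HX X L) g 0 a 1) // (@lin_add X _ (@tv_HX X L) g a b 1) //.
  by have := lpos 0 a (lexx _) a0 a1; have := lpos b 1 b0 b1 (lexx _); lra.
have up := @lin_le X _ (@tv_HX X L) phi (fun x => g x + phi y * 1) a b cphi
  (cont_add cg (@cont_cst X R (phi y * 1))) a0 ab b1.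
have dn := @lin_le X _ (@tv_HX X L) (fun x => phi y + (-1) * g x) phi a b
  (cont_add (@cont_cst X R (phi y)) (cont_mul (@cont_cst X R (-1)) cg)) cphi a0 ab b1.
rewrite (@lin_lin X _ (@tv_HX X L) g (fun=> 1)) // in up; last exact: cont_cst.
rewrite (@lin_lin X _ (@tv_HX X L) (fun=> phi y) g) // in dn; last exact: cont_cst.
rewrite !(@lin_cst X _ (@tv_HX X L)) // in up dn.
rewrite lin_dl //; apply/eqP; rewrite eq_le; apply/andP; split.
  suff : lin (tv L) phi a b <= lin (tv L) g a b + phi y * ((b - a) * 1) by move: lgab; lra.
  by apply: up => x; have := ler_norm (phi x - phi y); rewrite /g; lra.
suff : (b - a) * phi y + -1 * lin (tv L) g a b <= lin (tv L) phi a b by move: lgab; lra.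
by apply: dn => x; have := ler_norm (phi y - phi x); rewrite distrC /g; lra.
Qed.

(** Otherwise [equivT_dl_widen] would determine coordinate [a] on the whole [E]-class of [dl x], but
    that coordinate can be moved freely within the class. *)
Lemma class_escape E E' a x : out_closed E -> out_closed E' -> ~ E (inl a) -> E' (inl a) ->
  exists y, eqX E x y /\ ~ eqX E' x y.
Proof.
move=> cE cE' nE E'a; have [M [EM Ma]] := move_coord (dl x) nE.
apply: contrapT => nH; apply: Ma; apply: (equivT_dl_widen cE cE' EM _ E'a).
by move=> y xy; apply: contrapT => nxy; apply: nH; exists y.
Qed.

Lemma missing_coord (E : set node) : countable E -> exists a, ~ E (inl a).
Proof.
move=> cE; apply: contrapT => nH; apply: J_unc.
have /countable_injP[f finj] := cE.
have inE' j : E (inl j) by apply: contrapT => h; apply: nH; exists j.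
apply/countable_injP; exists (fun j => f (inl j)) => j j' _ _ ff.
by have [] : @inl J (S_HM X) j = inl j' by apply: finj; rewrite ?inE.
Qed.

Lemma eqX_nondegenerate E x : out_closed E -> countable E -> exists y, eqX E x y /\ x <> y.
Proof.
move=> cE /missing_coord[a nEa].
have [y [xy nxy]] := @class_escape E setT a x cE (fun _ _ _ => I) nEa I.
by exists y; split => // xEy; apply: nxy; rewrite xEy.
Qed.

(** Urysohn functions for the members of a countable base would generate a countable closed set
    whose class at [x] is a single point. *)
Lemma no_countable_local_base (x : X) (B : set (set X)) : local_base x B -> ~ countable B.
Proof.
move=> [B1 B2] cB; have [s sP] := countable_enum (set0 : set X) cB.
have /choice[f fP] : forall n, exists f : X -> R, continuous f /\
    (B (s n) -> f x = 1 /\ forall y, ~ s n y -> f y = 0).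
  move=> n; have [Bn|nBn] := pselect (B (s n)); last by exists (fun=> 0); split => //; exact: cont_cst.
  have [oU Ux] := B1 _ Bn.
  have [||f [cf _ f0 f1]] := @urysohn_cpt X (~` s n) [set x] hX cX _ (closed_point hX).
  - by rewrite closedC.
  - by apply/seteqP; split => // z [/= h zx]; apply: h; rewrite zx.
  by exists f; split => // _; split; [exact: f1 | exact: f0].
have okf n : okS (f n) 0 1 by split; [have [] := fP n | rewrite lexx ltr01].
pose E := \bigcup_(n in setT) gen (inr (mkS (okf n))).
have cE : out_closed E by apply: out_closed_bigcup => n _; exact: gen_closed.
have ctE : countable E by apply: bigcup_countable => // n _; exact: gen_countable.
have [y [xy /eqP nxy]] := eqX_nondegenerate x cE ctE.
have := hX; rewrite open_hausdorff => /(_ _ _ nxy)[[U V] /= [Ux Vy] [oU oV UV]].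
have [|W BW WU] := B2 U; first by apply: open_nbhs_nbhs; split => //; exact: set_mem.
have [n nW] := sP W BW; rewrite -nW in WU BW.
have [_ /(_ BW)[f1 f0]] := fP n.
have : f n x = f n y.
  by apply: xy; exists (mkS (okf n)) => //; exists n => //; exact: gen_self.
rewrite f1 f0 => [/eqP|/WU Uy]; first by rewrite oner_eq0.
have : (U `&` V) y by split => //; exact: set_mem.
by rewrite (eqP UV).
Qed.

(* If neither node generated the other, step functions oscillating between [p] and [x], respectively
   [p] and [y], could be glued along disjoint sets of coordinates.  As the oscillation gets faster,
   the glued elements converge to one and the same limit whether the two oscillations are in phase or
   in opposite phase, although the integral of [(phi - psi) ^ 2] is 0 in one case and 1 in the other. *)
Lemma gen_total (p : X) j1 j2 : gen (inl j2) (inl j1) \/ gen (inl j1) (inl j2).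
Proof.
apply: contrapT => nH; pose E1 := gen (inl j1); pose E2 := gen (inl j2).
have cE1 : out_closed E1 by exact: gen_closed.
have cE2 : out_closed E2 by exact: gen_closed.
have [x [px npx]] : exists x, eqX E2 p x /\ ~ eqX E1 p x.
  by apply: (@class_escape E2 E1 j1) => // [h|]; [apply: nH; left | exact: gen_self].
have [y [py npy]] : exists y, eqX E1 p y /\ ~ eqX E2 p y.
  by apply: (@class_escape E1 E2 j2) => // [h|]; [apply: nH; right | exact: gen_self].
have separate E z : ~ eqX E p z -> exists phi c d, [/\ funs E phi, c * phi p + d = 0 & c * phi z + d = 1].
  move=> npz; have [phi [Ephi neq]] : exists phi, funs E phi /\ phi p <> phi z.
    apply: contrapT => h; apply: npz => phi Ephi; apply: contrapT => h'; apply: h; by exists phi.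
  have neq' : phi z - phi p != 0 by rewrite subr_eq0 eq_sym; exact/eqP.
  exists phi, (phi z - phi p)^-1, (- ((phi z - phi p)^-1 * phi p)); split => //; first by rewrite subrr.
  by rewrite -mulrBr mulVf.
have [phi0 [c1 [d1 [Ephi phip phix]]]] := separate E1 x npx.
have [psi0 [c2 [d2 [Epsi psip psiy]]]] := separate E2 y npy.
have cphi0 := funs_cont Ephi; have cpsi0 := funs_cont Epsi.
pose phi z := c1 * phi0 z + d1; pose psi z := c2 * psi0 z + d2.
have cphi : continuous phi by exact: continuous_affine.
have cpsi : continuous psi by exact: continuous_affine.
have marg E L be (h : HM bool be) (a : bool -> X) f c d : out_closed E -> funs E f ->
    equivT E L (embT (HM_map a h)) -> forall i s t, 0 <= s -> s <= t -> t <= 1 ->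
    (forall r, s <= r < t -> be r = i) ->
    lin (tv L) (fun z => c * f z + d) s t = (t - s) * (c * f (a i) + d) /\
    lin (tv L) (fun z => (c * f z + d) ^+ 2) s t = (t - s) * (c * f (a i) + d) ^+ 2.
  move=> cE Ef /(equivT_lin cE) LE i s t s0 st t1 bei; have cf := funs_cont Ef.
  apply: lin_affine => //.
    by rewrite LE // embT_lin //; apply: hm_int_cst => // r /bei ->.
  rewrite LE ?embT_lin //; [|exact: cont_sqr|exact: (funs_sqr cE Ef)].
  by apply: hm_int_cst => // r /bei ->.
pose a i := if i then x else p; pose b i := if i then y else p.
pose F (z : T X * T X) := lin (tv (glue E1 z.1 z.2)) (fun q => (phi q - psi q) ^+ 2) 0 1.
have cF : continuous F by exact: (continuous_o (@lin_tv_cont X _ 0 1) (@glue_cont E1)).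
have glued be (h : HM bool be) (b' : bool -> X) : (forall i, eqX E1 p (b' i)) ->
    let M := glue E1 (embT (HM_map a h)) (embT (HM_map b' h)) in
    equivT E1 M (embT (HM_map a h)) /\ equivT E2 M (embT (HM_map b' h)).
  move=> b'p; split; first exact: glue_left.
  have stat E (c : bool -> X) : out_closed E -> (forall i, eqX E p (c i)) -> equivT E (embT (HM_map c h)) (dl p).
    move=> cE cp; apply/(equivT_lin cE) => f Ef s t; have cf := funs_cont Ef.
    have [[_ [/= s0 [/ltW st t1]]]|nok] := pselect (okS f s t); last by rewrite /lin; case: pselect.
    by rewrite embT_lin // lin_dl //; apply: hm_int_cst => // r _; apply/esym; exact: cp.
  (* On coordinates common to [E1] and [E2] both step functions look like [dl p], so gluing
     preserves both. *)
  apply: glue_right => j E1j E2j.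
  rewrite (stat E2 a cE2) //; last by case.
  by rewrite (stat E1 b' cE1).
pose z := (mixT (1 / 2) (dl (a false)) (dl (a true)), mixT (1 / 2) (dl (b false)) (dl (b true))).
have F0 : F z <= 0.
  rewrite leNgt; apply/negP => Fz.
  have [be [h /=]] := fast_oscillation (near_gt (cF z) Fz).
  have [|G1 G2] := glued be h b; first by case.
  rewrite ltNge => /negP; apply.
  apply: (@equal_marginals _ _ be phi psi (fun i => phi (a i)) (fun i => psi (b i))) => //.
  - by move=> i s t s0 st t1 bei; have [] := marg _ _ _ h a phi0 c1 d1 cE1 Ephi G1 i s t s0 st t1 bei.
  - by move=> i s t s0 st t1 bei; have [] := marg _ _ _ h a phi0 c1 d1 cE1 Ephi G1 i s t s0 st t1 bei.
  - by move=> i s t s0 st t1 bei; have [] := marg _ _ _ h b psi0 c2 d2 cE2 Epsi G2 i s t s0 st t1 bei.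
  - by move=> i s t s0 st t1 bei; have [] := marg _ _ _ h b psi0 c2 d2 cE2 Epsi G2 i s t s0 st t1 bei.
  - by case; rewrite /a /b /phi /psi ?phix ?psiy ?phip ?psip.
have F1 : 1 / 2 <= F z.
  rewrite leNgt; apply/negP => Fz.
  (* The opposite phase. The limit [z] does not change, because midpoints are symmetric. *)
  pose b' i := b (~~ i).
  have zE : z = (mixT (1 / 2) (dl (a false)) (dl (a true)), mixT (1 / 2) (dl (b' false)) (dl (b' true))).
    by rewrite /z; congr pair; exact: mixT_half_sym.
  have nz := near_lt (cF z) Fz; rewrite zE in nz.
  have [be [h /=]] := fast_oscillation nz.
  have [|G1 G2] := glued be h b'; first by case.
  move=> hF; have : 1 <= F (embT (HM_map a h), embT (HM_map b' h)); last by move: hF; rewrite /F /=; lra.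
  apply: (@distant_marginals _ _ be phi psi (fun i => phi (a i)) (fun i => psi (b' i))) => //.
  - by move=> i s t s0 st t1 bei; have [] := marg _ _ _ h a phi0 c1 d1 cE1 Ephi G1 i s t s0 st t1 bei.
  - by move=> i s t s0 st t1 bei; have [] := marg _ _ _ h b' psi0 c2 d2 cE2 Epsi G2 i s t s0 st t1 bei.
  - by case; rewrite /a /b' /b /phi /psi /= ?phix ?psiy ?phip ?psip ?subr0 ?sub0r ?sqrrN expr1n.
by move: F0 F1; lra.
Qed.

Lemma enumerate_funs (E : set node) : countable E -> exists c : nat -> X -> R,
  (forall n, continuous (c n)) /\ forall x y, (forall n, c n x = c n y) <-> eqX E x y.
Proof.
move=> cE; have [s sP] := countable_enum (inr (mkS okS_zero) : node) cE.
exists (fun n x => if s n is inr t then if `[< E (inr t) >] then (sval t).1.1 x else 0 else 0); split.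
  move=> n; case: (s n) => [j|t]; first exact: cont_cst.
  by case: asboolP => _; [have [] := svalP t | exact: cont_cst].
move=> x y; split=> [H _ [t Et <-]|H n].
  by have [n sn] := sP _ Et; have := H n; rewrite sn; case: asboolP.
case: (s n) => [//|t]; case: asboolP => // Et.
by apply: H; exists t.
Qed.

Lemma dl_inj (x y : X) : dl x = dl y -> x = y.
Proof.
move=> E; apply: contrapT => xy.
have [|f [cf _ fx fy]] := urysohn_cpt (A := [set x]) (B := [set y]) hX cX
  (@closed_point _ x hX) (@closed_point _ y hX).
  by apply/seteqP; split => // z [/= -> /xy].
have := lin_dl x cf (lexx 0) ler01 (lexx 1); rewrite E lin_dl // (fx x) // (fy y) // !subr0 mulr1 mulr0.
by move/eqP; rewrite oner_eq0.
Qed.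

Definition stage := {E : set node | out_closed E /\ countable E}.
Definition mk_stage (E : set node) (h : out_closed E /\ countable E) : stage := exist _ E h.
Definition stage_le (a b : stage) := sval a `<=` sval b.

Lemma stage_union (B : set stage) : countable B ->
  exists c : stage, sval c = \bigcup_(a in B) sval a.
Proof.
move=> cB; have h : out_closed (\bigcup_(a in B) sval a) /\ countable (\bigcup_(a in B) sval a).
  split; first by apply: out_closed_bigcup => a _; have [] := svalP a.
  by apply: bigcup_countable => // a _; have [] := svalP a.
by exists (mk_stage h).
Qed.

Lemma cube_openly_generated (x0 : X) : openly_generated X.
Proof.
have po : partial_order stage stage_le.
  split; [by move=> a n|split; [by move=> a b c ab bc n /ab; exact: bc|]].
  move=> [E HE] [E' HE'] ab ba.
  have EE' : E = E' by apply/seteqP; split; [exact: ab | exact: ba].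
  by subst E'; congr exist; exact: Prop_irrelevance.
have lubE (B : set stage) c : sval c = \bigcup_(a in B) sval a -> is_lub stage stage_le B c.
  move=> cE; split=> [b Bb n bn|u ub n]; first by rewrite cE; exists b.
  by rewrite cE => -[b Bb bn]; exact: (ub b Bb).
have oc : omega_complete stage stage_le.
  by move=> B /stage_union[c cE]; exists c; exact: lubE.
have /choice[c cP] : forall a : stage, exists c : nat -> X -> R,
    (forall n, continuous (c n)) /\ forall x y, (forall n, c n x = c n y) <-> eqX (sval a) x y.
  by move=> a; apply: enumerate_funs; have [] := svalP a.
have eE a : (fun x y => forall n, c a n x = c a n y) = eqX (sval a).
  by apply/funext => x; apply/funext => y; apply/propext; have [_] := cP a.
apply: (@openly_generated_of_functions X stage stage_le c x0 cX po _ oc).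
- split; first by have [a _] := oc set0 (countable0 _); exists a.
  move=> a b _ _; have [d [ub _]] := oc [set a; b] (finite_set_countable (finite_set2 a b)).
  by exists d => //; split; apply: ub; [left | right].
- by move=> a n; have [h _] := cP a; exact: h.
- by move=> a; rewrite eE; apply: eqX_open; have [] := svalP a.
- move=> a b ab x y /(cP b).2 H; apply/(cP a).2 => phi [s /ab Es <-].
  by apply: H; exists s.
- move=> B a cB dB [_ la] x y H; apply/(cP a).2 => phi [s Es <-].
  have [d dE] := stage_union cB.
  have ad : stage_le a d by apply: la => b Bb n bn; rewrite dE; exists b.
  have := ad _ Es; rewrite dE => -[b Bb bs].
  by apply: ((cP b).2 x y).1; [exact: H | exists s].
- move=> x y H; apply: dl_inj; apply: Phi_inj => j.
  have h : out_closed (gen (inl j)) /\ countable (gen (inl j)) by split; [exact: gen_closed | exact: gen_countable].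
  have xy : eqX (gen (inl j)) x y by apply: ((cP (mk_stage h)).2 x y).1; exact: H.
  have exy : equivT (gen (inl j)) (dl x) (dl y) by apply/equivT_dl => //; exact: gen_closed.
  by apply: exy; exact: gen_self.
Qed.

(** [M] consists of the coordinates not generated by earlier ones in a well-order of [J]. The least
    coordinate generating [j] is in [M], so [M] generates everything; and by [gen_total] each of its
    members generates all earlier coordinates, which are therefore countably many. *)
Lemma cube_weight (x0 : X) : exists B : set (set X), basis B /\ card_le_omega1 B.
Proof.
have [lt [irr tr tot mn]] := well_order_exists J.
pose M : set J := [set m | forall i, lt i m -> ~ gen (inl i) (inl m)].
have Mcof j : exists2 m, M m & gen (inl m) (inl j).
  have [|m mj mmin] := mn [set m | gen (inl m) (inl j)]; first by exists j; exact: gen_self.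
  exists m => // i im h; apply: (mmin i) => //.
  exact: (gen_min (@gen_closed _) h).
have M1 : card_le_omega1 M.
  exists lt; split; [|split; [|split; [|split]]].
  - by move=> i _; exact: irr.
  - by move=> i j k _ _ _; exact: tr.
  - by move=> i j _ _; exact: tot.
  - by move=> P _; exact: mn.
  move=> m Mm; have /countable_injP[f finj] := gen_countable (inl m).
  apply/countable_injP; exists (fun i => f (inl i)) => i j; rewrite !inE => -[Mi im] [Mj jm] ff.
  have gm k : lt k m -> gen (inl m) (inl k) by move=> km; have [//|h] := gen_total x0 k m; case: (Mm k km).
  by have [] : inl i = inl j :> node by apply: finj => //; rewrite inE; exact: gm.
have /choice[V VP] : forall j, exists V : nat -> set X, (forall n, open (V n)) /\
    forall x U, open U -> (forall y, eqX (gen (inl j)) x y -> U y) -> exists n, V n x /\ V n `<=` U.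
  move=> j; have [c [cc cE]] := enumerate_funs (gen_countable (inl j)).
  have [V [oV bV]] := function_basis cX cc; exists V; split => // x U oU xU.
  by apply: bV => // y /cE; exact: xU.
exists [set y | exists m n, M m /\ V m n = y]; split; last exact: countable_initial_union.
split=> [_ [m [n [_ <-]]]|x U nU]; first by have [h _] := VP m; exact: h.
have [j0 _] := J_inhabited; have [m0 Mm0 _] := Mcof j0.
have [m [Mm mU]] : exists m, M m /\ forall y, eqX (gen (inl m)) x y -> interior U y.
  apply: contrapT => nH.
  have [[m Mm]|[m Mm]|[m Mm] [m' Mm']|y Hy] := compact_directed cX
      (F := fun m : {m | M m} => eqX (gen (inl (sval m))) x `&` ~` interior U) (exist _ m0 Mm0).
  - apply: closedI; last by rewrite closedC; exact: open_interior.
    exact: (closed_pre (@continuous_pairl X X x) (@eqX_closed (gen (inl m)))).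
  - apply: contrapT => h; apply: nH; exists m; split => // y xy; apply: contrapT => nUy.
    by apply: h; exists y.
  - have [h|h] := gen_total x0 m m'.
      exists (exist _ m' Mm') => y [xy nUy]; split; split => //= phi [s Es <-].
      by apply: xy; exists s => //; exact: (gen_min (@gen_closed _) h).
    exists (exist _ m Mm) => y [xy nUy]; split; split => //= phi [s Es <-].
    by apply: xy; exists s => //; exact: (gen_min (@gen_closed _) h).
  have xy : x = y.
    apply: dl_inj; apply: Phi_inj => j; have [m Mm mj] := Mcof j.
    have [my _] := Hy (exist _ m Mm).
    have exy : equivT (gen (inl m)) (dl x) (dl y) by apply/equivT_dl => //; exact: gen_closed.
    by apply: exy.
  by have [_] := Hy (exist _ m0 Mm0); apply; rewrite -xy; exact: nU.
have [_ bV] := VP m; have [n [Vx VU]] := bV x _ (@open_interior _ U) mU.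
by exists (V m n); [split => //; exists m, n | exact: subset_trans VU (@interior_subset _ U)].
Qed.

Lemma basis_local_base (B : set (set X)) (x : X) : basis B -> local_base x [set U | B U /\ U x].
Proof.
move=> [oB bB]; split; first by move=> U [/oB].
by move=> V /(bB x)[U BU UV]; exists U.
Qed.

Lemma cube_weight_omega1 (x0 : X) : weight_omega1 X.
Proof.
split; first exact: cube_weight.
move=> [B cB bB]; apply: (no_countable_local_base (basis_local_base x0 bB)).
by apply: sub_countable cB; apply: subset_card_le => U [].
Qed.

(** Every local base is uncountable, and every point has one of size at most omega_1. *)
Lemma cube_chi_homogeneous : chi_homogeneous X.
Proof.
move=> x y By lBy; have [B [bB B1]] := cube_weight x.
exists [set U | B U /\ U x]; split; first exact: basis_local_base.
apply: card_le_trans (card_le_omega1_uncountable B1 (no_countable_local_base lBy)).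
by apply: subset_card_le => U [].
Qed.

End CubeHX.

Lemma homeomorphic_maps (V U : topologicalType) (A : set V) (B : set U) : homeomorphic A B ->
  exists (f : set_type A -> set_type B) (g : set_type B -> set_type A),
  [/\ continuous f, continuous g, forall a, g (f a) = a & forall b, f (g b) = b].
Proof.
move=> [f [g [fB [gA [gf [fg [cf cg]]]]]]].
exists (fun a => SigSub (mem_set (fB _ (set_valP a)))), (fun b => SigSub (mem_set (gA _ (set_valP b)))).
split.
- by apply: set_type_continuous; move/subspace_sigL_continuousP: cf.
- by apply: set_type_continuous; move/subspace_sigL_continuousP: cg.
- by move=> a; apply: val_inj; apply: gf; exact: set_valP.
- by move=> b; apply: val_inj; apply: fg; exact: set_valP.
Qed.

Theorem theorem1p3 (X : topologicalType) :
  hausdorff_space X -> compact [set: X] ->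
  ((exists J : Type, ~ countable [set: J] /\ homeomorphic (HX X) (tychonov_cube J))
   <->
   (openly_generated X /\ chi_homogeneous X /\ weight_omega1 X)).
Proof.
move=> hX cX; split => [[J [ncJ /homeomorphic_maps[Phi [Psi [cPhi cPsi PhiK PsiK]]]]]|[og [chi w1]]]; last first.
  exact: tychonov_of_openly_generated.
have z01 (j : J) : 0 <= (0 : R) <= 1 by rewrite lexx ler01.
(* The cube has a point, so [HX] is nonempty and there is a step function [al]; [al 0] is then a
   point of [X]. *)
have [_ [[al _ _] _]] := @tv_HX X (Psi (mk_cube z01)) setT filterT.
split; [|split].
- exact: (@cube_openly_generated X J cX hX Phi Psi cPhi cPsi PhiK PsiK ncJ (al 0)).
- exact: (@cube_chi_homogeneous X J cX hX Phi Psi cPhi cPsi PhiK PsiK ncJ).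
- exact: (@cube_weight_omega1 X J cX hX Phi Psi cPhi cPsi PhiK PsiK ncJ (al 0)).
Qed.
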